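(* Let $\pi$ be a set of primes and let $A\le\mathbb{C}^\times$ be the group generated by all $p^n$-th roots of unity, for all $n\in\mathbb{Z}^+$ and all $p\in\pi$. There is an isomorphism of $A$-fibered biset functors $$\mathbb{C}R_{\mathbb{C}}\;\cong\;\bigoplus_{(m,\zeta)\in[\Upsilon_\pi]} S^A_{\mathbb{Z}/m\mathbb{Z},1,1,\mathbb{C}_\zeta},$$ where $[\Upsilon_\pi]$ is the set of all pairs $(m,\zeta)$ such that $m\in\mathbb{N}$ is a $\pi'$-number (not divisible by any prime in $\pi$) and $\zeta$ is a primitive character of $\mathrm{Aut}(\mathbb{Z}/m\mathbb{Z})$.
   Context: **Fibered bisets.** For an abelian group $A$ and finite groups $G,H$, an $A$-fibered $(G,H)$-biset is a $(G,H)$-biset $X$ with a commuting $A$-action that is free with finitely many orbits. $B^A(G,H)$ is the Grothendieck group of isomorphism classes of $A$-fibered $(G,H)$-bisets with respect to disjoint union. For an $A$-fibered $(G,H)$-biset $X$ and an $A$-fibered $(H,K)$-biset $Y$, the tensor product $X\otimes_{AH}Y$ is the $A$-fibered $(G,K)$-biset consisting of the free $A$-orbits in the quotient of $X\times Y$ by the relations $(x\cdot(a,h),y)\sim(x,(a,h)\cdot y)$, $(a,h)\in A\times H$. **Functors.** Let $\mathcal{C}$ be the category whose objects are finite groups, with $\mathrm{Hom}_{\mathcal C}(G,H)=\mathbb{C}\otimes_{\mathbb Z} B^A(H,G)$ and composition the bilinear extension of the tensor product. An $A$-fibered biset functor (over $\mathbb{C}$) is a $\mathbb{C}$-linear functor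 from $\mathcal{C}$ to $\mathbb{C}$-vector spaces. **The functor $\mathbb{C}R_{\mathbb{C}}$.** For $A\le\mathbb{C}^\times$, $\mathbb{C}R_{\mathbb{C}}(G)=\mathbb{C}\otimes_{\mathbb Z} R_{\mathbb C}(G)$, where $R_{\mathbb C}(G)$ is the complex character ring. An $A$-fibered $(H,G)$-biset $Y$ sends the class of a $\mathbb{C}G$-module $M$ to the class of $\mathbb{C}Y\otimes_{\mathbb{C}G}M$, where $\mathbb{C}Y$ is the $(\mathbb{C}H,\mathbb{C}G)$-bimodule obtained from the free vector space on $Y$ by identifying the element $a\cdot y$ of $Y$ with the scalar multiple $a\,y$ ($a\in A$, $y\in Y$). **Simple functors.** Let $E_G=\mathrm{End}_{\mathcal C}(G)$, let $I_G$ be the ideal of $E_G$ generated by endomorphisms factoring through a group of order smaller than $|G|$, and $\bar E_G=E_G/I_G$. For each simple $\bar E_G$-module $V$ there is a unique (up to isomorphism) simple $A$-fibered biset functor $S$ with $S(G)\cong V$ and $S(H)=0$ for all $H$ with $|H|<|G|$ ($G$ is a minimal group of $S$). If $m$ is a $\pi'$-number and $G=\mathbb{Z}/m\mathbb{Z}$, then $\bar E_G\cong\mathbb{C}\mathrm{Aut}(G)$, with $\sigma\in\mathrm{Aut}(G)$ corresponding to the class of the biset $\mathrm{Iso}^\sigma$, namely the set $G$ with left multiplication and right action through $\sigma$ (with trivial fiber, i.e. $A\times G$ as an $A$-fibered biset). $\mathbb{C}_\zeta$ is the one-dimensional $\mathbb{C}\mathrm{Aut}(G)$-module with character $\zeta$,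 and $S^A_{\mathbb{Z}/m\mathbb{Z},1,1,\mathbb{C}_\zeta}$ is the simple $A$-fibered biset functor with minimal group $\mathbb{Z}/m\mathbb{Z}$ and evaluation $\mathbb{C}_\zeta$ at $\mathbb{Z}/m\mathbb{Z}$. **Primitive characters.** Identify $\mathrm{Aut}(\mathbb{Z}/m\mathbb{Z})=(\mathbb{Z}/m\mathbb{Z})^\times$ via $\sigma\mapsto\sigma(1)$. A character $\zeta:(\mathbb{Z}/m\mathbb{Z})^\times\to\mathbb{C}^\times$ is primitive if it is not induced from a character of $(\mathbb{Z}/d\mathbb{Z})^\times$ for a proper divisor $d$ of $m$. (For $m=1$ the trivial character is primitive.) *)

(* Defs.v *)
From HB Require Import structures.
From mathcomp Require Import all_boot all_order all_algebra all_fingroup.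
From mathcomp Require Import all_solvable all_field all_character.
From mathcomp Require Import boolp classical_sets functions cardinality reals.
From mathcomp Require Import complex.

Set Implicit Arguments.
Unset Strict Implicit.
Unset Printing Implicit Defensive.

Import GRing.Theory.

Local Open Scope ring_scope.

Section Quotient.
Variables (T : Type) (e : T -> T -> Prop).

Inductive eqv : T -> T -> Prop :=
| eqv_step x y : e x y -> eqv x y
| eqv_refl x : eqv x x
| eqv_sym x y : eqv x y -> eqv y x
| eqv_trans x y z : eqv x y -> eqv y z -> eqv x z.

Definition quot := {P : T -> Prop | exists x, P = eqv x}.

Definition cls (x : T) : quot := exist _ (eqv x) (ex_intro _ x erefl).

Definition repr (q : quot) : T := sval (cid (svalP q)).

Lemma quot_eq (p q : quot) : sval p = sval q -> p = q.
Proof.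
case: p q => [p hp] [q hq] /= epq; case: q / epq hq => hq.
by congr exist; apply: Prop_irrelevance.
Qed.

Lemma reprK q : cls (repr q) = q.
Proof. by apply: quot_eq; rewrite /repr /=; case: cid => x /= ->. Qed.

Lemma cls_eqv x y : eqv x y -> cls x = cls y.
Proof.
move=> exy; apply: quot_eq => /=; apply/funext => z; apply/propext; split => h.
  exact: eqv_trans (eqv_sym exy) h.
exact: eqv_trans exy h.
Qed.

Lemma eqv_repr x : eqv (repr (cls x)) x.
Proof.
have /(congr1 sval) /= E := reprK (cls x).
by rewrite E; apply: eqv_refl.
Qed.

Lemma eqv_inv (U : Type) (f : T -> U) :
  (forall x y, e x y -> f x = f y) -> forall x y, eqv x y -> f x = f y.
Proof.
move=> h x y; elim=> {x y} [x y /h|x|x y _ ->|x y z _ -> _ ->] //.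
Qed.

Lemma quot_ind (P : quot -> Prop) : (forall x, P (cls x)) -> forall q, P q.
Proof. by move=> h q; rewrite -(reprK q). Qed.

End Quotient.

Inductive lexp (R T : Type) :=
| Lgen of T
| Lzero
| Ladd of lexp R T & lexp R T
| Lscale of R & lexp R T.
Arguments Lgen {R T}.
Arguments Lzero {R T}.
Arguments Ladd {R T}.
Arguments Lscale {R T}.

(* [pres rel] is the R-module with generators T and relations rel : formal    *)
(* R-linear combinations modulo the congruence generated by the module axioms *)
(* and by rel                                                                 *)
Section Presentation.
Variables (R : pzRingType) (T : Type) (rel : lexp R T -> lexp R T -> Prop).

Inductive peq : lexp R T -> lexp R T -> Prop :=
| peq_rel x y : rel x y -> peq x y
| peq_refl x : peq x x
| peq_sym x y : peq x y -> peq y x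
| peq_trans x y z : peq x y -> peq y z -> peq x z
| peq_add x x' y y' : peq x x' -> peq y y' -> peq (Ladd x y) (Ladd x' y')
| peq_scale c x x' : peq x x' -> peq (Lscale c x) (Lscale c x')
| peq_addA x y z : peq (Ladd x (Ladd y z)) (Ladd (Ladd x y) z)
| peq_addC x y : peq (Ladd x y) (Ladd y x)
| peq_add0 x : peq (Ladd Lzero x) x
| peq_addN x : peq (Ladd (Lscale (-1) x) x) Lzero
| peq_scaleA a b x : peq (Lscale a (Lscale b x)) (Lscale (a * b) x)
| peq_scale1 x : peq (Lscale 1 x) x
| peq_scaleDr a x y :
    peq (Lscale a (Ladd x y)) (Ladd (Lscale a x) (Lscale a y))
| peq_scaleDl a b x :
    peq (Lscale (a + b) x) (Ladd (Lscale a x) (Lscale b x)).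

Definition pres : Type := quot peq.

HB.instance Definition _ := gen_eqMixin pres.
HB.instance Definition _ := gen_choiceMixin pres.

Let pi x : pres := cls peq x.

Let piE x y : peq x y -> pi x = pi y.
Proof. by move=> h; apply/cls_eqv/eqv_step. Qed.

Let peq_repr x : peq (repr (pi x)) x.
Proof.
have H a b : eqv peq a b -> peq a b.
  elim=> [//|||]; [exact: peq_refl | by move=> ? ? _ /peq_sym |].
  by move=> ? ? ? _ h _; apply: peq_trans h.
exact/H/eqv_repr.
Qed.

Definition padd (p q : pres) := pi (Ladd (repr p) (repr q)).
Definition pscale (c : R) (p : pres) := pi (Lscale c (repr p)).

Let paddE x y : padd (pi x) (pi y) = pi (Ladd x y).
Proof. by apply: piE; apply: peq_add; apply: peq_repr. Qed.
Let pscaleE c x : pscale c (pi x) = pi (Lscale c x).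
Proof. by apply: piE; apply: peq_scale; apply: peq_repr. Qed.

Let paddA : associative padd.
Proof.
elim/quot_ind=> x; elim/quot_ind=> y; elim/quot_ind=> z.
rewrite (paddE y z) (paddE x (Ladd y z)) (paddE x y) (paddE (Ladd x y) z).
exact/piE/peq_addA.
Qed.
Let paddC : commutative padd.
Proof.
elim/quot_ind=> x; elim/quot_ind=> y.
by rewrite (paddE x y) (paddE y x); apply/piE/peq_addC.
Qed.
Let padd0 : left_id (pi Lzero) padd.
Proof. by elim/quot_ind=> x; rewrite (paddE _ x); apply/piE/peq_add0. Qed.
Let paddN : left_inverse (pi Lzero) (pscale (-1)) padd.
Proof.
elim/quot_ind=> x; rewrite (pscaleE _ x) (paddE (Lscale _ x) x).
exact/piE/peq_addN.
Qed.

HB.instance Definition _ := GRing.isZmodule.Build pres paddA paddC padd0 paddN.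

Let addE x y : pi x + pi y = pi (Ladd x y). Proof. exact: paddE. Qed.

Let pscaleA a b p : pscale a (pscale b p) = pscale (a * b) p.
Proof.
elim/quot_ind: p => x.
rewrite (pscaleE b x) (pscaleE a (Lscale b x)) (pscaleE (a * b) x).
exact/piE/peq_scaleA.
Qed.
Let pscale1 : left_id 1 pscale.
Proof. by elim/quot_ind=> x; rewrite (pscaleE 1 x); apply/piE/peq_scale1. Qed.
Let pscaleDr : right_distributive pscale +%R.
Proof.
move=> a; elim/quot_ind=> x; elim/quot_ind=> y.
rewrite (addE x y) (pscaleE a (Ladd x y)) (pscaleE a x) (pscaleE a y) addE.
exact/piE/peq_scaleDr.
Qed.
Let pscaleDl p : {morph pscale^~ p : a b / a + b}.
Proof.
elim/quot_ind: p => x a b.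
rewrite (pscaleE (a + b) x) (pscaleE a x) (pscaleE b x) addE.
exact/piE/peq_scaleDl.
Qed.

HB.instance Definition _ :=
  GRing.Zmodule_isLmodule.Build R pres pscaleA pscale1 pscaleDr pscaleDl.

Let scaleE a x : a *: pi x = pi (Lscale a x). Proof. exact: pscaleE. Qed.

Definition pgen (t : T) : pres := pi (Lgen t).

Fixpoint leval (V : lmodType R) (f : T -> V) (x : lexp R T) : V :=
  match x with
  | Lgen t => f t
  | Lzero => 0
  | Ladd x y => leval f x + leval f y
  | Lscale c x => c *: leval f x
  end.

Let leval_pgen x : leval pgen x = pi x.
Proof.
elim: x => //= [x -> y ->|c x ->]; first exact: addE.
exact: scaleE.
Qed.

Lemma pgen_rel x y : rel x y -> leval pgen x = leval pgen y.
Proof. by rewrite !leval_pgen => h; apply: piE; exact: peq_rel. Qed.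

Lemma pres_ind (P : pres -> Prop) :
    (forall t, P (pgen t)) -> P 0 -> (forall x y, P x -> P y -> P (x + y)) ->
    (forall c x, P x -> P (c *: x)) ->
  forall x, P x.
Proof.
move=> Pg P0 PD PZ; elim/quot_ind; elim=> [//|//|x Px y Py|c x Px].
  by rewrite -[cls _ _](addE x y); apply: PD.
by rewrite -[cls _ _](scaleE c x); apply: PZ.
Qed.

Lemma pres_ext (V : lmodType R) (f g : {linear pres -> V}) :
  (forall t, f (pgen t) = g (pgen t)) -> f =1 g.
Proof.
move=> fg; elim/pres_ind=> [//||x y ex ey|c x ex]; rewrite ?linear0 //.
  by rewrite !linearD ex ey.
by rewrite !linearZ ex.
Qed.

Section Lift.
Variables (V : lmodType R) (f : T -> V).
Hypothesis f_rel : forall x y, rel x y -> leval f x = leval f y.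

Let leval_peq x y : peq x y -> leval f x = leval f y.
Proof.
elim=> {x y} //=.
- by move=> x y z _ -> _ ->.
- by move=> x x' y y' _ -> _ ->.
- by move=> c x x' _ ->.
- by move=> x y z; rewrite addrA.
- by move=> x y; rewrite addrC.
- by move=> x; rewrite add0r.
- by move=> x; rewrite scaleN1r addNr.
- by move=> a b x; rewrite scalerA.
- by move=> x; rewrite scale1r.
- by move=> a x y; rewrite scalerDr.
- by move=> a b x; rewrite scalerDl.
Qed.

Definition pres_lift (p : pres) : V := leval f (repr p).

Let liftE x : pres_lift (pi x) = leval f x.
Proof. exact/leval_peq/peq_repr. Qed.

Lemma pres_lift_linear : linear pres_lift.
Proof.
move=> c; elim/quot_ind=> x; elim/quot_ind=> y.
by rewrite (scaleE c x) (addE (Lscale c x) y) !liftE.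
Qed.

Definition plift : {linear pres -> V} :=
  HB.pack pres_lift (GRing.isLinear.Build _ _ _ _ _ pres_lift_linear).

Lemma plift_gen t : plift (pgen t) = f t. Proof. exact: liftE. Qed.
End Lift.

End Presentation.

(* Grothendieck group of the objects T, taken up to the isomorphism relation  *)
(* iso, with respect to the sum sum                                           *)
Section Grothendieck.
Variables (T : Type) (iso : T -> T -> Prop) (sum : T -> T -> T).

Inductive K0_rel : lexp int T -> lexp int T -> Prop :=
| K0_iso x y : iso x y -> K0_rel (Lgen x) (Lgen y)
| K0_sum x y : K0_rel (Lgen (sum x y)) (Ladd (Lgen x) (Lgen y)).

Definition K0 : zmodType := pres K0_rel.
End Grothendieck.

(* The C-module generated by the c (x) v: only additivity in v has to be       *)
(* imposed, since tensZ is already the free C-module on V modulo relations.   *)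
Section Scalars.
Variables (C : fieldType) (V : zmodType).

Inductive tensZ_rel : lexp C V -> lexp C V -> Prop :=
| tensZ_add v w : tensZ_rel (Lgen (v + w)) (Ladd (Lgen v) (Lgen w)).

Definition tensZ : lmodType C := pres tensZ_rel.
End Scalars.

Section CK0.
Variables (C : fieldType) (T : Type) (iso : T -> T -> Prop) (sum : T -> T -> T).

Definition CK0 : lmodType C := tensZ C (K0 iso sum).

Definition kgen (t : T) : CK0 := pgen (@tensZ_rel C _) (pgen (K0_rel iso sum) t).

Lemma kgen_iso x y : iso x y -> kgen x = kgen y.
Proof.
by move=> h; rewrite /kgen; have /= -> := pgen_rel (K0_iso sum h).
Qed.

Lemma kgen_sum x y : kgen (sum x y) = kgen x + kgen y.
Proof.
rewrite /kgen; have /= -> := pgen_rel (K0_sum iso sum x y).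
exact: (pgen_rel (tensZ_add C _ _)).
Qed.

Lemma CK0_ext (W : lmodType C) (f g : {linear CK0 -> W}) :
  (forall t, f (kgen t) = g (kgen t)) -> f =1 g.
Proof.
move=> fg; apply: pres_ext => u.
have genD (h : {linear CK0 -> W}) (v w : K0 iso sum) :
    h (pgen _ (v + w)) = h (pgen _ v) + h (pgen _ w).
  by have /= -> := pgen_rel (tensZ_add C v w); rewrite linearD.
have gen0 (h : {linear CK0 -> W}) : h (pgen _ 0) = 0.
  by apply: (addrI (h (pgen _ 0))); rewrite -genD !addr0.
have genN (h : {linear CK0 -> W}) (v : K0 iso sum) :
    h (pgen _ (- v)) = - h (pgen _ v).
  by apply/eqP; rewrite -addr_eq0 -genD addNr gen0.
have genMn (h : {linear CK0 -> W}) (v : K0 iso sum) n :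
    h (pgen _ (v *+ n)) = h (pgen _ v) *+ n.
  by elim: n => [|n IH]; rewrite ?gen0 // !mulrS genD IH.
elim/pres_ind: u => [t||x y ex ey|c x ex]; first exact: fg.
- by rewrite !gen0.
- by rewrite !genD ex ey.
have -> : c *: x = (x : K0 iso sum) *~ c by rewrite -[c in LHS]intz scaler_int.
by case: c => n; rewrite ?NegzE ?mulrNz ?genN -?pmulrn !genMn ex.
Qed.


Section Lift.
Variables (W : lmodType C) (f : T -> W).
Hypothesis f_iso : forall x y, iso x y -> f x = f y.
Hypothesis f_sum : forall x y, f (sum x y) = f x + f y.

Let f_rel : forall x y, K0_rel iso sum x y ->
  leval (V := zmodule W) f x = leval (V := zmodule W) f y.
Proof. by move=> _ _ []; [exact: f_iso | exact: f_sum]. Qed.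

Let lift0 := plift f_rel.

Let lift0_rel : forall x y, @tensZ_rel C (K0 iso sum) x y ->
  leval (V := W) lift0 x = leval (V := W) lift0 y.
Proof. by move=> _ _ [v w]; apply: (linearD lift0). Qed.

Definition klift : {linear CK0 -> W} := plift lift0_rel.

Lemma klift_gen t : klift (kgen t) = f t.
Proof. by rewrite /klift plift_gen /lift0 plift_gen. Qed.
End Lift.
End CK0.

Section BilinearLift.
Variables (C : fieldType) (W : lmodType C).
Variables (T1 : Type) (iso1 : T1 -> T1 -> Prop) (sum1 : T1 -> T1 -> T1).
Variables (T2 : Type) (iso2 : T2 -> T2 -> Prop) (sum2 : T2 -> T2 -> T2).
Variable b : T1 -> T2 -> W.
Hypothesis b_isol : forall x x' y, iso1 x x' -> b x y = b x' y.
Hypothesis b_suml : forall x x' y, b (sum1 x x') y = b x y + b x' y.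
Hypothesis b_isor : forall x y y', iso2 y y' -> b x y = b x y'.
Hypothesis b_sumr : forall x y y', b x (sum2 y y') = b x y + b x y'.

Let br x : {linear CK0 C iso2 sum2 -> W} := klift (@b_isor x) (@b_sumr x).

Let br_iso v x x' : iso1 x x' -> br x v = br x' v.
Proof.
by move=> h; apply: CK0_ext => t; rewrite /br !klift_gen; apply: b_isol.
Qed.

Let br_sum v x x' : br (sum1 x x') v = br x v + br x' v.
Proof.
have lin : linear (fun v => br x v + br x' v).
  by move=> c u w; rewrite !linearP scalerDr addrACA.
pose h : {linear CK0 C iso2 sum2 -> W} :=
  HB.pack (fun v => br x v + br x' v) (GRing.isLinear.Build _ _ _ _ _ lin).
rewrite -[RHS]/(h v); apply: CK0_ext => t.
rewrite -[RHS]/(br x (kgen C iso2 sum2 t) + br x' (kgen C iso2 sum2 t)).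
by rewrite /br !klift_gen; apply: b_suml.
Qed.

Definition kbilin (u : CK0 C iso1 sum1) (v : CK0 C iso2 sum2) : W :=
  klift (f := br^~ v) (@br_iso v) (@br_sum v) u.

Lemma kbilin_gen x y : kbilin (kgen _ _ _ x) (kgen _ _ _ y) = b x y.
Proof. by rewrite /kbilin klift_gen /br klift_gen. Qed.

Lemma kbilin_linearl v : linear (kbilin^~ v).
Proof. exact: linearP. Qed.

Lemma kbilin_linearr u : linear (kbilin u).
Proof.
move=> c v w.
have lin : linear (fun u => c *: kbilin u v + kbilin u w).
  move=> a x y; rewrite !kbilin_linearl !scalerDr !scalerA [c * a]mulrC.
  by rewrite addrACA.
pose h : {linear CK0 C iso1 sum1 -> W} :=
  HB.pack (fun u => c *: kbilin u v + kbilin u w)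
    (GRing.isLinear.Build _ _ _ _ _ lin).
rewrite -[RHS]/(h u) /kbilin; apply: CK0_ext => t.
rewrite -[RHS]/(c *: kbilin (kgen C iso1 sum1 t) v + kbilin (kgen C iso1 sum1 t) w).
by rewrite /kbilin !klift_gen linearP.
Qed.
End BilinearLift.

HB.mixin Record Group_isAbelian G of monoid.Group G := {
  abmulgC : commutative (@mulg G)
}.
#[short(type="abelianGroupType")]
HB.structure Definition AbelianGroup := {G of Group_isAbelian G & monoid.Group G}.

Section FiberedBisets.
Variable A : abelianGroupType.

(* The left and right actions are kept separate from the A-action; the         *)
(* element x.(a, h) of the usual notation is fact a (ract x h).                *)
Record fbiset_on (G H : finGroupType) (X : Type) := FBisetOn {
  lact : G -> X -> X;
  ract : X -> H -> X;
  fact : A -> X -> X;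
  lact1 : forall x, lact 1%g x = x;
  lactM : forall g g' x, lact (g * g')%g x = lact g (lact g' x);
  ract1 : forall x, ract x 1%g = x;
  ractM : forall x h h', ract x (h * h')%g = ract (ract x h) h';
  fact1 : forall x, fact 1%g x = x;
  factM : forall a a' x, fact (a * a')%g x = fact a (fact a' x);
  lract : forall g x h, lact g (ract x h) = ract (lact g x) h;
  lfact : forall g a x, lact g (fact a x) = fact a (lact g x);
  rfact : forall a x h, ract (fact a x) h = fact a (ract x h);
  fact_free : forall a x, fact a x = x -> a = 1%g;
  fact_fin : exists (I : finType) (r : I -> X),
    forall x, exists a i, x = fact a (r i)
}.

Record fbiset (G H : finGroupType) := FBiset {
  fbset :> Type;
  fb_on : fbiset_on G H fbset
}.

Notation "g \l x" := (lact (fb_on _) g x) (at level 45, right associativity).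
Notation "x \r h" := (ract (fb_on _) x h) (at level 44, left associativity).
Notation "a \f x" := (fact (fb_on _) a x) (at level 45, right associativity).

Lemma fact_inj G H (X : fbiset G H) a b (x : X) : a \f x = b \f x -> a = b.
Proof.
move=> e; have ba : (b^-1 * a)%g = 1%g.
  apply: (fact_free (f := fb_on X) (x := x)).
  by rewrite factM e -factM mulVg fact1.
by rewrite -[a](mulVKg b) ba mulg1.
Qed.

Definition fb_iso G H (X Y : fbiset G H) : Prop :=
  exists f : X -> Y,
    [/\ bijective f, forall g x, f (g \l x) = g \l f x,
        forall x h, f (x \r h) = f x \r h & forall a x, f (a \f x) = a \f f x].

Lemma fb_iso_refl G H (X : fbiset G H) : fb_iso X X.
Proof. by exists id; split=> //; exists id. Qed.

Lemma fb_iso_sym G H (X Y : fbiset G H) : fb_iso X Y -> fb_iso Y X.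
Proof.
case=> f [[g gK fK] fl fr fa]; exists g; split; first by exists f.
- by move=> h x; rewrite -[in LHS](fK x) -fl gK.
- by move=> x h; rewrite -[in LHS](fK x) -fr gK.
- by move=> a x; rewrite -[in LHS](fK x) -fa gK.
Qed.

Lemma fb_iso_trans G H (X Y Z : fbiset G H) :
  fb_iso X Y -> fb_iso Y Z -> fb_iso X Z.
Proof.
case=> f [bf fl fr fa] [g [bg gl gr ga]]; exists (g \o f); split=> /=.
- exact: bij_comp.
- by move=> h x; rewrite fl gl.
- by move=> x h; rewrite fr gr.
- by move=> a x; rewrite fa ga.
Qed.

Section Transport.
Variables (G H : finGroupType) (X : fbiset G H) (Y : Type).
Variables (f : Y -> X) (g : X -> Y).
Hypotheses (fK : cancel f g) (gK : cancel g f).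

Lemma transport_subproof : exists (I : finType) (r : I -> Y),
  forall y, exists a i, y = g (a \f f (r i)).
Proof.
have [I [r hr]] := fact_fin (fb_on X); exists I, (g \o r) => y.
have [a [i e]] := hr (f y); exists a, i => /=.
by rewrite gK -e fK.
Qed.

Definition transport_on : fbiset_on G H Y.
Proof.
refine (@FBisetOn G H Y (fun h y => g (h \l f y)) (fun y h => g (f y \r h))
  (fun a y => g (a \f f y)) _ _ _ _ _ _ _ _ _ _ transport_subproof).
- by move=> y; rewrite lact1.
- by move=> h h' y; rewrite gK lactM.
- by move=> y; rewrite ract1.
- by move=> y h h'; rewrite gK ractM.
- by move=> y; rewrite fact1.
- by move=> a a' y; rewrite gK factM.
- by move=> h y k; rewrite !gK lract.
- by move=> h a y; rewrite !gK lfact.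
- by move=> a y h; rewrite !gK rfact.
- by move=> a y /(congr1 f); rewrite gK; apply: fact_free.
Defined.

Lemma transport_iso : fb_iso X (FBiset transport_on).
Proof. by exists g; split=> [|h x|x h|a x] /=; rewrite ?gK //; exists f. Qed.
End Transport.

Section Sum.
Variables (G H : finGroupType) (X Y : fbiset G H).

Lemma fb_sum_subproof : exists (I : finType) (r : I -> X + Y),
  forall x, exists a i,
    x = match r i with inl x => inl (a \f x) | inr y => inr (a \f y) end.
Proof.
have [I [r hr]] := fact_fin (fb_on X); have [J [s hs]] := fact_fin (fb_on Y).
exists (I + J)%type,
  (fun k => match k with inl i => inl (r i) | inr j => inr (s j) end) => -[x|y].
  by have [a [i ->]] := hr x; exists a, (inl i).
by have [a [i ->]] := hs y; exists a, (inr i).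
Qed.

Definition fb_sum : fbiset G H.
Proof.
refine (@FBiset G H (X + Y) (@FBisetOn G H _
  (fun g z => match z with inl x => inl (g \l x) | inr y => inr (g \l y) end)
  (fun z h => match z with inl x => inl (x \r h) | inr y => inr (y \r h) end)
  (fun a z => match z with inl x => inl (a \f x) | inr y => inr (a \f y) end)
  _ _ _ _ _ _ _ _ _ _ fb_sum_subproof)).
- by case=> x; rewrite lact1.
- by move=> g g' [] x; rewrite lactM.
- by case=> x; rewrite ract1.
- by move=> [] x h h'; rewrite ractM.
- by case=> x; rewrite fact1.
- by move=> a a' [] x; rewrite factM.
- by move=> g [] x h; rewrite lract.
- by move=> g a [] x; rewrite lfact.
- by move=> a [] x h; rewrite rfact.
- by move=> a [] x []; apply: fact_free.
Defined.
End Sum.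

Lemma fb_sum_iso G H (X X' Y Y' : fbiset G H) :
  fb_iso X X' -> fb_iso Y Y' -> fb_iso (fb_sum X Y) (fb_sum X' Y').
Proof.
case=> f [[f' fK f'K] fl fr fa] [g [[g' gK g'K] gl gr ga]].
exists (fun z => match z with inl x => inl (f x) | inr y => inr (g y) end).
split=> [|h [] x|[] x h|a [] x] /=; rewrite ?fl ?fr ?fa ?gl ?gr ?ga //.
exists (fun z => match z with inl x => inl (f' x) | inr y => inr (g' y) end).
  by case=> x; rewrite ?fK ?gK.
by case=> x; rewrite ?f'K ?g'K.
Qed.

(* Iso^s with trivial fibre; fb_twist id is the identity of G                 *)
Section Twist.
Variables (G : finGroupType) (s : G -> G) (sM : {morph s : x y / (x * y)%g}).

Lemma fb_twist_subproof : exists (I : finType) (r : I -> A * G),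
  forall x, exists a i, x = ((a * (r i).1)%g, (r i).2).
Proof.
exists G, (fun g => (1%g, g)) => -[a g]; exists a, g.
by rewrite /= mulg1.
Qed.

Definition fb_twist : fbiset G G.
Proof.
refine (@FBiset G G (A * G) (@FBisetOn G G _
  (fun g x => (x.1, (g * x.2)%g)) (fun x g => (x.1, (x.2 * s g)%g))
  (fun a x => ((a * x.1)%g, x.2)) _ _ _ _ _ _ _ _ _ _ fb_twist_subproof)).
- by case=> a g /=; rewrite mul1g.
- by move=> g g' [a h] /=; rewrite mulgA.
- case=> a g /=; suff -> : s 1%g = 1%g by rewrite mulg1.
  by apply: (mulgI (s 1%g)); rewrite -sM !mulg1.
- by move=> [a g] h h' /=; rewrite sM mulgA.
- by case=> a g /=; rewrite mul1g.
- by move=> a a' [b g] /=; rewrite mulgA.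
- by move=> g [a k] h /=; rewrite mulgA.
- by [].
- by [].
- by move=> a [b g] [] e; apply: (mulIg b); rewrite mul1g.
Defined.
End Twist.

Definition fb_id G : fbiset G G := @fb_twist G id (fun _ _ => erefl).

Section Tensor.
Variables (G H K : finGroupType) (X : fbiset G H) (Y : fbiset H K).

(* tens_quot is the quotient of X x Y by ((x.(a, h), y) ~ (x, (a, h).y)); only *)
(* its free A-orbits are kept in tens.                                        *)
Variant tens_step : X * Y -> X * Y -> Prop :=
| TensStep x a h y : tens_step (a \f (x \r h), y) (x, a \f (h \l y)).

Definition tens_quot := quot tens_step.

Definition tq (x : X) (y : Y) : tens_quot := cls tens_step (x, y).

Definition tq_lift (U : Type) (f : X * Y -> U) (q : tens_quot) : U := f (repr q).

Definition tq_map (f : X * Y -> X * Y) : tens_quot -> tens_quot :=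
  tq_lift (fun p => cls tens_step (f p)).

Definition tq_fact a := tq_map (fun p => (a \f p.1, p.2)).

Definition tq_free q := forall a, tq_fact a q = q -> a = 1%g.

Lemma tqE x a h y : tq (a \f (x \r h)) y = tq x (a \f (h \l y)).
Proof. exact/cls_eqv/eqv_step/TensStep. Qed.

Lemma tqA x a y : tq (a \f x) y = tq x (a \f y).
Proof. by rewrite -{1}(ract1 (fb_on X) x) tqE lact1. Qed.

Lemma tqH x h y : tq (x \r h) y = tq x (h \l y).
Proof. by rewrite -(fact1 (fb_on X) (x \r h)) tqE fact1. Qed.

Lemma tq_ind (P : tens_quot -> Prop) : (forall x y, P (tq x y)) -> forall q, P q.
Proof. by move=> h; elim/quot_ind=> -[]. Qed.

Lemma tq_liftE (U : Type) (f : X * Y -> U) :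
    (forall x a h y, f (a \f (x \r h), y) = f (x, a \f (h \l y))) ->
  forall x y, tq_lift f (tq x y) = f (x, y).
Proof.
move=> h x y; apply: (eqv_inv (f := f)) (eqv_repr _ _) => _ _ [*].
exact: h.
Qed.

Lemma tq_factE a x y : tq_fact a (tq x y) = tq (a \f x) y.
Proof.
apply: tq_liftE => x0 b h y0 /=; rewrite -!/(tq _ _).
by rewrite -factM abmulgC factM -rfact tqE.
Qed.

Definition tq_lact g := tq_map (fun p => (g \l p.1, p.2)).
Definition tq_ract q k := tq_map (fun p => (p.1, p.2 \r k)) q.

Lemma tq_lactE g x y : tq_lact g (tq x y) = tq (g \l x) y.
Proof.
apply: tq_liftE => x0 b h y0 /=; rewrite -!/(tq _ _).
by rewrite lfact lract tqE.
Qed.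

Lemma tq_ractE k x y : tq_ract (tq x y) k = tq x (y \r k).
Proof.
apply: tq_liftE => x0 b h y0 /=; rewrite -!/(tq _ _).
by rewrite tqE rfact lract.
Qed.

Lemma tq_lact_fact g a q : tq_lact g (tq_fact a q) = tq_fact a (tq_lact g q).
Proof.
by elim/tq_ind: q => x y; rewrite tq_factE !tq_lactE tq_factE lfact.
Qed.

Lemma tq_ract_fact k a q : tq_ract (tq_fact a q) k = tq_fact a (tq_ract q k).
Proof. by elim/tq_ind: q => x y; rewrite tq_factE !tq_ractE tq_factE. Qed.

Lemma tq_lactM g g' q : tq_lact (g * g')%g q = tq_lact g (tq_lact g' q).
Proof. by elim/tq_ind: q => x y; rewrite !tq_lactE lactM. Qed.

Lemma tq_lact1 q : tq_lact 1%g q = q.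
Proof. by elim/tq_ind: q => x y; rewrite !tq_lactE lact1. Qed.

Lemma tq_ractM q k k' : tq_ract q (k * k')%g = tq_ract (tq_ract q k) k'.
Proof. by elim/tq_ind: q => x y; rewrite !tq_ractE ractM. Qed.

Lemma tq_ract1 q : tq_ract q 1%g = q.
Proof. by elim/tq_ind: q => x y; rewrite !tq_ractE ract1. Qed.

Lemma tq_factM a b q : tq_fact (a * b)%g q = tq_fact a (tq_fact b q).
Proof. by elim/tq_ind: q => x y; rewrite !tq_factE factM. Qed.

Lemma tq_fact1 q : tq_fact 1%g q = q.
Proof. by elim/tq_ind: q => x y; rewrite !tq_factE fact1. Qed.

Lemma tq_free_lact g q : tq_free q -> tq_free (tq_lact g q).
Proof.
move=> fq a; rewrite -tq_lact_fact => /(congr1 (tq_lact g^-1%g)).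
by rewrite -!tq_lactM mulVg !tq_lact1; apply: fq.
Qed.

Lemma tq_free_ract k q : tq_free q -> tq_free (tq_ract q k).
Proof.
move=> fq a; rewrite -tq_ract_fact => /(congr1 (tq_ract^~ k^-1%g)).
by rewrite -!tq_ractM mulgV !tq_ract1; apply: fq.
Qed.

Lemma tq_free_fact b q : tq_free q -> tq_free (tq_fact b q).
Proof.
have bK p : tq_fact b^-1%g (tq_fact b p) = p.
  by rewrite -tq_factM mulVg tq_fact1.
move=> fq a; rewrite -tq_factM abmulgC tq_factM => /(congr1 (tq_fact b^-1%g)).
by rewrite !bK; apply: fq.
Qed.

Definition tens := {q : tens_quot | tq_free q}.

Lemma tens_eq (p q : tens) : sval p = sval q -> p = q.
Proof.
case: p q => [p hp] [q hq] /= epq; case: q / epq hq => hq.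
by congr exist; apply: Prop_irrelevance.
Qed.

Definition tens_fact a (q : tens) : tens :=
  exist _ (tq_fact a (sval q)) (tq_free_fact (svalP q)).

Lemma fb_tens_subproof : exists (I : finType) (r : I -> tens),
  forall q, exists a i, q = tens_fact a (r i).
Proof.
have [I [r hr]] := fact_fin (fb_on X); have [J [s hs]] := fact_fin (fb_on Y).
pose P (k : I * J) := `[< tq_free (tq (r k.1) (s k.2)) >].
exists {k : I * J | P k}, (fun k => exist _ _ (asboolW (svalP k))).
case=> q; elim/tq_ind: q => x y; have [a [i ->]] := hr x.
have [b [j ->]] := hs y; rewrite -tqA -factM.
have -> : tq ((b * a)%g \f r i) (s j) = tq_fact (b * a)%g (tq (r i) (s j)).
  by rewrite tq_factE.
move=> fq.
have Pk : P (i, j).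
  apply/asboolP => /=; rewrite -[tq _ _]tq_fact1 -(mulVg (b * a)%g) tq_factM.
  exact: tq_free_fact.
by exists (b * a)%g, (exist _ (i, j) Pk); apply: tens_eq.
Qed.

Definition fb_tens : fbiset G K.
Proof.
refine (@FBiset G K tens (@FBisetOn G K _
  (fun g q => exist _ (tq_lact g (sval q)) (tq_free_lact (svalP q)))
  (fun q k => exist _ (tq_ract (sval q) k) (tq_free_ract (svalP q)))
  tens_fact _ _ _ _ _ _ _ _ _ _ fb_tens_subproof)).
- by move=> q; apply/tens_eq/tq_lact1.
- by move=> g g' q; apply/tens_eq/tq_lactM.
- by move=> q; apply/tens_eq/tq_ract1.
- by move=> q k k'; apply/tens_eq/tq_ractM.
- by move=> q; apply/tens_eq/tq_fact1.
- by move=> a b q; apply/tens_eq/tq_factM.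
- move=> g [q hq] k; apply: tens_eq => /=; elim/tq_ind: q hq => x y _.
  by rewrite tq_ractE !tq_lactE tq_ractE.
- by move=> g a q; apply/tens_eq/tq_lact_fact.
- by move=> a q k; apply/tens_eq/tq_ract_fact.
- by move=> a q /(congr1 sval); apply: (svalP q).
Defined.
End Tensor.

Lemma bij_of (U V : Type) (f : U -> V) :
  injective f -> (forall v, exists u, f u = v) -> bijective f.
Proof.
move=> fI fS; pose g v := sval (cid (fS v)).
have fK v : f (g v) = v by rewrite /g; case: cid.
by exists g => // u; apply: fI.
Qed.

Section TensorIso.
Variables (G H K : finGroupType).

Lemma tens_isoI (X : fbiset G H) (Y : fbiset H K) (Z : fbiset G K)
    (f : Z -> tens_quot X Y) :
    injective f -> (forall q, tq_free q -> exists z, f z = q) ->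
    (forall g z, f (g \l z) = tq_lact g (f z)) ->
    (forall z k, f (z \r k) = tq_ract (f z) k) ->
    (forall a z, f (a \f z) = tq_fact a (f z)) ->
  fb_iso Z (fb_tens X Y).
Proof.
move=> fI fS fl fr fa.
have ffree z : tq_free (f z).
  by move=> a; rewrite -fa => /fI; apply: fact_free.
exists (fun z => exist _ (f z) (ffree z) : tens X Y); split.
- apply: bij_of => [z z' /(congr1 sval) /fI //|[q fq]].
  by have [z e] := fS q fq; exists z; apply: tens_eq.
- by move=> g z; apply/tens_eq/fl.
- by move=> z k; apply/tens_eq/fr.
- by move=> a z; apply/tens_eq/fa.
Qed.

Section Map.
Variables (X X' : fbiset G H) (Y Y' : fbiset H K) (f : X -> X') (g : Y -> Y').
Hypotheses (fl : forall h x, f (h \l x) = h \l f x)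
  (fr : forall x h, f (x \r h) = f x \r h)
  (fa : forall a x, f (a \f x) = a \f f x)
  (gl : forall h x, g (h \l x) = h \l g x)
  (gr : forall x h, g (x \r h) = g x \r h)
  (ga : forall a x, g (a \f x) = a \f g x).

Definition tq_mor : tens_quot X Y -> tens_quot X' Y' :=
  tq_lift (fun p => tq (f p.1) (g p.2)).

Lemma tq_morE x y : tq_mor (tq x y) = tq (f x) (g y).
Proof. by apply: tq_liftE => x0 a h y0 /=; rewrite fa fr ga gl tqE. Qed.

Lemma tq_mor_lact h q : tq_mor (tq_lact h q) = tq_lact h (tq_mor q).
Proof. by elim/tq_ind: q => x y; rewrite tq_lactE !tq_morE tq_lactE fl. Qed.

Lemma tq_mor_ract k q : tq_mor (tq_ract q k) = tq_ract (tq_mor q) k.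
Proof. by elim/tq_ind: q => x y; rewrite tq_ractE !tq_morE tq_ractE gr. Qed.

Lemma tq_mor_fact a q : tq_mor (tq_fact a q) = tq_fact a (tq_mor q).
Proof. by elim/tq_ind: q => x y; rewrite tq_factE !tq_morE tq_factE fa. Qed.
End Map.

Lemma fb_tens_iso (X X' : fbiset G H) (Y Y' : fbiset H K) :
  fb_iso X X' -> fb_iso Y Y' -> fb_iso (fb_tens X Y) (fb_tens X' Y').
Proof.
case=> f [[f' fK f'K] fl fr fa] [g [[g' gK g'K] gl gr ga]].
have f'l h x : f' (h \l x) = h \l f' x by rewrite -[x in LHS]f'K -fl fK.
have f'r x h : f' (x \r h) = f' x \r h by rewrite -[x in LHS]f'K -fr fK.
have f'a a x : f' (a \f x) = a \f f' x by rewrite -[x in LHS]f'K -fa fK.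
have g'l h x : g' (h \l x) = h \l g' x by rewrite -[x in LHS]g'K -gl gK.
have g'r x h : g' (x \r h) = g' x \r h by rewrite -[x in LHS]g'K -gr gK.
have g'a a x : g' (a \f x) = a \f g' x by rewrite -[x in LHS]g'K -ga gK.
have mK : cancel (@tq_mor X X' Y Y' f g) (tq_mor f' g').
  by elim/tq_ind=> x y; rewrite !tq_morE ?fK ?gK.
have mK' : cancel (tq_mor f' g') (@tq_mor X X' Y Y' f g).
  by elim/tq_ind=> x y; rewrite !tq_morE ?f'K ?g'K.
apply: (@tens_isoI X' Y' (fb_tens X Y) (fun q => tq_mor f g (sval q))).
- by move=> p q /(can_inj mK) /tens_eq.
- move=> q fq.
  have fq' : tq_free (tq_mor f' g' q : tens_quot X Y).
    by move=> a; rewrite -tq_mor_fact // => /(can_inj mK'); apply: fq.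
  by exists (exist _ _ fq') => /=.
- by move=> h q; apply: tq_mor_lact.
- by move=> q k; apply: tq_mor_ract.
- by move=> a q; apply: tq_mor_fact.
Qed.

Section SumL.
Variables (X X' : fbiset G H) (Y : fbiset H K).

Lemma fb_tens_suml :
  fb_iso (fb_tens (fb_sum X X') Y) (fb_sum (fb_tens X Y) (fb_tens X' Y)).
Proof.
pose i : X -> fb_sum X X' := inl; pose i' : X' -> fb_sum X X' := inr.
pose m := @tq_mor X (fb_sum X X') Y Y i id.
pose m' := @tq_mor X' (fb_sum X X') Y Y i' id.
have mE x y : m (tq x y) = tq (i x) y by rewrite /m tq_morE.
have m'E x y : m' (tq x y) = tq (i' x) y by rewrite /m' tq_morE.
pose p : tens_quot (fb_sum X X') Y -> tens_quot X Y + tens_quot X' Y :=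
  tq_lift (X := fb_sum X X') (fun z => match z.1 : X + X' with inl x => inl (tq x z.2)
                                 | inr x => inr (tq x z.2) end).
have pE x y : p (tq (i x) y) = inl (tq x y).
  by apply: tq_liftE => -[] x0 a h y0 /=; rewrite tqE.
have pE' x y : p (tq (i' x) y) = inr (tq x y).
  by apply: tq_liftE => -[] x0 a h y0 /=; rewrite tqE.
have mK q : p (m q) = inl q by elim/tq_ind: q => x y; rewrite mE pE.
have mK' q : p (m' q) = inr q by elim/tq_ind: q => x y; rewrite m'E pE'.
apply: fb_iso_sym; apply: (@tens_isoI _ _ (fb_sum (fb_tens X Y) (fb_tens X' Y))
  (fun z => match z with inl q => m (sval q) | inr q => m' (sval q) end)).
- case=> q [] q' /(congr1 p); rewrite ?mK ?mK' // => -[];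
  by move/tens_eq ->.
- elim/tq_ind=> -[x|x] y fq.
    have fq' : tq_free (tq x y).
      move=> a e; apply: fq; rewrite -[tq _ _]/(tq (i x) y) -mE.
      by rewrite -tq_mor_fact // e.
    by exists (inl (exist _ _ fq')); rewrite mE.
  have fq' : tq_free (tq x y).
    move=> a e; apply: fq; rewrite -[tq _ _]/(tq (i' x) y) -m'E.
    by rewrite -tq_mor_fact // e.
  by exists (inr (exist _ _ fq')); rewrite m'E.
- by move=> h [] q; apply: tq_mor_lact.
- by move=> [] q k; apply: tq_mor_ract.
- by move=> a [] q; apply: tq_mor_fact.
Qed.
End SumL.

Section SumR.
Variables (X : fbiset G H) (Y Y' : fbiset H K).

Lemma fb_tens_sumr :
  fb_iso (fb_tens X (fb_sum Y Y')) (fb_sum (fb_tens X Y) (fb_tens X Y')).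
Proof.
pose i : Y -> fb_sum Y Y' := inl; pose i' : Y' -> fb_sum Y Y' := inr.
pose m := @tq_mor X X Y (fb_sum Y Y') id i.
pose m' := @tq_mor X X Y' (fb_sum Y Y') id i'.
have mE x y : m (tq x y) = tq x (i y) by rewrite /m tq_morE.
have m'E x y : m' (tq x y) = tq x (i' y) by rewrite /m' tq_morE.
pose p : tens_quot X (fb_sum Y Y') -> tens_quot X Y + tens_quot X Y' :=
  tq_lift (Y := fb_sum Y Y') (fun z => match z.2 : Y + Y' with inl y => inl (tq z.1 y)
                                 | inr y => inr (tq z.1 y) end).
have pE x y : p (tq x (i y)) = inl (tq x y).
  by apply: tq_liftE => x0 a h [] y0 /=; rewrite tqE.
have pE' x y : p (tq x (i' y)) = inr (tq x y).
  by apply: tq_liftE => x0 a h [] y0 /=; rewrite tqE.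
have mK q : p (m q) = inl q by elim/tq_ind: q => x y; rewrite mE pE.
have mK' q : p (m' q) = inr q by elim/tq_ind: q => x y; rewrite m'E pE'.
apply: fb_iso_sym; apply: (@tens_isoI _ _ (fb_sum (fb_tens X Y) (fb_tens X Y'))
  (fun z => match z with inl q => m (sval q) | inr q => m' (sval q) end)).
- case=> q [] q' /(congr1 p); rewrite ?mK ?mK' // => -[];
  by move/tens_eq ->.
- elim/tq_ind=> x [] y fq.
    have fq' : tq_free (tq x y).
      move=> a e; apply: fq; rewrite -[tq _ _]/(tq x (i y)) -mE.
      by rewrite -tq_mor_fact // e.
    by exists (inl (exist _ _ fq')); rewrite mE.
  have fq' : tq_free (tq x y).
    move=> a e; apply: fq; rewrite -[tq _ _]/(tq x (i' y)) -m'E.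
    by rewrite -tq_mor_fact // e.
  by exists (inr (exist _ _ fq')); rewrite m'E.
- by move=> h [] q; apply: tq_mor_lact.
- by move=> [] q k; apply: tq_mor_ract.
- by move=> a [] q; apply: tq_mor_fact.
Qed.
End SumR.
End TensorIso.

(* Every A-fibered biset is isomorphic to one with underlying set A x 'I_n,   *)
(* so these form a set of representatives on which the Grothendieck group can *)
(* be built                                                                   *)
Definition fbset_sk (G H : finGroupType) :=
  {n : nat & fbiset_on G H (A * 'I_n)}.

Definition fb_of_sk G H (X : fbset_sk G H) : fbiset G H := FBiset (projT2 X).

Lemma fb_skP G H (X : fbiset G H) :
  exists Y : fbset_sk G H, fb_iso (fb_of_sk Y) X.
Proof.
have [I [r hr]] := fact_fin (fb_on X).
pose R i j := `[< exists a, r i = a \f r j >].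
have Rrefl i : R i i by apply/asboolP; exists 1%g; rewrite fact1.
have Rsym i j : R i j -> R j i.
  move=> /asboolP [a e]; apply/asboolP; exists a^-1%g.
  by rewrite e -factM mulVg fact1.
have Rtrans i j k : R i j -> R j k -> R i k.
  move=> /asboolP [a e] /asboolP [b e']; apply/asboolP; exists (a * b)%g.
  by rewrite e e' factM.
pose c i := choose (R i) i.
have cR i : R i (c i) by apply: chooseP.
have cE i j : R i j -> c i = c j.
  move=> ij; rewrite /c.
  have RE : R i =1 R j.
    move=> k; apply/idP/idP; [exact: Rtrans (Rsym _ _ ij) | exact: Rtrans ij].
  by rewrite (eq_choose RE) (choose_id _ (Rrefl j)) // Rsym.
pose J := {i : I | c i == i}.
have cc i : c (c i) == c i by rewrite -(cE i (c i)).
pose f (p : A * 'I_#|{: J}|) : X := p.1 \f r (val (enum_val p.2)).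
have f_bij : bijective f.
  apply: bij_of => [[a k] [b l]|x]; rewrite /f /=.
    move=> e; have kl : k = l.
      apply/enum_val_inj/val_inj.
      rewrite -(eqP (valP (enum_val k))) -(eqP (valP (enum_val l))).
      apply: cE; apply/asboolP; exists (a^-1 * b)%g.
      by rewrite factM -e -factM mulVg fact1.
    by case: l / kl e => /fact_inj ->.
  have [a [i ->]] := hr x; have /asboolP [b ->] := cR i.
  exists ((a * b)%g, enum_rank (exist _ (c i) (cc i) : J)).
  by rewrite enum_rankK factM.
have [g fK gK] := f_bij.
exists (existT (fun n => fbiset_on G H (A * 'I_n)) _ (transport_on fK gK)).
apply: fb_iso_sym.
exact: transport_iso.
Qed.

Definition fb_sk G H (X : fbiset G H) : fbset_sk G H := sval (cid (fb_skP X)).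

Lemma fb_skK G H (X : fbiset G H) : fb_iso (fb_of_sk (fb_sk X)) X.
Proof. by rewrite /fb_sk; case: cid. Qed.

Definition sk_iso G H (X Y : fbset_sk G H) := fb_iso (fb_of_sk X) (fb_of_sk Y).
Definition sk_sum G H (X Y : fbset_sk G H) :=
  fb_sk (fb_sum (fb_of_sk X) (fb_of_sk Y)).

(* B^A(G, H), built from the representatives in fbset_sk for reasons of size   *)
Definition Bgrp G H : zmodType := K0 (@sk_iso G H) (@sk_sum G H).

Variable C : fieldType.

Definition CB G H : lmodType C := tensZ C (Bgrp G H).

Definition bcls G H (X : fbiset G H) : CB G H :=
  kgen C (@sk_iso G H) (@sk_sum G H) (fb_sk X).

Lemma bcls_iso G H (X Y : fbiset G H) : fb_iso X Y -> bcls X = bcls Y.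
Proof.
move=> h; apply: kgen_iso; apply: fb_iso_trans (fb_skK X) _.
exact: fb_iso_trans h (fb_iso_sym (fb_skK Y)).
Qed.

Lemma bcls_sk G H (X : fbset_sk G H) :
  bcls (fb_of_sk X) = kgen C (@sk_iso G H) (@sk_sum G H) X.
Proof. exact/kgen_iso/fb_skK. Qed.

Lemma bcls_sum G H (X Y : fbiset G H) : bcls (fb_sum X Y) = bcls X + bcls Y.
Proof.
rewrite [bcls X]/bcls [bcls Y]/bcls -kgen_sum -bcls_sk; apply: bcls_iso.
apply: fb_iso_trans (fb_iso_sym (fb_skK _)).
by apply: fb_sum_iso; apply/fb_iso_sym/fb_skK.
Qed.

(* Note the reversal: arrows from G to H are combinations of (H, G)-bisets.   *)
Definition Chom (G H : finGroupType) : lmodType C := CB H G.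

Definition Cid G : Chom G G := bcls (fb_id G).

Definition comp_sk G H K (X : fbset_sk K H) (Y : fbset_sk H G) : Chom G K :=
  bcls (fb_tens (fb_of_sk X) (fb_of_sk Y)).

Lemma comp_sk_isol G H K (X X' : fbset_sk K H) (Y : fbset_sk H G) :
  sk_iso X X' -> comp_sk X Y = comp_sk X' Y.
Proof. by move=> h; apply/bcls_iso/fb_tens_iso/fb_iso_refl. Qed.

Lemma comp_sk_isor G H K (X : fbset_sk K H) (Y Y' : fbset_sk H G) :
  sk_iso Y Y' -> comp_sk X Y = comp_sk X Y'.
Proof. by move=> h; apply/bcls_iso/fb_tens_iso => //; apply: fb_iso_refl. Qed.

Lemma comp_sk_suml G H K (X X' : fbset_sk K H) (Y : fbset_sk H G) :
  comp_sk (sk_sum X X') Y = comp_sk X Y + comp_sk X' Y.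
Proof.
rewrite /comp_sk -bcls_sum; apply: bcls_iso.
apply: fb_iso_trans (fb_tens_suml _ _ _).
by apply: fb_tens_iso (fb_iso_refl _); apply: fb_skK.
Qed.

Lemma comp_sk_sumr G H K (X : fbset_sk K H) (Y Y' : fbset_sk H G) :
  comp_sk X (sk_sum Y Y') = comp_sk X Y + comp_sk X Y'.
Proof.
rewrite /comp_sk -bcls_sum; apply: bcls_iso.
apply: fb_iso_trans (fb_tens_sumr _ _ _).
by apply: fb_tens_iso (fb_skK _); apply: fb_iso_refl.
Qed.

Definition Ccomp G H K (phi : Chom H K) (psi : Chom G H) : Chom G K :=
  kbilin (@comp_sk_isol G H K) (@comp_sk_suml G H K)
         (@comp_sk_isor G H K) (@comp_sk_sumr G H K) phi psi.

Lemma CcompE G H K (X : fbiset K H) (Y : fbiset H G) :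
  Ccomp (bcls X) (bcls Y) = bcls (fb_tens X Y).
Proof.
rewrite /Ccomp kbilin_gen; apply: bcls_iso.
by apply: fb_tens_iso; apply: fb_skK.
Qed.

Record fbfunctor := FBFunctor {
  fob :> finGroupType -> lmodType C;
  fmap : forall G H, Chom G H -> fob G -> fob H;
  fmap_linearl : forall G H (x : fob G), linear (fun phi : Chom G H => fmap phi x);
  fmap_linearr : forall G H (phi : Chom G H), linear (fmap phi);
  fmap_id : forall G (x : fob G), fmap (Cid G) x = x;
  fmap_comp : forall G H K (phi : Chom H K) (psi : Chom G H) (x : fob G),
    fmap (Ccomp phi psi) x = fmap phi (fmap psi x)
}.

Definition functor_iso (F F' : fbfunctor) : Prop :=
  exists eta : forall G, F G -> F' G,
    [/\ forall G, linear (eta G), forall G, bijective (eta G) &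
        forall G H (phi : Chom G H) x, eta H (fmap phi x) = fmap phi (eta G x)].

Definition subfunctor (F : fbfunctor) (P : forall G, F G -> Prop) : Prop :=
  [/\ forall G, P G 0, forall G c x y, P G x -> P G y -> P G (c *: x + y) &
      forall G H (phi : Chom G H) x, P G x -> P H (fmap phi x)].

Definition simple_functor (F : fbfunctor) : Prop :=
  (exists G (x : F G), x <> 0) /\
  forall P, subfunctor P ->
    (forall G (x : F G), P G x -> x = 0) \/ (forall G (x : F G), P G x).

End FiberedBisets.

Notation "g \l x" := (lact (fb_on _) g x) (at level 45, right associativity).
Notation "x \r h" := (ract (fb_on _) x h) (at level 44, left associativity).
Notation "a \f x" := (fact (fb_on _) a x) (at level 45, right associativity).

Section DirectSum.
Local Open Scope classical_set_scope.

Section Module.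
Variables (C : fieldType) (I : Type) (V : I -> lmodType C).

Definition dsum : Type :=
  {f : forall i, V i | finite_set [set i | f i <> 0]}.

HB.instance Definition _ := gen_eqMixin dsum.
HB.instance Definition _ := gen_choiceMixin dsum.

Lemma dsum_eq (u v : dsum) : (forall i, sval u i = sval v i) -> u = v.
Proof.
case: u v => [f hf] [g hg] /= fg; have {}fg : f = g by apply: functional_extensionality_dep.
by case: g / fg hg => hg; congr exist; apply: Prop_irrelevance.
Qed.

Lemma dsum0_subproof : finite_set [set i | (0 : V i) <> 0].
Proof. by apply: sub_finite_set (finite_set0 I) => i /=; apply. Qed.

Lemma dsum_lin_subproof c (u v : dsum) :
  finite_set [set i | c *: sval u i + sval v i <> 0].
Proof.
have h : finite_set ([set i | sval u i <> 0] `|` [set i | sval v i <> 0]).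
  by rewrite finite_setU; split; [apply: (svalP u) | apply: (svalP v)].
apply: sub_finite_set h => i /= ne.
have [u0|u0] := pselect (sval u i = 0); last by left.
by right => v0; apply: ne; rewrite u0 v0 scaler0 addr0.
Qed.

Definition dsum0 : dsum := exist _ (fun i => 0) dsum0_subproof.
Definition dsum_lin c (u v : dsum) : dsum :=
  exist _ (fun i => c *: sval u i + sval v i) (dsum_lin_subproof c u v).

Definition dsum_add := dsum_lin 1.
Definition dsum_opp u := dsum_lin (-1) u dsum0.
Definition dsum_scale c u := dsum_lin c u dsum0.

Lemma dsum_addA : associative dsum_add.
Proof. by move=> u v w; apply: dsum_eq => i /=; rewrite !scale1r addrA. Qed.
Lemma dsum_addC : commutative dsum_add.
Proof. by move=> u v; apply: dsum_eq => i /=; rewrite !scale1r addrC. Qed.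
Lemma dsum_add0 : left_id dsum0 dsum_add.
Proof. by move=> u; apply: dsum_eq => i /=; rewrite scaler0 add0r. Qed.
Lemma dsum_addN : left_inverse dsum0 dsum_opp dsum_add.
Proof.
by move=> u; apply: dsum_eq => i /=; rewrite scale1r addr0 scaleN1r addNr.
Qed.

HB.instance Definition _ :=
  GRing.isZmodule.Build dsum dsum_addA dsum_addC dsum_add0 dsum_addN.

Lemma dsumD (u v : dsum) i : sval (u + v) i = sval u i + sval v i.
Proof. by rewrite /= scale1r. Qed.

Lemma dsum_scaleE c u i : sval (dsum_scale c u) i = c *: sval u i.
Proof. by rewrite /= addr0. Qed.

Lemma dsum_scaleA a b u : dsum_scale a (dsum_scale b u) = dsum_scale (a * b) u.
Proof. by apply: dsum_eq => i; rewrite !dsum_scaleE scalerA. Qed.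
Lemma dsum_scale1 : left_id 1 dsum_scale.
Proof. by move=> u; apply: dsum_eq => i; rewrite dsum_scaleE scale1r. Qed.
Lemma dsum_scaleDr : right_distributive dsum_scale +%R.
Proof.
by move=> a u v; apply: dsum_eq => i; rewrite dsumD !dsum_scaleE dsumD scalerDr.
Qed.
Lemma dsum_scaleDl u : {morph dsum_scale^~ u : a b / a + b}.
Proof.
by move=> a b; apply: dsum_eq => i; rewrite dsumD !dsum_scaleE scalerDl.
Qed.

HB.instance Definition _ := GRing.Zmodule_isLmodule.Build C dsum
  dsum_scaleA dsum_scale1 dsum_scaleDr dsum_scaleDl.

Lemma dsumZ c (u : dsum) i : sval (c *: u) i = c *: sval u i.
Proof. exact: dsum_scaleE. Qed.
End Module.

Section Functor.
Variables (A : abelianGroupType) (C : fieldType) (I : Type).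
Variable S : I -> fbfunctor A C.

Definition dsum_ob (G : finGroupType) : lmodType C := dsum (fun i => S i G).

Lemma dsum_map_subproof G H (phi : Chom A C G H) (u : dsum_ob G) :
  finite_set [set i | fmap phi (sval u i) <> 0].
Proof.
apply: sub_finite_set (svalP u) => i /= ne u0; apply: ne; rewrite u0.
pose f : {linear S i G -> S i H} := HB.pack (fmap phi)
  (GRing.isLinear.Build _ _ _ _ _ (@fmap_linearr _ _ (S i) G H phi)).
exact: (linear0 f).
Qed.

Definition dsum_map G H (phi : Chom A C G H) (u : dsum_ob G) : dsum_ob H :=
  exist _ (fun i => fmap phi (sval u i)) (dsum_map_subproof phi u).

Definition functor_dsum : fbfunctor A C.
Proof.
refine (@FBFunctor A C dsum_ob dsum_map _ _ _ _).
- move=> G H u c phi psi; apply: dsum_eq => i.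
  by rewrite [RHS]dsumD dsumZ; apply: (@fmap_linearl _ _ (S i)).
- move=> G H phi c u v; apply: dsum_eq => i.
  rewrite [RHS]dsumD dsumZ -[RHS]fmap_linearr -dsumZ -dsumD.
  by [].
- by move=> G u; apply: dsum_eq => i; apply: fmap_id.
- by move=> G H K phi psi u; apply: dsum_eq => i; apply: fmap_comp.
Defined.
End Functor.
End DirectSum.

(* identifies A with a subgroup of C^x *)
Record mult_embedding (A : abelianGroupType) (C : fieldType) := MultEmbedding {
  emb :> A -> C;
  emb1 : emb 1%g = 1;
  embM : forall a b, emb (a * b)%g = emb a * emb b;
  emb_inj : injective emb
}.

Lemma CK0_extP (C : fieldType) T iso sum (W : lmodType C)
    (f g : @CK0 C T iso sum -> W) : linear f -> linear g ->
  (forall t, f (kgen C iso sum t) = g (kgen C iso sum t)) -> f =1 g.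
Proof.
move=> fL gL.
pose f' : {linear CK0 C iso sum -> W} :=
  HB.pack f (GRing.isLinear.Build _ _ _ _ _ fL).
pose g' : {linear CK0 C iso sum -> W} :=
  HB.pack g (GRing.isLinear.Build _ _ _ _ _ gL).
exact: (@CK0_ext _ _ _ _ _ f' g').
Qed.

Section FiniteDimension.
Variables (C : fieldType) (V : lmodType C).

Lemma findim_iso (I : finType) (e : I -> V) :
    (forall v, exists c : I -> C, v = \sum_i c i *: e i) ->
  exists n (f : 'cV[C]_n -> V), linear f /\ bijective f.
Proof.
move=> he.
pose P n := `[< exists f : 'cV[C]_n -> V, linear f /\ forall v, exists u, f u = v >].
have exP : exists n, P n.
  exists #|I|; apply/asboolP.
  exists (fun w => \sum_i w (enum_rank i) 0 *: e i); split=> [c u w|v].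
    rewrite scaler_sumr -big_split /=; apply: eq_bigr => i _.
    by rewrite !mxE scalerDl scalerA.
  have [c ->] := he v; exists (\col_k c (enum_val k)); apply: eq_bigr => i _.
  by rewrite mxE enum_rankK.
case: (ex_minnP exP) => n /asboolP [f [fL fS]] n_min.
exists n, f; split=> //; apply: bij_of => // u v fuv.
apply: contrapT => uv.
pose fl : {linear 'cV[C]_n -> V} := HB.pack f (GRing.isLinear.Build _ _ _ _ _ fL).
pose w := u - v.
have fw : f w = 0 by rewrite -[f]/(fl : _ -> _) linearB /= fuv subrr.
have [k wk] : exists k, w k 0 != 0.
  apply: contrapT => h; apply: uv; apply/eqP; rewrite -subr_eq0.
  apply/eqP/colP => i; rewrite [RHS]mxE; apply: contrapT => ne; apply: h.
  by exists i; apply/eqP.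
case: n k f fL fS n_min u v fuv uv @fl w fw wk
  => [[]//|n] k f fL fS n_min u v _ _ fl w fw wk.
suff /n_min : P n by rewrite ltnn.
apply/asboolP.
pose up (x : 'cV[C]_n) : 'cV[C]_n.+1 :=
  \col_i (if unlift k i is Some j then x j 0 else 0).
exists (f \o up); split=> [c x y|y] /=.
  rewrite -fL; congr f; apply/colP => i; rewrite !mxE.
  by case: unliftP => [j _|_]; rewrite ?mxE // mulr0 addr0.
have [x fx] := fS y.
pose x' := (- (x k 0 / w k 0)) *: w + x.
exists (\col_j x' (lift k j) 0).
rewrite -fx -[RHS]add0r -(scaler0 _ (- (x k 0 / w k 0))) -fw -fL; congr f.
apply/colP => i; rewrite mxE; case: unliftP => [j ->|->]; first by rewrite mxE.
by rewrite !mxE mulNr divfK // addNr.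
Qed.
End FiniteDimension.

Section CharacterFunctor.
Variables (A : abelianGroupType) (C : fieldType) (iota : mult_embedding A C).

Notation rep G := (representation C [set: G]%G).

(* V, with G acting linearly on the left, is isomorphic to the CG-module of   *)
(* column vectors on which g acts as the matrix M g                           *)
Definition affords (G : finGroupType) (V : lmodType C) (act : G -> V -> V)
    (M : rep G) : Prop :=
  exists f : 'cV[C]_(rdegree M) -> V,
    [/\ linear f, bijective f & forall g v, f (M g *m v) = act g (f v)].

Lemma lin_inv (U V : lmodType C) (f : U -> V) (g : V -> U) :
  linear f -> cancel f g -> cancel g f -> linear g.
Proof.
by move=> fL fK gK c u v; apply: (can_inj fK); rewrite fL !gK.
Qed.

Lemma lin_mx m n (f : 'cV[C]_m -> 'cV[C]_n) :
  linear f -> exists P, forall v, f v = P *m v.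
Proof.
move=> fL; pose fl : {linear 'cV[C]_m -> 'cV[C]_n} :=
  HB.pack f (GRing.isLinear.Build _ _ _ _ _ fL).
exists (\matrix_(i, j) f (delta_mx j 0) i 0) => v.
rewrite {1}(matrix_sum_delta v) -[f]/(fl : _ -> _) linear_sum /=.
apply/colP => i; rewrite summxE mxE; apply: eq_bigr => j _.
by rewrite big_ord1 -[f]/(fl : _ -> _) linearZ /= !mxE mulrC ord1.
Qed.

Lemma mx_ext m n (P Q : 'M[C]_(m, n)) :
  (forall v : 'cV_n, P *m v = Q *m v) -> P = Q.
Proof.
move=> h; apply/matrixP => i j.
have /colP/(_ i) := h (delta_mx j 0).
by rewrite -!colE !mxE.
Qed.

Lemma rsim_of_lin G (M N : rep G) (f : 'cV[C]_(rdegree M) -> 'cV[C]_(rdegree N)) :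
  linear f -> bijective f -> (forall g v, f (M g *m v) = N g *m f v) ->
  mx_rsim M N.
Proof.
move=> fL [f' fK f'K] fM.
have [P PE] := lin_mx fL; have [Q QE] := lin_mx (lin_inv fL fK f'K).
have QP : Q *m P = 1%:M.
  by apply: mx_ext => v; rewrite -mulmxA -PE -QE fK mul1mx.
have PQ : P *m Q = 1%:M.
  by apply: mx_ext => v; rewrite -mulmxA -QE -PE f'K mul1mx.
have dimE : rdegree M = rdegree N.
  apply/eqP; rewrite eqn_leq -{1}(mxrank1 C (rdegree M)) -QP mulmx_max_rank.
  by rewrite -{1}(mxrank1 C (rdegree N)) -PQ mulmx_max_rank.
apply: (MxReprSim (B := Q)) => //.
  by apply/row_freeP; exists P.
move=> g _; apply: mx_ext => v; rewrite -!mulmxA -!QE.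
by apply: (can_inj fK); rewrite fM !f'K.
Qed.

Lemma lin_of_rsim G (M N : rep G) : mx_rsim M N ->
  exists P Q, [/\ P *m Q = 1%:M, Q *m P = 1%:M &
    forall g, P *m M g = N g *m P].
Proof.
case: M N => [m M] [n N] [B /= mn]; case: n / mn N B => N B.
rewrite row_free_unit => Bu BE; exists (invmx B), B.
rewrite mulVmx // mulmxV //; split=> // g.
rewrite -[N g](mulKmx Bu) -[RHS]mulmxA; congr (_ *m _).
by rewrite -[LHS](mulmxK Bu) BE ?inE.
Qed.

Section Affords.
Variable G : finGroupType.

Lemma affords_rsim (V : lmodType C) (act : G -> V -> V) (M N : rep G) :
  affords act M -> affords act N -> mx_rsim M N.
Proof.
move=> [f [fL fb fM]] [f' [f'L [h f'K hK] f'M]].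
have hL := lin_inv f'L f'K hK.
apply: (@rsim_of_lin _ M N (h \o f)).
- by move=> c u v /=; rewrite fL hL.
- by apply: bij_comp => //; exists f'.
- by move=> g v /=; apply: (can_inj f'K); rewrite hK f'M hK fM.
Qed.

Lemma affords_iso (V V' : lmodType C) (act : G -> V -> V) (act' : G -> V' -> V')
    (f : V -> V') (f' : V' -> V) (M : rep G) :
    linear f -> cancel f f' -> cancel f' f ->
    (forall g v, f (act g v) = act' g (f v)) ->
  affords act M -> affords act' M.
Proof.
move=> fL fK f'K fact [h [hL hb hM]]; exists (f \o h); split.
- by move=> c u v /=; rewrite hL fL.
- by apply: bij_comp => //; exists f'.
- by move=> g v /=; rewrite hM fact.
Qed.

Lemma affords_sum (V V' W : lmodType C) (act : G -> V -> V) (act' : G -> V' -> V')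
    (actW : G -> W -> W) (M M' : rep G)
    (i : {linear V -> W}) (i' : {linear V' -> W})
    (p : {linear W -> V}) (p' : {linear W -> V'}) :
    (forall v, p (i v) = v) -> (forall v, p' (i' v) = v) ->
    (forall v, p (i' v) = 0) -> (forall v, p' (i v) = 0) ->
    (forall w, i (p w) + i' (p' w) = w) ->
    (forall g, linear (actW g)) ->
    (forall g v, i (act g v) = actW g (i v)) ->
    (forall g v, i' (act' g v) = actW g (i' v)) ->
  affords act M -> affords act' M' -> affords actW (dadd_grepr M M').
Proof.
move=> pi p'i' pi' p'i ip actL iact i'act [f [fL [h fK hK] fM]]
  [f' [f'L [h' f'K h'K] f'M]].
exists (fun w => i (f (usubmx w)) + i' (f' (dsubmx w))); split.
- move=> c u v; rewrite !linearP fL f'L !linearP scalerDr.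
  by rewrite addrACA.
- exists (fun w => col_mx (h (p w)) (h' (p' w))) => w.
    by rewrite !linearD pi pi' p'i p'i' addr0 add0r fK f'K vsubmxK.
  by rewrite col_mxKu col_mxKd hK h'K ip.
- move=> g v; rewrite /= -[in LHS](vsubmxK v) mul_block_col !mul0mx addr0 add0r.
  rewrite col_mxKu col_mxKd fM f'M iact i'act.
  by rewrite -[X in X + _]scale1r -actL scale1r.
Qed.

Lemma affords_exists (V : lmodType C) (act : G -> V -> V) (I : finType) (e : I -> V) :
    (forall v, exists c : I -> C, v = \sum_i c i *: e i) ->
    (forall g, linear (act g)) -> (forall v, act 1%g v = v) ->
    (forall g h v, act (g * h)%g v = act g (act h v)) ->
  exists M, affords act M.
Proof.
move=> /findim_iso [n [f [fL [f' fK f'K]]]] actL act1 actM.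
have f'L := lin_inv fL fK f'K.
have /choice [P PE] : forall g, exists P, forall v, f' (act g (f v)) = P *m v.
  by move=> g; apply: lin_mx => c u v; rewrite fL actL f'L.
have Prep : mx_repr [set: G]%G P.
  split=> [|g h _ _]; apply: mx_ext => v.
    by rewrite -PE act1 fK mul1mx.
  by rewrite -mulmxA -!PE f'K -actM.
exists (Representation (MxRepresentation Prep)), f; split=> //; first by exists f'.
by move=> g v; rewrite /= -PE f'K.
Qed.
End Affords.

(* U (x)_{CG} M, for a right CG-module U and a left CG-module M               *)
Section TensorG.
Variables (G : finGroupType) (U M : lmodType C).
Variables (r : U -> G -> U) (l : G -> M -> M).

Inductive tensG_rel : lexp C (U * M) -> lexp C (U * M) -> Prop :=
| tensG_addl u u' m :
    tensG_rel (Lgen (u + u', m)) (Ladd (Lgen (u, m)) (Lgen (u', m)))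
| tensG_addr u m m' :
    tensG_rel (Lgen (u, m + m')) (Ladd (Lgen (u, m)) (Lgen (u, m')))
| tensG_scalel c u m : tensG_rel (Lgen (c *: u, m)) (Lscale c (Lgen (u, m)))
| tensG_scaler c u m : tensG_rel (Lgen (u, c *: m)) (Lscale c (Lgen (u, m)))
| tensG_bal u g m : tensG_rel (Lgen (r u g, m)) (Lgen (u, l g m)).

Definition tensG : lmodType C := pres tensG_rel.

Definition tenG (u : U) (m : M) : tensG := pgen tensG_rel (u, m).

Lemma tenG_linl m : linear (tenG^~ m).
Proof.
move=> c u v; rewrite /tenG; have /= -> := pgen_rel (tensG_addl (c *: u) v m).
by have /= -> := pgen_rel (tensG_scalel c u m).
Qed.

Lemma tenG_linr u : linear (tenG u).
Proof.
move=> c m n; rewrite /tenG; have /= -> := pgen_rel (tensG_addr u (c *: m) n).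
by have /= -> := pgen_rel (tensG_scaler c u m).
Qed.

Lemma tenG_bal u g m : tenG (r u g) m = tenG u (l g m).
Proof. by rewrite /tenG; have /= -> := pgen_rel (tensG_bal u g m). Qed.

Section Lift.
Variables (W : lmodType C) (b : U -> M -> W).
Hypotheses (bl : forall m, linear (b^~ m)) (br : forall u, linear (b u))
  (bal : forall u g m, b (r u g) m = b u (l g m)).

Lemma tensG_lift_rel x y : tensG_rel x y ->
  leval (fun p => b p.1 p.2) x = leval (fun p => b p.1 p.2) y.
Proof.
have b0l m : b 0 m = 0.
  by rewrite -[X in b X m](addNr 0) -scaleN1r bl scaleN1r addNr.
have b0r u : b u 0 = 0.
  by rewrite -[X in b u X](addNr 0) -scaleN1r br scaleN1r addNr.
case=> [u u' m|u m m'|c u m|c u m|u g m] /=.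
- by rewrite -[u]scale1r bl !scale1r.
- by rewrite -[m]scale1r br !scale1r.
- by rewrite -[c *: u]addr0 bl b0l addr0.
- by rewrite -[c *: m]addr0 br b0r addr0.
- exact: bal.
Qed.

Definition tensG_lift : {linear tensG -> W} := plift tensG_lift_rel.

Lemma tensG_liftE u m : tensG_lift (tenG u m) = b u m.
Proof. exact: plift_gen. Qed.
End Lift.
End TensorG.

(* the bimodule CY : the free vector space on Y with a y identified with the  *)
(* scalar multiple of y by a                                                  *)
Section FiberedBimodule.
Variables (H G : finGroupType) (Y : fbiset A H G).

Inductive lin_rel : lexp C Y -> lexp C Y -> Prop :=
| lin_fib a y : lin_rel (Lgen (a \f y)) (Lscale (iota a) (Lgen y)).

Definition linY : lmodType C := pres lin_rel.

Definition ygen (y : Y) : linY := pgen lin_rel y.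

Lemma ygen_fib a y : ygen (a \f y) = iota a *: ygen y.
Proof. by rewrite /ygen; have /= -> := pgen_rel (lin_fib a y). Qed.

Section Lift.
Variables (W : lmodType C) (f : Y -> W).
Hypothesis fA : forall a y, f (a \f y) = iota a *: f y.

Lemma linY_lift_rel x y : lin_rel x y -> leval f x = leval f y.
Proof. by case=> a z; apply: fA. Qed.

Definition linY_lift : {linear linY -> W} := plift linY_lift_rel.

Lemma linY_liftE y : linY_lift (ygen y) = f y.
Proof. exact: plift_gen. Qed.
End Lift.

Lemma linY_lact_fib h a y : ygen (h \l a \f y) = iota a *: ygen (h \l y).
Proof. by rewrite lfact ygen_fib. Qed.
Lemma linY_ract_fib g a y : ygen ((a \f y) \r g) = iota a *: ygen (y \r g).
Proof. by rewrite rfact ygen_fib. Qed.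

Definition linY_lact (h : H) : {linear linY -> linY} := linY_lift (linY_lact_fib h).
Definition linY_ract (u : linY) (g : G) : linY := linY_lift (linY_ract_fib g) u.

Lemma linY_ext (W : lmodType C) (f g : linY -> W) : linear f -> linear g ->
  (forall y, f (ygen y) = g (ygen y)) -> f =1 g.
Proof.
move=> fL gL.
pose f' : {linear linY -> W} := HB.pack f (GRing.isLinear.Build _ _ _ _ _ fL).
pose g' : {linear linY -> W} := HB.pack g (GRing.isLinear.Build _ _ _ _ _ gL).
exact: (@pres_ext _ _ _ _ f' g').
Qed.

Section Tensor.
Variable M : rep G.

Definition lact_rep (g : G) (v : 'cV[C]_(rdegree M)) := M g *m v.

Definition YM : lmodType C := tensG linY_ract lact_rep.

Definition yten (y : Y) (v : 'cV[C]_(rdegree M)) : YM :=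
  tenG linY_ract lact_rep (ygen y) v.

Lemma yten_lin y : linear (yten y).
Proof. exact: tenG_linr. Qed.

Lemma yten_fib a y v : yten (a \f y) v = iota a *: yten y v.
Proof.
rewrite /yten ygen_fib.
by rewrite /tenG; have /= -> := pgen_rel (tensG_scalel linY_ract lact_rep (iota a) (ygen y) v).
Qed.

Lemma yten_bal y g v : yten (y \r g) v = yten y (M g *m v).
Proof. by rewrite -[RHS]tenG_bal /linY_ract linY_liftE. Qed.

Lemma YM_ext (W : lmodType C) (f g : YM -> W) : linear f -> linear g ->
  (forall y v, f (yten y v) = g (yten y v)) -> f =1 g.
Proof.
move=> fL gL fg.
pose f' : {linear YM -> W} := HB.pack f (GRing.isLinear.Build _ _ _ _ _ fL).
pose g' : {linear YM -> W} := HB.pack g (GRing.isLinear.Build _ _ _ _ _ gL).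
apply: (@pres_ext _ _ _ _ f' g') => -[u v].
have compL (h : {linear YM -> W}) : linear (fun u => h (tenG linY_ract lact_rep u v)).
  by move=> c u1 u2; rewrite tenG_linl linearP.
exact: (linY_ext (compL f') (compL g') (fun y => fg y v) u).
Qed.

Section Lift.
Variables (W : lmodType C) (b : Y -> 'cV[C]_(rdegree M) -> W).
Hypotheses (bA : forall a y v, b (a \f y) v = iota a *: b y v)
  (bL : forall y, linear (b y))
  (bB : forall y g v, b (y \r g) v = b y (M g *m v)).

Let b1 v : {linear linY -> W} := linY_lift (fun a y => bA a y v).

Let b1l v : linear (fun u => b1 v u). Proof. exact: linearP. Qed.

Let b1r u : linear (fun v => b1 v u).
Proof.
move=> c v w; move: u.
have lin : linear (fun u => c *: b1 v u + b1 w u).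
  move=> d x y.
  have L z : b1 z (d *: x + y) = d *: b1 z x + b1 z y by exact: linearP.
  by rewrite !L !scalerDr !scalerA [c * d]mulrC addrACA.
by apply: (linY_ext (b1l _) lin) => y; rewrite /b1 !linY_liftE bL.
Qed.

Let b1B u g v : b1 v (linY_ract u g) = b1 (lact_rep g v) u.
Proof.
move: u; apply: linY_ext => [c x y|c x y|y].
- by rewrite /linY_ract !linearP.
- by rewrite linearP.
- by rewrite /linY_ract /b1 !linY_liftE bB.
Qed.

Definition YM_lift : {linear YM -> W} := tensG_lift b1l b1r b1B.

Lemma YM_liftE y v : YM_lift (yten y v) = b y v.
Proof. by rewrite /YM_lift tensG_liftE /b1 linY_liftE. Qed.
End Lift.

Lemma YM_act_fib h a y v : yten (h \l a \f y) v = iota a *: yten (h \l y) v.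
Proof. by rewrite lfact yten_fib. Qed.

Lemma YM_act_bal h y g v : yten (h \l (y \r g)) v = yten (h \l y) (M g *m v).
Proof. by rewrite lract yten_bal. Qed.

Definition YM_act (h : H) : {linear YM -> YM} :=
  YM_lift (YM_act_fib h) (fun y => yten_lin (h \l y)) (YM_act_bal h).

Lemma YM_actE h y v : YM_act h (yten y v) = yten (h \l y) v.
Proof. exact: YM_liftE. Qed.

Lemma YM_act1 v : YM_act 1%g v = v.
Proof.
move: v; apply: YM_ext => [||y v]; rewrite ?YM_actE ?lact1 //; exact: linearP.
Qed.

Lemma YM_actM h k v : YM_act (h * k)%g v = YM_act h (YM_act k v).
Proof.
move: v; apply: YM_ext => [||y v]; first exact: linearP.
  by move=> c u v; rewrite !linearP.
by rewrite !YM_actE lactM.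
Qed.

Lemma YM_affords : exists N, affords YM_act N.
Proof.
have [J [r hr]] := fact_fin (fb_on Y).
pose e (k : J * 'I_(rdegree M)) := yten (r k.1) (delta_mx k.2 0).
pose P (x : YM) := exists c, x = \sum_k c k *: e k.
have P0 : P 0.
  by exists (fun=> 0); rewrite big1 // => k _; rewrite scale0r.
have PD x y : P x -> P y -> P (x + y).
  case=> c -> [d ->]; exists (fun k => c k + d k).
  by rewrite -big_split; apply: eq_bigr => k _; rewrite scalerDl.
have PZ a x : P x -> P (a *: x).
  case=> c ->; exists (fun k => a * c k).
  by rewrite scaler_sumr; apply: eq_bigr => k _; rewrite scalerA.
have Pe k : P (e k).
  exists (fun j => (j == k)%:R); rewrite (bigD1 k) //= eqxx scale1r big1 ?addr0 //.
  by move=> j /negPf ->; rewrite scale0r.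
have Py y v : P (yten y v).
  have [a [j ->]] := hr y; rewrite yten_fib; apply: (PZ).
  pose h : {linear 'cV[C]_(rdegree M) -> YM} :=
    HB.pack (yten (r j)) (GRing.isLinear.Build _ _ _ _ _ (yten_lin (r j))).
  rewrite -[yten (r j) v]/(h v) (matrix_sum_delta v) linear_sum.
  apply: (big_ind P) => // i _; rewrite big_ord1 linearZ; apply: (PZ).
  exact: (Pe (j, i)).
apply: (@affords_exists _ _ _ _ e) => [x|g|x|g h x].
- rewrite -[exists c, _]/(P x); elim/pres_ind: x => // -[u v].
  rewrite -[pgen _ _]/(tenG linY_ract lact_rep u v).
  pose h : {linear linY -> YM} := HB.pack (fun u => tenG linY_ract lact_rep u v)
    (GRing.isLinear.Build _ _ _ _ _ (@tenG_linl _ _ _ linY_ract lact_rep v)).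
  rewrite -[tenG _ _ u v]/(h u); elim/pres_ind: u => [y||x y Px Py'|c x Px].
  + exact: Py.
  + by rewrite linear0.
  + by rewrite linearD; apply: PD.
  + by rewrite linearZ; apply: (PZ).
- exact: linearP.
- exact: YM_act1.
- exact: YM_actM.
Qed.
End Tensor.
End FiberedBimodule.

Arguments yten {H G Y} M y v.
(* A matrix representation isomorphic to CY (x)_{CG} M, on which H acts by    *)
(* left multiplication on Y                                                   *)
Definition YM_rep (H G : finGroupType) (Y : fbiset A H G) (M : rep G) : rep H :=
  sval (cid (YM_affords Y M)).

Lemma YM_repP (H G : finGroupType) (Y : fbiset A H G) (M : rep G) :
  affords (YM_act Y M) (YM_rep Y M).
Proof. by rewrite /YM_rep; case: cid. Qed.

Lemma affords_YM_iso (H G : finGroupType) (Y Y' : fbiset A H G) (M : rep G) N :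
  fb_iso Y Y' -> affords (YM_act Y M) N -> affords (YM_act Y' M) N.
Proof.
case=> f [[f' fK f'K] fl fr fa].
have f'r y g : f' (y \r g) = f' y \r g by rewrite -[y in LHS]f'K -fr fK.
have f'a a y : f' (a \f y) = a \f f' y by rewrite -[y in LHS]f'K -fa fK.
pose F : {linear YM Y M -> YM Y' M} :=
  @YM_lift _ _ Y M _ (fun y v => yten M (f y) v)
    ltac:(by move=> a y v; cbv beta; rewrite fa yten_fib)
    ltac:(by move=> y; apply: yten_lin)
    ltac:(by move=> y g v; cbv beta; rewrite fr yten_bal).
pose F' : {linear YM Y' M -> YM Y M} :=
  @YM_lift _ _ Y' M _ (fun y v => yten M (f' y) v)
    ltac:(by move=> a y v; cbv beta; rewrite f'a yten_fib)
    ltac:(by move=> y; apply: yten_lin)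
    ltac:(by move=> y g v; cbv beta; rewrite f'r yten_bal).
apply: (@affords_iso _ _ _ _ _ F F'); first exact: linearP.
- apply: YM_ext => [c u v||y v]; rewrite ?linearP //.
  by rewrite /F /F' !YM_liftE fK.
- apply: YM_ext => [c u v||y v]; rewrite ?linearP //.
  by rewrite /F /F' !YM_liftE f'K.
- move=> h; apply: YM_ext => [c u v|c u v|y v]; rewrite ?linearP //.
  by rewrite /F !YM_actE !YM_liftE ?YM_actE fl.
Qed.

Lemma affords_YM_rsim (H G : finGroupType) (Y : fbiset A H G) (M M' : rep G) N :
  mx_rsim M M' -> affords (YM_act Y M) N -> affords (YM_act Y M') N.
Proof.
case/lin_of_rsim=> P [Q [PQ QP PM]].
have QM g : Q *m M' g = M g *m Q.
  by rewrite -[RHS]mul1mx -QP -!mulmxA [P *m (_ *m _)]mulmxA PM -mulmxA PQ mulmx1.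
pose F : {linear YM Y M -> YM Y M'} :=
  @YM_lift _ _ Y M _ (fun y v => yten M' y (P *m v))
    ltac:(by move=> a y v; cbv beta; rewrite yten_fib)
    ltac:(by move=> y c u v; cbv beta; rewrite linearP yten_lin)
    ltac:(by move=> y g v; cbv beta; rewrite yten_bal !mulmxA PM).
pose F' : {linear YM Y M' -> YM Y M} :=
  @YM_lift _ _ Y M' _ (fun y v => yten M y (Q *m v))
    ltac:(by move=> a y v; cbv beta; rewrite yten_fib)
    ltac:(by move=> y c u v; cbv beta; rewrite linearP yten_lin)
    ltac:(by move=> y g v; cbv beta; rewrite yten_bal !mulmxA QM).
apply: (@affords_iso _ _ _ _ _ F F'); first exact: linearP.
- apply: YM_ext => [c u v||y v]; rewrite ?linearP //.
  by rewrite /F /F' !YM_liftE mulmxA QP mul1mx.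
- apply: YM_ext => [c u v||y v]; rewrite ?linearP //.
  by rewrite /F /F' !YM_liftE mulmxA PQ mul1mx.
- move=> h; apply: YM_ext => [c u v|c u v|y v]; rewrite ?linearP //.
  by rewrite /F !YM_actE !YM_liftE ?YM_actE.
Qed.

Lemma yten0 (H G : finGroupType) (Y : fbiset A H G) (M : rep G) (y : Y) :
  yten M y 0 = 0.
Proof. by rewrite -[X in yten _ _ X](addNr 0) -scaleN1r yten_lin scaleN1r addNr. Qed.

Lemma lin0fun (U V : lmodType C) : linear (fun _ : U => 0 : V).
Proof. by move=> c u v; rewrite scaler0 addr0. Qed.

Lemma affords_YM_suml (H G : finGroupType) (Y Y' : fbiset A H G) (M : rep G) :
  affords (YM_act (fb_sum Y Y') M) (dadd_grepr (YM_rep Y M) (YM_rep Y' M)).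
Proof.
pose i : {linear YM Y M -> YM (fb_sum Y Y') M} :=
  @YM_lift _ _ Y M _ (fun y v => @yten _ _ (fb_sum Y Y') M (inl y) v)
    ltac:(by move=> a y v; cbv beta; rewrite -yten_fib)
    ltac:(by move=> y; apply: yten_lin)
    ltac:(by move=> y g v; cbv beta; rewrite -yten_bal).
pose i' : {linear YM Y' M -> YM (fb_sum Y Y') M} :=
  @YM_lift _ _ Y' M _ (fun y v => @yten _ _ (fb_sum Y Y') M (inr y) v)
    ltac:(by move=> a y v; cbv beta; rewrite -yten_fib)
    ltac:(by move=> y; apply: yten_lin)
    ltac:(by move=> y g v; cbv beta; rewrite -yten_bal).
pose p : {linear YM (fb_sum Y Y') M -> YM Y M} :=
  @YM_lift _ _ (fb_sum Y Y') M _
    (fun y v => match y : Y + Y' with inl y => yten M y v | inr _ => 0 end)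
    ltac:(by move=> a [] y v /=; cbv beta; rewrite ?yten_fib ?scaler0)
    ltac:(by move=> [] y; [apply: yten_lin | apply: lin0fun])
    ltac:(by move=> [] y g v /=; cbv beta; rewrite ?yten_bal).
pose p' : {linear YM (fb_sum Y Y') M -> YM Y' M} :=
  @YM_lift _ _ (fb_sum Y Y') M _
    (fun y v => match y : Y + Y' with inl _ => 0 | inr y => yten M y v end)
    ltac:(by move=> a [] y v /=; cbv beta; rewrite ?yten_fib ?scaler0)
    ltac:(by move=> [] y; [apply: lin0fun | apply: yten_lin])
    ltac:(by move=> [] y g v /=; cbv beta; rewrite ?yten_bal).
apply: (@affords_sum _ _ _ _ _ _ _ _ _ i i' p p') (YM_repP _ _) (YM_repP _ _).
- apply: YM_ext => [c u v||y v]; rewrite ?linearP //.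
  by rewrite /i /p !YM_liftE.
- apply: YM_ext => [c u v||y v]; rewrite ?linearP //.
  by rewrite /i' /p' !YM_liftE.
- apply: YM_ext => [c u v||y v]; rewrite ?linearP //; first exact: lin0fun.
  by rewrite /i' /p !YM_liftE.
- apply: YM_ext => [c u v||y v]; rewrite ?linearP //; first exact: lin0fun.
  by rewrite /i /p' !YM_liftE.
- apply: YM_ext => [c u v||[] y v] //.
  + by rewrite !linearP scalerDr addrACA.
  + by rewrite /i /i' /p /p' !YM_liftE linear0 addr0.
  + by rewrite /i /i' /p /p' !YM_liftE linear0 add0r.
- by move=> h; apply: linearP.
- move=> h; apply: YM_ext => [c u v|c u v|y v]; rewrite ?linearP //.
  by rewrite /i YM_actE !YM_liftE ?YM_actE.
- move=> h; apply: YM_ext => [c u v|c u v|y v]; rewrite ?linearP //.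
  by rewrite /i' YM_actE !YM_liftE ?YM_actE.
Qed.

Lemma affords_YM_sumr (H G : finGroupType) (Y : fbiset A H G) (M M' : rep G) :
  affords (YM_act Y (dadd_grepr M M')) (dadd_grepr (YM_rep Y M) (YM_rep Y M')).
Proof.
set D := dadd_grepr M M'.
pose inu (v : 'cV[C]_(rdegree M)) : 'cV[C]_(rdegree D) := col_mx v 0.
pose ind (v : 'cV[C]_(rdegree M')) : 'cV[C]_(rdegree D) := col_mx 0 v.
pose pu (v : 'cV[C]_(rdegree D)) : 'cV[C]_(rdegree M) := usubmx v.
pose pd (v : 'cV[C]_(rdegree D)) : 'cV[C]_(rdegree M') := dsubmx v.
have inuL : linear inu.
  by move=> c u v; rewrite /inu scale_col_mx add_col_mx scaler0 addr0.
have indL : linear ind.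
  by move=> c u v; rewrite /ind scale_col_mx add_col_mx scaler0 addr0.
have puL : linear pu by move=> c u v; rewrite /pu linearP.
have pdL : linear pd by move=> c u v; rewrite /pd linearP.
have inuM g v : D g *m inu v = inu (M g *m v).
  by rewrite /inu /= mul_block_col !mul0mx !mulmx0 !addr0.
have indM g v : D g *m ind v = ind (M' g *m v).
  by rewrite /ind /= mul_block_col !mul0mx !mulmx0 !add0r.
have puM g v : pu (D g *m v) = M g *m pu v.
  by rewrite /pu -[in LHS](vsubmxK v) /= mul_block_col !mul0mx !addr0 col_mxKu.
have pdM g v : pd (D g *m v) = M' g *m pd v.
  by rewrite /pd -[in LHS](vsubmxK v) /= mul_block_col !mul0mx !add0r col_mxKd.
pose i : {linear YM Y M -> YM Y D} :=
  @YM_lift _ _ Y M _ (fun y v => yten D y (inu v))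
    ltac:(by move=> a y v; cbv beta; rewrite -yten_fib)
    ltac:(by move=> y c u v; cbv beta; rewrite inuL yten_lin)
    ltac:(by move=> y g v; cbv beta; rewrite yten_bal inuM).
pose i' : {linear YM Y M' -> YM Y D} :=
  @YM_lift _ _ Y M' _ (fun y v => yten D y (ind v))
    ltac:(by move=> a y v; cbv beta; rewrite -yten_fib)
    ltac:(by move=> y c u v; cbv beta; rewrite indL yten_lin)
    ltac:(by move=> y g v; cbv beta; rewrite yten_bal indM).
pose p : {linear YM Y D -> YM Y M} :=
  @YM_lift _ _ Y D _ (fun y v => yten M y (pu v))
    ltac:(by move=> a y v; cbv beta; rewrite -yten_fib)
    ltac:(by move=> y c u v; cbv beta; rewrite puL yten_lin)
    ltac:(by move=> y g v; cbv beta; rewrite yten_bal puM).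
pose p' : {linear YM Y D -> YM Y M'} :=
  @YM_lift _ _ Y D _ (fun y v => yten M' y (pd v))
    ltac:(by move=> a y v; cbv beta; rewrite -yten_fib)
    ltac:(by move=> y c u v; cbv beta; rewrite pdL yten_lin)
    ltac:(by move=> y g v; cbv beta; rewrite yten_bal pdM).
apply: (@affords_sum _ _ _ _ _ _ _ _ _ i i' p p') (YM_repP _ _) (YM_repP _ _).
- apply: YM_ext => [c u v||y v]; rewrite ?linearP //.
  by rewrite /i /p !YM_liftE /inu /pu col_mxKu.
- apply: YM_ext => [c u v||y v]; rewrite ?linearP //.
  by rewrite /i' /p' !YM_liftE /ind /pd col_mxKd.
- apply: YM_ext => [c u v||y v]; rewrite ?linearP //; first exact: lin0fun.
  by rewrite /i' /p !YM_liftE /ind /pu col_mxKu yten0.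
- apply: YM_ext => [c u v||y v]; rewrite ?linearP //; first exact: lin0fun.
  by rewrite /i /p' !YM_liftE /inu /pd col_mxKd yten0.
- apply: YM_ext => [c u v||y v] //.
  + by rewrite !linearP scalerDr addrACA.
  + rewrite /i /i' /p /p' !YM_liftE -[X in X + _]scale1r -yten_lin scale1r.
    by rewrite /inu /ind add_col_mx addr0 add0r vsubmxK.
- by move=> h; apply: linearP.
- move=> h; apply: YM_ext => [c u v|c u v|y v]; rewrite ?linearP //.
  by rewrite /i YM_actE !YM_liftE ?YM_actE.
- move=> h; apply: YM_ext => [c u v|c u v|y v]; rewrite ?linearP //.
  by rewrite /i' YM_actE !YM_liftE ?YM_actE.
Qed.

Lemma affords_YM_id (G : finGroupType) (M : rep G) : affords (YM_act (fb_id A G) M) M.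
Proof.
have MM g h : M (g * h)%g = M g *m M h by rewrite repr_mxM ?inE.
have bE (a : A) (g : G) (v : 'cV_(rdegree M)) :
    @yten _ _ (fb_id A G) M (a, g) v =
    iota a *: @yten _ _ (fb_id A G) M (1%g, 1%g) (M g *m v).
  by rewrite -yten_bal -yten_fib /= mulg1 mul1g.
pose F : {linear YM (fb_id A G) M -> 'cV[C]_(rdegree M)} :=
  @YM_lift _ _ (fb_id A G) M _
    (fun (y : A * G) v => iota y.1 *: (M y.2 *m v) : 'cV[C]_(rdegree M))
    ltac:(by move=> a [b g] v; cbv beta; rewrite /= embM scalerA)
    ltac:(by move=> y c u v; cbv beta; rewrite linearP scalerDr !scalerA mulrC)
    ltac:(by move=> [b g] h v; cbv beta; rewrite /= MM mulmxA).
exists (@yten _ _ (fb_id A G) M (1%g, 1%g)); split; first exact: yten_lin.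
- exists F => [v|]; first by rewrite /F YM_liftE /= emb1 scale1r repr_mx1 mul1mx.
  apply: YM_ext => [c u v||[a g] v]; rewrite ?linearP ?yten_lin //.
  rewrite /F YM_liftE bE -[X in yten _ _ X]addr0 yten_lin.
  by rewrite yten0 addr0.
- move=> g v; rewrite YM_actE /= [RHS]bE emb1 scale1r.
  by rewrite mulg1.
Qed.

Section Comp.
Variables (K H G : finGroupType) (X : fbiset A K H) (Y : fbiset A H G) (M : rep G).

Let T := fb_tens X Y.

Definition tq_yten (q : tens_quot X Y) (v : 'cV[C]_(rdegree M)) : YM T M :=
  if pselect (tq_free q) is left h then @yten _ _ T M (exist _ q h) v else 0.

Lemma tq_yten_free (q : T) v : tq_yten (sval q) v = yten M q v.
Proof.
rewrite /tq_yten; case: pselect => [h|/(_ (svalP q))//].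
by congr (yten M _ v); apply: tens_eq.
Qed.

Lemma tq_yten_lin q : linear (tq_yten q).
Proof.
rewrite /tq_yten; case: pselect => h; [exact: yten_lin | exact: lin0fun].
Qed.

Lemma tq_free_factE a (q : tens_quot X Y) : tq_free (tq_fact a q) -> tq_free q.
Proof.
move=> /(@tq_free_fact _ _ _ _ _ _ a^-1%g); rewrite -tq_factM mulVg tq_fact1.
exact.
Qed.

Lemma tq_free_lactE k (q : tens_quot X Y) : tq_free (tq_lact k q) -> tq_free q.
Proof.
move=> /(@tq_free_lact _ _ _ _ _ _ k^-1%g); rewrite -tq_lactM mulVg tq_lact1.
exact.
Qed.

Lemma tq_free_ractE g (q : tens_quot X Y) : tq_free (tq_ract q g) -> tq_free q.
Proof.
move=> /(@tq_free_ract _ _ _ _ _ _ g^-1%g); rewrite -tq_ractM mulgV tq_ract1.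
exact.
Qed.

Lemma tq_yten_fact a q v : tq_yten (tq_fact a q) v = iota a *: tq_yten q v.
Proof.
have [h|h] := pselect (tq_free q).
  pose q' : T := exist _ q h.
  by rewrite (tq_yten_free q') -yten_fib -tq_yten_free.
rewrite /tq_yten; case: pselect => [/tq_free_factE//|_].
by case: pselect => // _; rewrite scaler0.
Qed.

Lemma tq_yten_ract q g v : tq_yten (tq_ract q g) v = tq_yten q (M g *m v).
Proof.
have [h|h] := pselect (tq_free q).
  pose q' : T := exist _ q h.
  by rewrite (tq_yten_free q') -yten_bal -tq_yten_free.
rewrite /tq_yten; case: pselect => [/tq_free_ractE//|_].
by case: pselect.
Qed.

Lemma tq_yten_lact k q v : tq_yten (tq_lact k q) v = YM_act T M k (tq_yten q v).
Proof.
have [h|h] := pselect (tq_free q).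
  pose q' : T := exist _ q h.
  by rewrite (tq_yten_free q') YM_actE -tq_yten_free.
rewrite /tq_yten; case: pselect => [/tq_free_lactE//|_].
by case: pselect => // _; rewrite linear0.
Qed.

Let Phi (x : X) : {linear YM Y M -> YM T M} :=
  @YM_lift _ _ Y M _ (fun y v => tq_yten (tq x y) v)
    ltac:(by move=> a y v; cbv beta; rewrite -tqA -tq_factE tq_yten_fact)
    ltac:(by move=> y; apply: tq_yten_lin)
    ltac:(by move=> y g v; cbv beta; rewrite -tq_ractE tq_yten_ract).

Let PhiE x y v : Phi x (yten M y v) = tq_yten (tq x y) v.
Proof. exact: YM_liftE. Qed.

Let Phi_fib a x w : Phi (a \f x) w = iota a *: Phi x w.
Proof.
move: w; apply: YM_ext => [|c u v|y v]; first exact: linearP.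
  have -> : Phi x (c *: u + v) = c *: Phi x u + Phi x v by exact: linearP.
  by rewrite scalerDr !scalerA mulrC.
by rewrite !PhiE -tq_factE tq_yten_fact.
Qed.

Let Phi_ract x h w : Phi (x \r h) w = Phi x (YM_act Y M h w).
Proof.
move: w; apply: YM_ext => [c u v|c u v|y v]; rewrite ?linearP //.
by rewrite YM_actE !PhiE tqH.
Qed.

Let Phi_lact k x w : Phi (k \l x) w = YM_act T M k (Phi x w).
Proof.
move: w; apply: YM_ext => [c u v|c u v|y v]; rewrite ?linearP //.
by rewrite !PhiE -tq_lactE tq_yten_lact.
Qed.

Lemma affords_YM_comp R :
  affords (YM_act X (YM_rep Y M)) R -> affords (YM_act T M) R.
Proof.
set N := YM_rep Y M; have [f [fL [f' fK f'K] fN]] : affords (YM_act Y M) N.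
  exact: YM_repP.
have f'L := lin_inv fL fK f'K.
have f'N h w : f' (YM_act Y M h w) = N h *m f' w.
  by apply: (can_inj fK); rewrite fN !f'K.
have f'_fib a y v : f' (yten M (a \f y) v) = iota a *: f' (yten M y v).
  rewrite yten_fib -[X in f' X]addr0 f'L -[RHS]addr0; congr (_ + _).
  by rewrite -[X in f' X](addNr 0) -scaleN1r f'L scaleN1r addNr.
have f'_act h y v : f' (yten M (h \l y) v) = N h *m f' (yten M y v).
  by rewrite -f'N YM_actE.
have ytenZ x c w : yten N x (c *: w) = c *: yten N x w :> YM X N.
  by rewrite -[X in yten _ _ X]addr0 yten_lin yten0 addr0.
pose F : {linear YM X N -> YM T M} :=
  @YM_lift _ _ X N _ (fun x w => Phi x (f w))
    ltac:(by move=> a x w; cbv beta; rewrite Phi_fib)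
    ltac:(by move=> x c u v; cbv beta; rewrite fL linearP)
    ltac:(by move=> x h w; cbv beta; rewrite Phi_ract fN).
pose sg (q : tens_quot X Y) v : YM X N :=
  tq_lift (fun p => yten N p.1 (f' (yten M p.2 v))) q.
have sgE x y v : sg (tq x y) v = yten N x (f' (yten M y v)).
  apply: tq_liftE => x0 a h y0 /=.
  by rewrite yten_fib yten_bal f'_fib f'_act ytenZ.
have sg_fact a q v : sg (tq_fact a q) v = iota a *: sg q v.
  by elim/tq_ind: q => x y; rewrite tq_factE !sgE yten_fib.
have sg_ract q g v : sg (tq_ract q g) v = sg q (M g *m v).
  by elim/tq_ind: q => x y; rewrite tq_ractE !sgE yten_bal.
have sg_lin q : linear (sg q).
  by elim/tq_ind: q => x y c u v; rewrite !sgE yten_lin f'L yten_lin.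
have sg_nfree q v : ~ tq_free q -> sg q v = 0.
  move=> nf; apply: contrapT => ne; apply: nf => a e.
  apply: (emb_inj (m := iota)); rewrite emb1; apply/eqP; rewrite -subr_eq0.
  have /eqP : (iota a - 1) *: sg q v = 0.
    by rewrite scalerBl scale1r -sg_fact e subrr.
  by rewrite scaler_eq0 => /orP [//|/eqP].
pose F' : {linear YM T M -> YM X N} :=
  @YM_lift _ _ T M _ (fun (q : T) v => sg (sval q) v)
    ltac:(by move=> a q v; apply: sg_fact)
    ltac:(by move=> q; apply: sg_lin)
    ltac:(by move=> q g v; apply: sg_ract).
have FE x w : F (yten N x w) = Phi x (f w) by exact: YM_liftE.
have F'E (q : T) v : F' (yten M q v) = sg (sval q) v by exact: YM_liftE.
have F'yt q v : F' (tq_yten q v) = sg q v.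
  have [h|h] := pselect (tq_free q).
    by rewrite (tq_yten_free (exist _ q h)) F'E.
  rewrite sg_nfree // /tq_yten; case: pselect => // _.
  by rewrite linear0.
apply: (@affords_iso _ _ _ _ _ F F'); first exact: linearP.
- apply: YM_ext => [c u v||x w]; rewrite ?linearP //.
  rewrite FE -[in RHS](fK w); move: (f w); apply: YM_ext.
  + by move=> c u v; rewrite !linearP.
  + by move=> c u v; rewrite f'L yten_lin.
  + by move=> y v; rewrite PhiE F'yt sgE.
- apply: YM_ext => [c u v||[q hq] v]; rewrite ?linearP //.
  rewrite F'E [sval _]/=; elim/tq_ind: q hq => x y hq.
  rewrite sgE FE f'K PhiE.
  exact: (tq_yten_free (exist _ (tq x y) hq)).
- move=> k; apply: YM_ext => [c u v|c u v|x w]; rewrite ?linearP //.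
  by rewrite YM_actE !FE Phi_lact.
Qed.
End Comp.

(* R_C(G) is taken as the Grothendieck group of CG-modules with respect to     *)
(* direct sums; a module is given by its matrices, acting on column vectors.  *)
Definition rep_iso G (M N : rep G) : Prop := mx_rsim M N.
Definition Rgrp (G : finGroupType) : zmodType := K0 (@rep_iso G) (@dadd_grepr C G _).
Definition CR (G : finGroupType) : lmodType C := tensZ C (Rgrp G).
Definition rcls G (M : rep G) : CR G := kgen C (@rep_iso G) (@dadd_grepr C G _) M.

Definition CR_gen (G H : finGroupType) (Y : fbset_sk A H G) (M : rep G) : CR H :=
  rcls (YM_rep (fb_of_sk Y) M).

Lemma CR_gen_isol G H (Y Y' : fbset_sk A H G) (M : rep G) :
  sk_iso Y Y' -> CR_gen Y M = CR_gen Y' M.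
Proof.
move=> YY; apply: kgen_iso; apply: affords_rsim (YM_repP _ _).
exact: affords_YM_iso YY (YM_repP _ _).
Qed.

Lemma CR_gen_isor G H (Y : fbset_sk A H G) (M M' : rep G) :
  rep_iso M M' -> CR_gen Y M = CR_gen Y M'.
Proof.
move=> MM; apply: kgen_iso; apply: affords_rsim (YM_repP _ _).
exact: affords_YM_rsim MM (YM_repP _ _).
Qed.

Lemma CR_gen_suml G H (Y Y' : fbset_sk A H G) (M : rep G) :
  CR_gen (sk_sum Y Y') M = CR_gen Y M + CR_gen Y' M.
Proof.
rewrite /CR_gen /rcls -kgen_sum; apply: kgen_iso.
apply: affords_rsim (affords_YM_suml _ _ _).
exact: affords_YM_iso (fb_skK _) (YM_repP _ _).
Qed.

Lemma CR_gen_sumr G H (Y : fbset_sk A H G) (M M' : rep G) :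
  CR_gen Y (dadd_grepr M M') = CR_gen Y M + CR_gen Y M'.
Proof.
rewrite /CR_gen /rcls -kgen_sum; apply: kgen_iso.
exact: affords_rsim (YM_repP _ _) (affords_YM_sumr _ _ _).
Qed.

Definition CR_map G H (phi : Chom A C G H) : CR G -> CR H :=
  kbilin (@CR_gen_isol G H) (@CR_gen_suml G H)
         (@CR_gen_isor G H) (@CR_gen_sumr G H) phi.

Lemma CR_mapE G H (Y : fbiset A H G) (M : rep G) :
  CR_map (bcls C Y) (rcls M) = rcls (YM_rep Y M).
Proof.
rewrite /CR_map kbilin_gen; apply: kgen_iso.
apply: affords_rsim (YM_repP _ _).
exact: affords_YM_iso (fb_skK _) (YM_repP _ _).
Qed.

Lemma CR_map_linearl G H (x : CR G) : linear (fun phi : Chom A C G H => CR_map phi x).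
Proof. exact: kbilin_linearl. Qed.

Lemma CR_map_linearr G H (phi : Chom A C G H) : linear (CR_map phi).
Proof. exact: kbilin_linearr. Qed.

Lemma CR_map_id G (x : CR G) : CR_map (Cid A C G) x = x.
Proof.
move: x; apply: CK0_extP => [||M]; [exact: CR_map_linearr | by [] |].
rewrite -/(rcls M) CR_mapE; apply: kgen_iso.
exact: affords_rsim (YM_repP _ _) (affords_YM_id _).
Qed.

Lemma CR_map_comp G H K (phi : Chom A C H K) (psi : Chom A C G H) (x : CR G) :
  CR_map (Ccomp phi psi) x = CR_map phi (CR_map psi x).
Proof.
move: x; apply: CK0_extP => [||M].
- exact: CR_map_linearr.
- by move=> c u v; rewrite !CR_map_linearr.
rewrite -/(rcls M); move: psi; apply: CK0_extP => [||Y].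
- by move=> c u v; rewrite [Ccomp _ _]kbilin_linearr CR_map_linearl.
- by move=> c u v; rewrite CR_map_linearl CR_map_linearr.
rewrite -bcls_sk; move: phi; apply: CK0_extP => [||X].
- by move=> c u v; rewrite [Ccomp _ _]kbilin_linearl CR_map_linearl.
- by move=> c u v; rewrite CR_map_linearl.
rewrite -bcls_sk CcompE !CR_mapE; apply: kgen_iso.
apply: affords_rsim (YM_repP _ _) _.
exact: affords_YM_comp (YM_repP _ _).
Qed.

Definition functor_CR : fbfunctor A C :=
  FBFunctor CR_map_linearl CR_map_linearr CR_map_id CR_map_comp.

End CharacterFunctor.

Section FibreGroup.
Variables (C : fieldType) (pi : nat_pred).

Definition mult_subgroup (B : C -> Prop) : Prop :=
  [/\ B 1, ~ B 0, forall x y, B x -> B y -> B (x * y) &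
      forall x, B x -> B x^-1].

Definition pi_power_root (z : C) : Prop :=
  exists p n, [/\ p \in pi, prime p, (0 < n)%N & z ^+ (p ^ n) = 1].

(* the subgroup of C^x generated by the p^n-th roots of unity, p in pi        *)
Definition in_mu_pi (z : C) : Prop :=
  forall B, mult_subgroup B -> (forall x, pi_power_root x -> B x) -> B z.

Lemma in_mu_pi_subgroup : mult_subgroup in_mu_pi.
Proof.
split.
- by move=> B [].
- move=> /(_ (fun z => z <> 0)) []//; last first.
    move=> z [p [n [_ pp _ zn]]] z0; move: zn.
    rewrite z0 expr0n expn_eq0 -leqn0 leqNgt prime_gt0 //= => /esym/eqP.
    by rewrite oner_eq0.
  split=> //; first exact/eqP/oner_neq0.
    by move=> x y /eqP x0 /eqP y0; apply/eqP; rewrite mulf_neq0.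
  by move=> x /eqP x0; apply/eqP; rewrite invr_neq0.
- by move=> x y hx hy B hB hr; case: (hB) => _ _ h _; apply: h; [apply: hx | apply: hy].
- by move=> x hx B hB hr; case: (hB) => _ _ _; apply; apply: hx.
Qed.

Definition mu_pi : Type := {z : C | `[< in_mu_pi z >]}.

HB.instance Definition _ := Choice.on mu_pi.

Definition mu_one : mu_pi :=
  exist _ 1 (asboolT (let: And4 h _ _ _ := in_mu_pi_subgroup in h)).
Definition mu_mul (x y : mu_pi) : mu_pi :=
  exist _ (val x * val y) (asboolT (let: And4 _ _ h _ := in_mu_pi_subgroup in
    h _ _ (asboolW (valP x)) (asboolW (valP y)))).
Definition mu_inv (x : mu_pi) : mu_pi :=
  exist _ (val x)^-1 (asboolT (let: And4 _ _ _ h := in_mu_pi_subgroup in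
    h _ (asboolW (valP x)))).

Lemma mu_neq0 (x : mu_pi) : val x != 0.
Proof.
by apply/eqP => x0; case: in_mu_pi_subgroup => _ + _ _; rewrite -x0; apply; apply: asboolW (valP x).
Qed.

Lemma mu_mulA : associative mu_mul.
Proof. by move=> x y z; apply: val_inj; rewrite /= mulrA. Qed.
Lemma mu_mulC : commutative mu_mul.
Proof. by move=> x y; apply: val_inj; rewrite /= mulrC. Qed.
Lemma mu_mul1 : left_id mu_one mu_mul.
Proof. by move=> x; apply: val_inj; rewrite /= mul1r. Qed.
Lemma mu_mul1r : right_id mu_one mu_mul.
Proof. by move=> x; rewrite mu_mulC mu_mul1. Qed.
Lemma mu_mulV : left_inverse mu_one mu_inv mu_mul.
Proof. by move=> x; apply: val_inj; rewrite /= mulVf // mu_neq0. Qed.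
Lemma mu_mulVr : right_inverse mu_one mu_inv mu_mul.
Proof. by move=> x; rewrite mu_mulC mu_mulV. Qed.

HB.instance Definition _ :=
  isGroup.Build mu_pi mu_mulA mu_mul1 mu_mul1r mu_mulV mu_mulVr.
HB.instance Definition _ := Group_isAbelian.Build mu_pi mu_mulC.

Definition mu_embedding : mult_embedding mu_pi C :=
  @MultEmbedding mu_pi C (fun x : mu_pi => val x) erefl (fun _ _ => erefl) val_inj.
End FibreGroup.

Section Index.

(* m is meant to be positive, and then m.-1.+1 = m; unlike 'Z_m, this is the   *)
(* trivial group for m = 1.                                                   *)
Definition Zmod (m : nat) : finGroupType := 'I_m.-1.+1.

Definition AutZ (m : nat) : finGroupType := [subg Aut [set: Zmod m]].

Lemma AutZ_morph m (s : AutZ m) : {morph sgval s : x y / (x * y)%g}.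
Proof.
move=> x y; have /morphicP h := Aut_morphic (subgP s).
by apply: h; rewrite inE.
Qed.

Definition fb_aut (A : abelianGroupType) m (s : AutZ m) : fbiset A (Zmod m) (Zmod m) :=
  fb_twist A (AutZ_morph s).

Variable C : fieldType.

Definition lin_char m (zeta : {ffun AutZ m -> C}) : Prop :=
  zeta 1%g = 1 /\ forall s t, zeta (s * t)%g = zeta s * zeta t.

(* the identification of Aut(Z/mZ) with (Z/mZ)^x                              *)
Definition AutZ_unit m (s : AutZ m) : nat := sgval s (Zp1 : Zmod m).

(* zeta is the composite of a character of (Z/dZ)^x with reduction modulo d   *)
Definition induced_from d m (zeta : {ffun AutZ m -> C}) : Prop :=
  exists2 xi : {ffun AutZ d -> C}, lin_char xi &
    forall s t, AutZ_unit s = AutZ_unit t %[mod d] -> zeta s = xi t.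

Definition primitive m (zeta : {ffun AutZ m -> C}) : Prop :=
  lin_char zeta /\
  forall d, (d %| m)%N -> d <> m -> ~ induced_from d zeta.

Record Upsilon (pi : nat_pred) := {
  ups_m : nat;
  ups_zeta : {ffun AutZ ups_m -> C};
  ups_nat : pi^'.-nat ups_m;
  ups_primitive : primitive ups_zeta
}.

(* Given that S vanishes on groups of smaller order, the ideal of             *)
(* endomorphisms of Z/mZ factoring through such groups acts by zero on        *)
(* S(Z/mZ), so its module structure is that of C Aut(Z/mZ), an automorphism s *)
(* acting through Iso^s; f below is an isomorphism from C_zeta onto it.       *)
Definition is_simple_functor_at (A : abelianGroupType) m
    (zeta : {ffun AutZ m -> C}) (S : fbfunctor A C) : Prop :=
  [/\ simple_functor S,
      forall H : finGroupType, (#|{: H}| < #|{: Zmod m}|)%N ->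
        forall x : S H, x = 0 &
      exists f : C^o -> S (Zmod m),
        [/\ linear f, bijective f &
            forall s c, fmap (bcls C (fb_aut A s)) (f c) = f (zeta s * c)]].
End Index.

(* Main.v *)
(* Taking traces identifies C R_C(G) with the class functions on G, and a fibered
   (H, G)-biset X acts on them by f |-> (h |-> |G|^-1 sum a f(g)), the sum being over
   the g in G and the A-orbits of x in X with h x = a x g. The elements a occurring
   there have pi-order, hence this action commutes with f |-> (x |-> f(x ^ k)) for k
   prime to the group orders and congruent to 1 modulo their pi-parts: C R_C is graded
   by the characters of the Galois group of the pi'-roots of unity, that is by the
   pairs (m, zeta).

   Let e in C R_C(Z/m) be the function equal to zeta^-1 on the generators and to 0
   elsewhere. Restricting to cyclic groups, twisting by linear characters with values
   in A and deflating shows that e lies in every nonzero subfunctor of the zeta-part,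
   so that e generates a simple functor; and together these e generate C R_C, since the
   indicator function of a generator of a cyclic group is obtained from them by
   inflation, twisting and induction.

   A simple functor S with the same minimal data has a vector t in S(Z/m) such that t
   and e are multiplied by the same scalar under every endomorphism of Z/m, because a
   transitive fibered (Z/m, Z/m)-biset is some Iso^s or factors through a smaller
   group. Hence the subfunctor of S (+) C R_C generated by (t, e) is the graph of an
   isomorphism of S onto the functor generated by e. *)
From HB Require Import structures.
From mathcomp Require Import boolp classical_sets cardinality reals.
From mathcomp Require Import all_boot all_order all_algebra all_fingroup.
From mathcomp Require Import all_solvable all_field all_character.
From mathcomp Require Import complex ring.
Require Import Defs.

Set Implicit Arguments.
Unset Strict Implicit.
Unset Printing Implicit Defensive.

Import Order.TTheory GRing.Theory Num.Theory.
Local Open Scope ring_scope.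

(** * The character map *)

(** [CK0] is a presentation over a presentation. Additivity of the outer generators reduces the
    inner integral combinations to sums and opposites, so that only the classes of objects
    remain. *)
Lemma CK0_ind (C : fieldType) T iso (sum : T -> T -> T) (P : CK0 C iso sum -> Prop) :
    (forall t, P (kgen C iso sum t)) -> P 0 ->
    (forall c u v, P u -> P v -> P (c *: u + v)) ->
  forall u, P u.
Proof.
move=> Pg P0 PL.
have PZ c u : P u -> P (c *: u) by move=> Pu; rewrite -[_ *: _]addr0; apply: PL.
have PD u v : P u -> P v -> P (u + v) by move=> Pu; rewrite -[u]scale1r; apply: PL.
elim/pres_ind => // u.
have genD (v w : K0 iso sum) : pgen (@tensZ_rel C (K0 iso sum)) (v + w) =
    pgen (@tensZ_rel C (K0 iso sum)) v + pgen (@tensZ_rel C (K0 iso sum)) w.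
  by have /= -> := pgen_rel (tensZ_add C v w).
have gen0 : pgen (@tensZ_rel C (K0 iso sum)) 0 = 0.
  by apply: (addrI (pgen (@tensZ_rel C (K0 iso sum)) 0)); rewrite -genD !addr0.
have genN v : P (pgen (@tensZ_rel C (K0 iso sum)) v) ->
    P (pgen (@tensZ_rel C (K0 iso sum)) (- v)).
  move=> /(PZ (-1)); rewrite scaleN1r; congr P; apply/eqP; rewrite eq_sym -addr_eq0.
  by rewrite -genD addNr gen0.
have genMn v n : P (pgen (@tensZ_rel C (K0 iso sum)) v) ->
    P (pgen (@tensZ_rel C (K0 iso sum)) (v *+ n)).
  by move=> Pv; elim: n => [|n IH]; rewrite ?gen0 // mulrS genD; apply: PD.
elim/pres_ind: u => [t||x y Px Py|c x Px]; rewrite ?gen0 ?genD //; first exact: Pg.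
  exact: PD.
have -> : c *: x = (x : K0 iso sum) *~ c by rewrite -[c in LHS]intz scaler_int.
by case: c => n; rewrite ?NegzE ?mulrNz; [|apply: genN]; apply: genMn.
Qed.

(** In characteristic p, z ^ p = 1 gives (z - 1) ^ p = 0, which leaves no primitive p-th root. Roots
    of unity of all orders thus give both characteristic 0 and splitting fields of abelian
    groups. *)
Lemma prim_pchar0 (C : fieldType) :
    (forall n, (0 < n)%N -> exists z : C, n.-primitive_root z) ->
  [pchar C] =i pred0.
Proof.
move=> C_prim p; rewrite [RHS]inE; apply/negP => pC.
have p_pr := pcharf_prime pC.
have [z z_pr] := C_prim p (prime_gt0 p_pr).
have : (z - 1) ^+ p = 0.
  rewrite -(pFrobenius_autE pC) pFrobenius_autB_comm; last exact: mulrC.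
  by rewrite pFrobenius_aut1 pFrobenius_autE (prim_expr_order z_pr) subrr.
move/eqP; rewrite expf_eq0 prime_gt0 //= subr_eq0 => /eqP z1.
have := prim_order_dvd z_pr 1; rewrite z1 expr1 eqxx dvdn1.
by move/eqP => p1; rewrite p1 in p_pr.
Qed.

Lemma prim_natr_eq0 (C : fieldType) n :
    (forall n, (0 < n)%N -> exists z : C, n.-primitive_root z) ->
  (n%:R == 0 :> C) = (n == 0%N).
Proof. by move=> /prim_pchar0 /pcharf0P ->. Qed.

Lemma socleType_inhabited (F : fieldType) (gT : finGroupType) (G : {group gT}) n
    (rG : mx_representation F G n) : inhabited (socleType rG).
Proof.
apply: contrapT => no_soc; suff : false by [].
by apply: (socle_exists rG) => soc; case: no_soc; exists.
Qed.

Section CharacterMap.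
Variable C : fieldType.
Hypothesis C_prim : forall n, (0 < n)%N -> exists z : C, n.-primitive_root z.
Notation rep G := (representation C [set: G]%G).

Definition rtrace (G : finGroupType) (M : rep G) : {ffun G -> C^o} :=
  [ffun g => \tr (M g)].

Lemma rtrace_iso (G : finGroupType) (M N : rep G) :
  rep_iso M N -> rtrace M = rtrace N.
Proof. by move=> MN; apply/ffunP => g; rewrite !ffunE (mxtrace_rsim MN) ?inE. Qed.

Lemma rtrace_sum (G : finGroupType) (M N : rep G) :
  rtrace (dadd_grepr M N) = rtrace M + rtrace N.
Proof. by apply/ffunP => g; rewrite !ffunE mxtrace_block. Qed.

Definition ch (G : finGroupType) (u : CR C G) (x : G) : C :=
  klift (@rtrace_iso G) (@rtrace_sum G) u x.

Lemma chE (G : finGroupType) (M : rep G) g : ch (rcls M) g = \tr (M g).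
Proof. by rewrite /ch klift_gen ffunE. Qed.

Lemma ch_lin (G : finGroupType) c (u v : CR C G) x :
  ch (c *: u + v) x = c * ch u x + ch v x.
Proof. by rewrite /ch linearP !ffunE. Qed.

Lemma ch0 (G : finGroupType) x : ch (0 : CR C G) x = 0.
Proof. by rewrite /ch linear0 ffunE. Qed.

Lemma chZ (G : finGroupType) c (u : CR C G) x : ch (c *: u) x = c * ch u x.
Proof. by rewrite -[_ *: _]addr0 ch_lin ch0 addr0. Qed.

Lemma ch_sum (G : finGroupType) I r (P : pred I) (F : I -> CR C G) x :
  ch (\sum_(i <- r | P i) F i) x = \sum_(i <- r | P i) ch (F i) x.
Proof.
by apply: (big_morph (fun u => ch u x)) => [u v|]; rewrite ?ch0 // -[u]scale1r ch_lin scale1r mul1r.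
Qed.

Lemma chJ (G : finGroupType) (u : CR C G) x y : ch u (x ^ y)%g = ch u x.
Proof.
pose f (u : CR C G) : C^o := ch u (x ^ y)%g.
pose f' (u : CR C G) : C^o := ch u x.
suff /(_ u) : f =1 f' by []; apply: CK0_extP.
- by move=> c v w; rewrite /f ch_lin.
- by move=> c v w; rewrite /f' ch_lin.
move=> M; rewrite /f /f' -/(rcls M) !chE conjgE.
by rewrite !repr_mxM ?inE // mxtrace_mulC repr_mxK ?inE.
Qed.

Section Injective.
Variable G : finGroupType.
Let G' : (([pchar C]^'.-group [set: G]%G)%g : bool).
Proof. by apply/pgroupP => p _ _; rewrite inE /= prim_pchar0. Qed.

Let sG : irrType C [set: G]%G :=
  inhabited_witness (socleType_inhabited (regular_repr C [set: G]%G)).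
Let irr (i : sG) : rep G := Representation (irr_repr i).

Lemma rcls0 : rcls (grepr0 : rep G) = 0.
Proof.
apply: (@addrI _ (rcls grepr0)); rewrite addr0 -[LHS]kgen_sum.
apply: kgen_iso; exists 0; rewrite /row_free ?mxrank0 //.
by move=> g _; rewrite mulmx0 mul0mx.
Qed.

Lemma rcls_sum (I : finType) (M : I -> rep G) :
  rcls (\big[dadd_grepr/grepr0]_i M i) = \sum_i rcls (M i).
Proof. by apply: (big_morph _ _ rcls0) => M1 M2; apply: kgen_sum. Qed.

Lemma CR_span_irr (u : CR C G) : exists c : sG -> C, u = \sum_i c i *: rcls (irr i).
Proof.
pose P (u : CR C G) := exists c : sG -> C, u = \sum_i c i *: rcls (irr i).
have P0 : P 0 by exists (fun=> 0); rewrite big1 // => i _; rewrite scale0r.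
have PL c x y : P x -> P y -> P (c *: x + y).
  move=> [f ->] [g ->]; exists (fun i => c * f i + g i).
  rewrite scaler_sumr -big_split; apply: eq_bigr => i _.
  by rewrite scalerDl scalerA.
have P_irr i : P (rcls (irr i)).
  exists (fun j => (j == i)%:R); rewrite (bigD1 i) //= eqxx scale1r.
  by rewrite big1 ?addr0 // => j /negPf ->; rewrite scale0r.
have PD x y : P x -> P y -> P (x + y) by move=> Px; rewrite -[x]scale1r; apply: PL.
apply: (@CK0_ind _ _ _ _ P) => // M.
have [sM] := socleType_inhabited M.
pose N (W : sM) := muln_grepr (irr (irr_comp sG (socle_repr W))) (socle_mult W).
(* By Maschke's theorem M is its own socle, and each component of it is a multiple of an irreducible
   module. *)
have MN : mx_rsim M (\big[dadd_grepr/grepr0]_W N W).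
  have soc1 : Socle sM = 1%:M := reducible_Socle1 sM (mx_Maschke_pchar M G').
  apply: mx_rsim_trans (mx_rsim_sym (rsim_submod1 (mxmodule1 M) _)) _ => //.
  apply: (mx_rsim_dsum (U := fun W : sM => W)
    (modU := fun W => component_mx_module M (socle_base W))) (Socle_direct sM) _.
    by rewrite -/(Socle sM) soc1.
  move=> W; apply: mx_rsim_socle.
  exact: (rsim_irr_comp_pchar sG G' (socle_irr W)).
have -> : kgen C _ _ M = rcls (\big[dadd_grepr/grepr0]_W N W) by apply: kgen_iso.
rewrite rcls_sum.
apply: (big_ind P) => // W _; rewrite rcls_sum.
by apply: (big_ind P) => // j _; apply: P_irr.
Qed.

(** The trace of a fixed group ring element is a combination of character values, with coefficients
    independent of the representation. Applied to a vanishing combination of irreducible characters,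
    the Wedderburn idempotent of i isolates [c i] times the degree, which is nonzero in
    characteristic 0. *)
Lemma ch_inj (u v : CR C G) : ch u =1 ch v -> u = v.
Proof.
suff ker0 (w : CR C G) : (forall x, ch w x = 0) -> w = 0.
  move=> uv; apply/eqP; rewrite -subr_eq0; apply/eqP/ker0 => x.
  by rewrite addrC -scaleN1r ch_lin uv mulN1r addNr.
have [c ->] := CR_span_irr w => c0 {w}.
rewrite big1 // => i _; suff -> : c i = 0 by rewrite scale0r.
pose e := Wedderburn_id i.
have op j A : \tr (gring_op (irr j) A) =
    \sum_k gring_row A 0 k * ch (rcls (irr j)) (enum_val k).
  rewrite gring_opE /gring_mx /= [X in vec_mx X]mulmx_sum_row !linear_sum.
  by apply: eq_bigr => k _; rewrite rowK !linearZ /= mxvecK chE.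
have: \sum_j c j * \tr (gring_op (irr j) e) = 0.
  under eq_bigr => j _ do rewrite op mulr_sumr.
  rewrite exchange_big big1 //= => k _.
  have E : \sum_j c j * ch (rcls (irr j)) (enum_val k) = 0.
    rewrite -[RHS](c0 (enum_val k)) ch_sum.
    by apply: eq_bigr => j _; rewrite chZ.
  rewrite -[RHS](mulr0 (gring_row e 0 k)) -[in RHS]E mulr_sumr.
  by apply: eq_bigr => j _; rewrite mulrCA.
rewrite (bigD1 i) //= op_Wedderburn_id_pchar // mxtrace1 big1 ?addr0.
  move/eqP; rewrite mulf_eq0 prim_natr_eq0 // -leqn0 leqNgt irr_degree_gt0 orbF.
  by move/eqP.
move=> j ji; rewrite (@irr_repr'_op0_pchar _ _ _ sG G' j i) ?mxtrace0 ?mulr0 //.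
  by rewrite eq_sym.
exact: Wedderburn_id_mem.
Qed.

Lemma linear_rep_trace (M : rep G) : rdegree M = 1%N ->
  \tr (M 1%g) = 1 /\ forall x y, \tr (M (x * y)%g) = \tr (M x) * \tr (M y).
Proof.
case: M => d M /= d1; subst d; rewrite repr_mx1 mxtrace1.
split=> // x y; rewrite repr_mxM ?inE //.
by rewrite [M x]mx11_scalar [M y]mx11_scalar -scalar_mxM !mxtrace_scalar.
Qed.

Lemma ch_span_linear (u : CR C G) : abelian [set: G] ->
  exists (I : finType) (c : I -> C) (l : I -> G -> C),
    (forall i, l i 1%g = 1 /\ forall x y, l i (x * y)%g = l i x * l i y) /\
    forall x, ch u x = \sum_i c i * l i x.
Proof.
move=> abG; have [z z_pr] := C_prim (cardG_gt0 [set: G]%G).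
have splitG := primitive_root_splitting_abelian z_pr abG.
have [c ->] := CR_span_irr u.
exists sG, c, (fun i x => \tr (irr i x)); split=> [i|x].
  exact/linear_rep_trace/irr_degree_abelian.
by rewrite ch_sum; apply: eq_bigr => i _; rewrite chZ chE.
Qed.

End Injective.
End CharacterMap.

(** * The trace formula *)

Lemma morph1 (L : finGroupType) (M : groupType) (h : L -> M) :
  {morph h : x y / (x * y)%g} -> h 1%g = 1%g.
Proof. by move=> hM; apply: (mulgI (h 1%g)); rewrite -hM !mulg1. Qed.

Section Transversal.
Variables (A : abelianGroupType) (G H : finGroupType) (X : fbiset A G H).

(** The representatives of [fact_fin] may meet an A-orbit several times; a canonical choice in each
    class of indices makes them irredundant, as the trace formula requires. *)
Lemma fb_transversal : exists (I : finType) (r : I -> X),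
  (forall x, exists a i, x = a \f r i) /\ (forall a i j, r i = a \f r j -> i = j).
Proof.
have [I [r hr]] := fact_fin (fb_on X).
pose R i j := `[< exists a, r i = a \f r j >].
have Rrefl i : R i i by apply/asboolP; exists 1%g; rewrite fact1.
have Rsym i j : R i j -> R j i.
  move=> /asboolP [a e]; apply/asboolP; exists a^-1%g.
  by rewrite e -factM mulVg fact1.
have Rtrans i j k : R i j -> R j k -> R i k.
  move=> /asboolP [a e] /asboolP [b e']; apply/asboolP; exists (a * b)%g.
  by rewrite e e' factM.
pose c i := choose (R i) i.
have cR i : R i (c i) by apply: chooseP.
have cE i j : R i j -> c i = c j.
  move=> ij; rewrite /c.
  have RE : R i =1 R j.
    by move=> k; apply/idP/idP; [exact: Rtrans (Rsym _ _ ij) | exact: Rtrans ij].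
  by rewrite (eq_choose RE) (choose_id _ (Rrefl j)) // Rsym.
have cc i : c (c i) == c i by rewrite -(cE i (c i)).
exists {i : I | c i == i}, (fun i => r (val i)); split=> [x|a i j e].
  have [a [i ->]] := hr x; have /asboolP [b ->] := cR i.
  by exists (a * b)%g, (exist _ (c i) (cc i)); rewrite factM.
apply: val_inj; rewrite -(eqP (valP i)) -(eqP (valP j)); apply: cE.
by apply/asboolP; exists a.
Qed.
End Transversal.

(** * Twisted restriction and induction as fibered bisets *)

Section Pullback.
Variable A : abelianGroupType.

Section Left.
Variables (G H K : finGroupType) (f : H -> G) (l : H -> A).
Hypotheses (fM : {morph f : x y / (x * y)%g}) (lM : {morph l : x y / (x * y)%g}).
Variable X : fbiset A G K.

Definition fb_lpull : fbiset A H K.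
Proof.
refine (@FBiset A H K X (@FBisetOn A H K X
  (fun h x => l h \f (f h \l x)) (fun x k => x \r k) (fun a x => a \f x)
  _ _ _ _ _ _ _ _ _ _ (fact_fin (fb_on X)))).
- by move=> x; rewrite !morph1 // lact1 fact1.
- by move=> h h' x; rewrite fM lM lactM factM !lfact.
- by move=> x; rewrite ract1.
- by move=> x k k'; rewrite ractM.
- by move=> x; rewrite fact1.
- by move=> a b x; rewrite factM.
- by move=> h x k; rewrite lract rfact.
- by move=> h a x; rewrite lfact -!factM abmulgC.
- by move=> a x k; rewrite rfact.
- by move=> a x; apply: fact_free.
Defined.
End Left.

Section Right.
Variables (G H K : finGroupType) (f : K -> H).
Hypothesis fM : {morph f : x y / (x * y)%g}.
Variable X : fbiset A G H.

Definition fb_rpull : fbiset A G K.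
Proof.
refine (@FBiset A G K X (@FBisetOn A G K X
  (fun g x => g \l x) (fun x k => x \r f k) (fun a x => a \f x)
  _ _ _ _ _ _ _ _ _ _ (fact_fin (fb_on X)))).
- by move=> x; rewrite lact1.
- by move=> h h' x; rewrite lactM.
- by move=> x; rewrite morph1 // ract1.
- by move=> x k k'; rewrite fM ractM.
- by move=> x; rewrite fact1.
- by move=> a b x; rewrite factM.
- by move=> h x k; rewrite lract.
- by move=> h a x; rewrite lfact.
- by move=> a x k; rewrite rfact.
- by move=> a x; apply: fact_free.
Defined.
End Right.

(** As [f] is any homomorphism and [l] a linear character with values in A, this covers restriction,
    inflation and twisting. *)
Definition fb_res (G H : finGroupType) (f : H -> G) (l : H -> A)
    (fM : {morph f : x y / (x * y)%g}) (lM : {morph l : x y / (x * y)%g}) :=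
  fb_lpull fM lM (fb_id A G).

(** Induction when [f] is injective, deflation when it is surjective. *)
Definition fb_ind (G H : finGroupType) (f : H -> G)
    (fM : {morph f : x y / (x * y)%g}) :=
  fb_rpull fM (fb_id A G).

(** A bijection from the whole quotient onto a fibered biset shows that all A-orbits of the quotient
    are free, so that none is discarded in the tensor product. *)
Lemma fb_tens_isoF (G H K : finGroupType) (X : fbiset A G H) (Y : fbiset A H K)
    (Z : fbiset A G K) (F : tens_quot X Y -> Z) :
    bijective F ->
    (forall g x y, F (tq (g \l x) y) = g \l F (tq x y)) ->
    (forall x y k, F (tq x (y \r k)) = F (tq x y) \r k) ->
    (forall a x y, F (tq (a \f x) y) = a \f F (tq x y)) ->
  fb_iso (fb_tens X Y) Z.
Proof.
case=> F' FK F'K Fl Fr Fa.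
apply: fb_iso_sym; apply: (@tens_isoI _ _ _ _ X Y Z F').
- exact: can_inj F'K.
- by move=> q _; exists (F q).
- move=> g z; apply: (can_inj FK); rewrite F'K -{1}(F'K z).
  by elim/tq_ind: (F' z) => x y; rewrite tq_lactE Fl.
- move=> z k; apply: (can_inj FK); rewrite F'K -{1}(F'K z).
  by elim/tq_ind: (F' z) => x y; rewrite tq_ractE Fr.
- move=> a z; apply: (can_inj FK); rewrite F'K -{1}(F'K z).
  by elim/tq_ind: (F' z) => x y; rewrite tq_factE Fa.
Qed.

Lemma fb_tens_res (G H K : finGroupType) (f : H -> G) (l : H -> A)
    (fM : {morph f : x y / (x * y)%g}) (lM : {morph l : x y / (x * y)%g})
    (X : fbiset A G K) :
  fb_iso (fb_tens (fb_res fM lM) X) (fb_lpull fM lM X).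
Proof.
pose F := @tq_lift A H G K (fb_res fM lM) X _
  (fun p => p.1.1 \f (p.1.2 \l p.2) : fb_lpull fM lM X).
have FE x y : F (tq x y) = x.1 \f (x.2 \l y).
  apply: tq_liftE => -[a g] b h z /=.
  by rewrite lactM lfact -!factM abmulgC.
apply: (@fb_tens_isoF _ _ _ _ _ _ F).
- exists (fun x : X => @tq _ _ _ _ (fb_res fM lM) X (1%g, 1%g) x).
    elim/tq_ind=> -[a g] x; rewrite FE /= -tqE /=.
    by congr tq; rewrite /= !mulg1 !mul1g.
  by move=> x; rewrite FE /= lact1 fact1.
- by move=> h [a g] x; rewrite !FE /= factM lactM lfact.
- by move=> [a g] x k; rewrite !FE /= rfact lract.
- by move=> b [a g] x; rewrite !FE /= factM.
Qed.

Lemma fb_tens_ind (G H K : finGroupType) (f : K -> H)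
    (fM : {morph f : x y / (x * y)%g}) (X : fbiset A G H) :
  fb_iso (fb_tens X (fb_ind fM)) (fb_rpull fM X).
Proof.
pose F := @tq_lift A G H K X (fb_ind fM) _
  (fun p => p.2.1 \f (p.1 \r p.2.2) : fb_rpull fM X).
have FE x y : F (tq x y) = y.1 \f (x \r y.2).
  apply: tq_liftE => z b h [a g] /=.
  by rewrite rfact -factM ractM abmulgC.
apply: (@fb_tens_isoF _ _ _ _ _ _ F).
- exists (fun x : X => @tq _ _ _ _ X (fb_ind fM) x (1%g, 1%g)).
    elim/tq_ind=> x [a g]; rewrite FE tqE /=.
    by congr tq; rewrite /= !mulg1.
  by move=> x; rewrite FE /= ract1 fact1.
- by move=> h x [a g]; rewrite !FE /= lfact lract.
- by move=> x [a g] k; rewrite !FE /= ractM rfact.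
- by move=> b x [a g]; rewrite !FE /= rfact -!factM abmulgC.
Qed.
End Pullback.

(** * The character of a tensor product with a fibered biset *)

Section Trace.
Variables (A : abelianGroupType) (C : fieldType) (iota : mult_embedding A C).
Hypothesis C_prim : forall n, (0 < n)%N -> exists z : C, n.-primitive_root z.
Notation rep G := (representation C [set: G]%G).

Section Coef.
Variables (G H : finGroupType) (X : fbiset A G H).

(** The coefficient of x along y in CX: the scalar a if x = a y, and 0 if x lies in another
    A-orbit. *)
Definition fb_coef (x y : X) : C :=
  if pselect (exists a, x = a \f y) is left h then iota (sval (cid h)) else 0.

Lemma fb_coefE a x y : x = a \f y -> fb_coef x y = iota a.
Proof.
move=> e; rewrite /fb_coef; case: pselect => [h|[]]; last by exists a.
by case: cid => b /= e'; congr (iota _); apply/esym; apply: (@fact_inj _ _ _ X _ _ y); rewrite -e.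
Qed.

Lemma fb_coef0 x y : ~ (exists a, x = a \f y) -> fb_coef x y = 0.
Proof. by rewrite /fb_coef; case: pselect. Qed.

Lemma fb_coef_fact a x y : fb_coef (a \f x) y = iota a * fb_coef x y.
Proof.
have [[b e]|ne] := pselect (exists b, x = b \f y).
  by rewrite (fb_coefE e) (@fb_coefE (a * b)%g) ?embM // e factM.
rewrite !fb_coef0 ?mulr0 // => -[b e]; apply: ne; exists (a^-1 * b)%g.
by rewrite factM -e -factM mulVg fact1.
Qed.
End Coef.

(** A trace can be computed in any family with coordinate forms that reproduce every vector; linear
    independence of the family is not assumed, which suits the tensors spanning CX (x) M. *)
Lemma mxtrace_frame n (K : finType) (N : 'M[C]_n) (q : K -> 'cV[C]_n -> C^o)
    (e : K -> 'cV[C]_n) :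
    (forall k, linear (q k)) -> (forall v, v = \sum_k q k v *: e k) ->
  \tr N = \sum_k q k (N *m e k).
Proof.
move=> qL ve.
pose ql k : {linear 'cV[C]_n -> C^o} :=
  HB.pack (q k) (GRing.isLinear.Build _ _ _ _ _ (qL k)).
have qE k v : q k v = \sum_i v i 0 * q k (delta_mx i 0).
  rewrite [in LHS](matrix_sum_delta v) -[q k]/(ql k : _ -> _) linear_sum.
  by apply: eq_bigr => i _; rewrite big_ord1 linearZ.
rewrite /mxtrace.
transitivity (\sum_i \sum_k q k (N *m delta_mx i 0) * e k i 0).
  apply: eq_bigr => i _; rewrite -[N i i](_ : (N *m delta_mx i 0 : 'cV_n) i 0 = _).
    rewrite {1}(ve (N *m delta_mx i 0)) summxE; apply: eq_bigr => k _.
    by rewrite mxE.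
  by rewrite -colE mxE.
rewrite exchange_big; apply: eq_bigr => k _ /=.
have -> : N *m e k = \sum_i e k i 0 *: (N *m delta_mx i 0).
  rewrite {1}(matrix_sum_delta (e k)) mulmx_sumr; apply: eq_bigr => i _.
  by rewrite big_ord1 -scalemxAr.
rewrite -[q k]/(ql k : _ -> _) linear_sum; apply: eq_bigr => i _.
by rewrite linearZ mulrC.
Qed.

Arguments yten [A C] iota [H G Y] M y v.

Section YMTrace.
Variables (G H : finGroupType) (X : fbiset A H G) (M : rep G).
Variables (I : finType) (r : I -> X).
Hypothesis rS : forall x, exists a i, x = a \f r i.
Hypothesis rI : forall a i j, r i = a \f r j -> i = j.

Let K : finType := (I * 'I_(rdegree M))%type.
Let e (k : K) : YM iota X M := yten iota M (r k.1) (delta_mx k.2 0).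
(** The coordinate of x (x) v along [e k], averaged over G so that it respects the relation x g (x)
    v = x (x) g v. *)
Let q0 (k : K) (x : X) (v : 'cV[C]_(rdegree M)) : C^o :=
  #|G|%:R^-1 * \sum_g fb_coef (x \r g^-1%g) (r k.1) * (M g *m v) k.2 0.

Let MM g h : M (g * h)%g = M g *m M h.
Proof. by rewrite repr_mxM ?inE. Qed.

Let q0_fib k a x v : q0 k (a \f x) v = iota a *: q0 k x v.
Proof.
transitivity (iota a * q0 k x v) => //; rewrite /q0 mulrCA; congr (_ * _).
rewrite mulr_sumr; apply: eq_bigr => g _.
by rewrite rfact fb_coef_fact mulrA.
Qed.

Let q0_lin k x : linear (q0 k x).
Proof.
move=> c u v; transitivity (c * q0 k x u + q0 k x v) => //.
rewrite /q0 mulrCA -mulrDr [c * _]mulr_sumr -big_split.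
congr (_ * _); apply: eq_bigr => g _ /=.
by rewrite linearP !mxE mulrDr mulrCA.
Qed.

Let q0_bal k x g v : q0 k (x \r g) v = q0 k x (M g *m v).
Proof.
rewrite /q0; congr (_ * _); rewrite (reindex_inj (mulIg g)) /=.
apply: eq_bigr => h _; rewrite mulmxA -MM; congr (fb_coef _ _ * _).
by rewrite -ractM invMg mulgA mulgV mul1g.
Qed.

Let q (k : K) : {linear YM iota X M -> C^o} := YM_lift (q0_fib k) (q0_lin k) (q0_bal k).

Let qE k x v : q k (yten iota M x v) = q0 k x v. Proof. exact: YM_liftE. Qed.

Let sum_coef x v : yten iota M x v = \sum_i fb_coef x (r i) *: yten iota M (r i) v :> YM iota X M.
Proof.
have [a [i e0]] := rS x; rewrite (bigD1 i) //= (fb_coefE e0) -yten_fib -e0.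
rewrite big1 ?addr0 // => j ji; rewrite fb_coef0 ?scale0r // => -[b e1].
case/eqP: ji; apply: (@rI (b^-1 * a)%g).
by rewrite factM -e0 e1 -factM mulVg fact1.
Qed.

Let frame (v : YM iota X M) : v = \sum_k q k v *: e k.
Proof.
move: v; apply: YM_ext => [c u v|c u v|x v] //.
  by rewrite scaler_sumr -big_split; apply: eq_bigr => k _; rewrite linearP scalerDl scalerA.
have cardG : #|G|%:R != 0 :> C.
  by rewrite prim_natr_eq0 // -lt0n -cardsT cardG_gt0.
(* The tensor x (x) v is the average of the tensors x g^-1 (x) g v, all equal to it. *)
transitivity (#|G|%:R^-1 *: \sum_(g : G) yten iota M (x \r g^-1%g) (M g *m v) : YM iota X M).
  rewrite (eq_bigr (fun=> yten iota M x v)) => [|g _].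
    by rewrite sumr_const -scaler_nat scalerA mulVf ?scale1r.
  by rewrite yten_bal mulmxA -MM mulVg repr_mx1 mul1mx.
under [RHS]eq_bigr => k _ do rewrite qE /q0 -scalerA scaler_suml.
rewrite -scaler_sumr exchange_big; congr (_ *: _); apply: eq_bigr => g _ /=.
rewrite sum_coef -(pair_big xpredT xpredT
  (fun i j => (fb_coef (x \r g^-1%g) (r i) * (M g *m v) j 0) *: e (i, j))) /=.
apply: eq_bigr => i _.
pose h : {linear 'cV[C]_(rdegree M) -> YM iota X M} :=
  HB.pack (yten iota M (r i)) (GRing.isLinear.Build _ _ _ _ _ (@yten_lin _ _ iota _ _ X M (r i))).
rewrite -[yten iota M (r i) _]/(h _) (matrix_sum_delta (M g *m v)) linear_sum scaler_sumr.
by apply: eq_bigr => j _; rewrite big_ord1 linearZ scalerA -matrix_sum_delta.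
Qed.

Lemma ch_YM (N : rep H) h : affords (YM_act iota X M) N ->
  \tr (N h) = #|G|%:R^-1 *
    \sum_g (\sum_i fb_coef ((h \l r i) \r g^-1%g) (r i)) * \tr (M g).
Proof.
case=> f [fL [f' fK f'K] fM]; have f'L := lin_inv fL fK f'K.
rewrite (@mxtrace_frame _ K _ (fun k v => q k (f v)) (fun k => f' (e k))).
- transitivity (\sum_(k : K) #|G|%:R^-1 *
      \sum_g fb_coef ((h \l r k.1) \r g^-1%g) (r k.1) * M g k.2 k.2).
    apply: eq_bigr => k _; rewrite fM f'K YM_actE qE /q0; congr (_ * _).
    by apply: eq_bigr => g _; rewrite -colE mxE.
  rewrite -mulr_sumr exchange_big; congr (_ * _); apply: eq_bigr => g _ /=.
  rewrite -(pair_big xpredT xpredT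
    (fun i j => fb_coef ((h \l r i) \r g^-1%g) (r i) * M g j j)) mulr_suml /=.
  by apply: eq_bigr => i _; rewrite -mulr_sumr.
- by move=> k c u v; rewrite fL linearP.
move=> v; apply: (can_inj fK); rewrite {1}(frame (f v)).
pose fl : {linear 'cV[C]_(rdegree N) -> YM iota X M} :=
  HB.pack f (GRing.isLinear.Build _ _ _ _ _ fL).
rewrite -[RHS]/(fl _) linear_sum; apply: eq_bigr => k _.
by rewrite linearZ /= f'K.
Qed.

End YMTrace.

Lemma ch_CR_map (G H : finGroupType) (X : fbiset A H G) (I : finType) (r : I -> X)
    (u : CR C G) h :
    (forall x, exists a i, x = a \f r i) ->
    (forall a i j, r i = a \f r j -> i = j) ->
  ch (CR_map iota (bcls C X) u) h = #|G|%:R^-1 *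
    \sum_g (\sum_i fb_coef ((h \l r i) \r g^-1%g) (r i)) * ch u g.
Proof.
move=> rS rI; pose F (u : CR C G) : C^o := ch (CR_map iota (bcls C X) u) h.
pose F' (u : CR C G) : C^o := #|G|%:R^-1 *
    \sum_g (\sum_i fb_coef ((h \l r i) \r g^-1%g) (r i)) * ch u g.
suff /(_ u) : F =1 F' by [].
apply: CK0_extP => [c v w|c v w|N].
- by rewrite /F CR_map_linearr ch_lin.
- transitivity (c * F' v + F' w) => //; rewrite /F' mulrCA -mulrDr [c * _]mulr_sumr.
  rewrite -big_split; congr (_ * _); apply: eq_bigr => g _.
  by rewrite ch_lin mulrDr mulrCA.
rewrite /F /F' -/(rcls N) CR_mapE chE.
rewrite (ch_YM rS rI h (YM_repP iota X N)); congr (_ * _).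
by apply: eq_bigr => g _; rewrite chE.
Qed.

Lemma fb_coef_transversal (G H : finGroupType) (X : fbiset A G H) (I : finType)
    (r : I -> X) a i j : (forall a i j, r i = a \f r j -> i = j) ->
  fb_coef (a \f r i) (r j) = iota a *+ (i == j).
Proof.
move=> rI; have [->|ne] := eqVneq i j; first exact: fb_coefE.
rewrite fb_coef0 // => -[b e]; case/eqP: ne; apply: (rI (a^-1 * b)%g).
by rewrite factM -e -factM mulVg fact1.
Qed.

Lemma fb_id_transversal (G : finGroupType) (r := fun z : G => (1%g, z) : fb_id A G) :
  (forall x, exists a i, x = a \f r i) /\ (forall a i j, r i = a \f r j -> i = j).
Proof.
split=> [[a g]|a i j [] //]; exists a, g.
by rewrite /r /= mulg1.
Qed.

Lemma ch_res (G H : finGroupType) (f : H -> G) (l : H -> A)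
    (fM : {morph f : x y / (x * y)%g}) (lM : {morph l : x y / (x * y)%g})
    (u : CR C G) h :
  ch (CR_map iota (bcls C (fb_res fM lM)) u) h = iota (l h) * ch u (f h).
Proof.
have [rS rI] := fb_id_transversal G.
rewrite (@ch_CR_map _ _ (fb_res fM lM) _ _ u h rS rI).
transitivity (#|G|%:R^-1 * \sum_(z : G) iota (l h) * ch u (f h)).
  congr (_ * _); under eq_bigr => g _ do rewrite mulr_suml.
  rewrite exchange_big; apply: eq_bigr => z _ /=.
  pose X := fb_res fM lM; pose r z : X := (1%g, z).
  have E g : fb_coef ((h \l r z) \r g^-1%g) (r z) = iota (l h) *+ (f h * z * g^-1 == z)%g.
    by rewrite -(@fb_coef_transversal _ _ X _ r).
  transitivity (\sum_g (iota (l h) *+ (f h * z * g^-1 == z)%g) * ch u g).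
    by apply: eq_bigr => g _; congr (_ * _); apply: E.
  (* For each z only the conjugate of f(h) by z contributes, and a character takes the same value
     there as at f(h). *)
  rewrite (bigD1 (f h ^ z)%g) //= big1 => [|g ne].
    rewrite conjgE !invMg invgK !mulgA mulgK mulgV mul1g eqxx addr0.
    by rewrite -mulgA -conjgE chJ.
  case: eqP => [e|]; last by rewrite mul0r.
  by case/eqP: ne; rewrite conjgE -[(f h * z)%g](mulgKV g) e mulKg.
rewrite sumr_const -[X in _ * X]mulr_natl [LHS]mulrA mulVf ?mul1r // prim_natr_eq0 //.
by rewrite -lt0n -cardsT cardG_gt0.
Qed.

Lemma ch_ind (G H : finGroupType) (f : H -> G) (fM : {morph f : x y / (x * y)%g})
    (u : CR C H) y :
  ch (CR_map iota (bcls C (fb_ind A fM)) u) y =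
    #|H|%:R^-1 * \sum_h \sum_z (y * z == z * f h)%g%:R * ch u h.
Proof.
have [rS rI] := fb_id_transversal G.
rewrite (@ch_CR_map _ _ (fb_ind A fM) _ _ u y rS rI).
congr (_ * _); apply: eq_bigr => h _; rewrite mulr_suml; apply: eq_bigr => z _.
pose X := fb_ind A fM; pose r z : X := (1%g, z).
have fV : f h^-1%g = (f h)^-1%g.
  by apply: (mulgI (f h)); rewrite -fM !mulgV (morph1 fM).
have E : fb_coef ((y \l r z) \r h^-1%g) (r z) = 1%:R *+ (y * z * (f h)^-1 == z)%g.
  by rewrite -(emb1 iota) -(@fb_coef_transversal _ _ X _ r) // fact1 -fV.
congr (_ * _); rewrite [LHS]E; congr _%:R.
by rewrite -(inj_eq (mulIg (f h))) mulgKV.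
Qed.

End Trace.

(** * Residues and automorphisms of cyclic groups *)

Section CoprimeResidues.
Local Open Scope nat_scope.

Lemma modn_weaken d n a b : (d %| n)%N -> a = b %[mod n] -> a = b %[mod d].
Proof. by move=> dn ab; rewrite -(modn_dvdm a dn) ab modn_dvdm. Qed.

Lemma coprime_mod k k' n : k = k' %[mod n] -> coprime k n = coprime k' n.
Proof. by move=> e; rewrite -coprime_modl e coprime_modl. Qed.

(** Add n t to k, where t is the part of N prime to k: a prime of N dividing k divides neither n nor
    t, and any other prime of N divides t but not k. If k = 0 then n = 1, and 1 will do. *)
Lemma coprime_lift k n N : (0 < n)%N -> (0 < N)%N -> coprime k n ->
  exists2 k', k' = k %[mod n] & coprime k' N.
Proof.
move=> n_gt0 N_gt0 kn; have [k0|k_gt0] := posnP k.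
  move: kn; rewrite k0 /coprime gcd0n => /eqP ->.
  by exists 1%N; [rewrite !modn1 | exact: coprime1n].
set t := N`_(\pi(k)^').
have kt : coprime k t by apply: (pnat_coprime (pnat_pi k_gt0)); apply: part_pnat.
exists (k + n * t)%N; first by rewrite addnC mulnC modnMDl.
have k'k : coprime (k + n * t) k.
  by rewrite -coprime_modl modnDl coprime_modl coprime_sym coprimeMr kn.
have k'_gt0 : (0 < k + n * t)%N by rewrite addn_gt0 k_gt0.
rewrite -(partnC \pi(k) N_gt0) coprimeMr; apply/andP; split.
  rewrite coprime_sym; apply: (pnat_coprime (part_pnat _ _)).
  by rewrite -coprime_pi' // coprime_sym.
by rewrite -coprime_modl addnC modnMDl coprime_modl.
Qed.

Lemma chinese_gcd m n a b : (0 < m)%N -> (0 < n)%N -> a = b %[mod gcdn m n] ->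
  exists k, k = a %[mod m] /\ k = b %[mod n].
Proof.
(* [a'] represents a modulo m and is at least b, so that the difference with b is a natural
   number. *)
move=> m_gt0 n_gt0 ab; pose a' := (a + b * m)%N.
have a'b : (b <= a')%N by rewrite /a' (leq_trans _ (leq_addl _ _)) // leq_pmulr.
have /eqP : a' = b %[mod gcdn m n].
  rewrite -ab; apply/eqP; rewrite eqn_mod_dvd ?leq_addr // addKn.
  by rewrite dvdn_mull // dvdn_gcdl.
rewrite eqn_mod_dvd // => /dvdnP [j ej].
have [u _ /dvdnP [q eq]] := Bezoutl n m_gt0.
(* By Bezout u n is minus the gcd modulo m; the factor [m.-1] stands for -1, so the added term is j
   times the gcd, that is a' - b, modulo m. *)
exists (b + u * n * j * m.-1)%N; split; last by rewrite addnC -mulnA mulnAC modnMDl.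
have e : (b + u * n * j * m.-1 + q * j * m = a' + u * n * j * m)%N.
  rewrite (mulnAC q j m) -eq -(subnK a'b) ej.
  have -> : (u * n * j * m = u * n * j * m.-1 + u * n * j)%N by rewrite -mulnSr prednK.
  by ring.
transitivity (a' %% m); last by rewrite /a' addnC modnMDl.
by rewrite -(modnMDl (q * j)) addnC e addnC modnMDl.
Qed.

(** Since m is a pi'-number, it has the same gcd with n times the pi-part of L as with n, so the
    congruences are compatible; [coprime_lift] then makes the solution prime to L. These k are the
    exponents through which the Galois group of the pi'-roots of unity acts. *)
Lemma unit_residue (pi : nat_pred) m n L s : (0 < m)%N -> (0 < n)%N -> (0 < L)%N ->
    pi^'.-nat m -> coprime s m -> s = 1 %[mod gcdn m n] ->
  exists k, [/\ k = s %[mod m], k = 1 %[mod n], coprime k L & k = 1 %[mod L`_pi]].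
Proof.
move=> m_gt0 n_gt0 L_gt0 pi_m s_m s1.
have Lm : coprime m L`_pi by rewrite coprime_sym (pnat_coprime (part_pnat pi L)).
have gE : gcdn m (n * L`_pi) = gcdn m n by rewrite Gauss_gcdl.
have N_gt0 : (0 < n * L`_pi)%N by rewrite muln_gt0 n_gt0 part_gt0.
have [|k0 [k0s k01]] := @chinese_gcd m (n * L`_pi) s 1 m_gt0 N_gt0; first by rewrite gE.
have ck0 : coprime k0 (m * (n * L`_pi)).
  by rewrite coprimeMr (coprime_mod k0s) s_m (coprime_mod k01) coprime1n.
have [|k kk0 kL] := coprime_lift _ L_gt0 ck0; first by rewrite muln_gt0 m_gt0.
have dm : (m %| m * (n * L`_pi))%N by rewrite dvdn_mulr.
have dN : (n * L`_pi %| m * (n * L`_pi))%N by rewrite dvdn_mull.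
exists k; split=> //; first by rewrite (modn_weaken dm kk0).
  by rewrite (modn_weaken (dvdn_trans (dvdn_mulr _ _) dN) kk0) // (modn_weaken (dvdn_mulr _ _) k01).
by rewrite (modn_weaken (dvdn_trans (dvdn_mull _ _) dN) kk0) // (modn_weaken (dvdn_mull _ _) k01).
Qed.
End CoprimeResidues.

Section CyclicGroup.
Variables (m : nat) (m_gt0 : (0 < m)%N).

Lemma ZmodM (x y : Zmod m) : nat_of_ord (x * y)%g = ((x + y) %% m)%N.
Proof. by rewrite /=; congr (_ %% _)%N; apply: prednK. Qed.

Lemma ZmodX (x : Zmod m) k : nat_of_ord (x ^+ k)%g = ((x * k) %% m)%N.
Proof. by rewrite Zp_expg /=; congr (_ %% _)%N; apply: prednK. Qed.

Lemma Zmod_lt (x : Zmod m) : (x < m)%N.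
Proof. by rewrite -[X in (_ < X)%N](prednK m_gt0) ltn_ord. Qed.

(** The reduction covers m = 1, where the generator [Zp1] is 0. *)
Lemma Zp1_val : nat_of_ord (Zp1 : Zmod m) = (1 %% m)%N.
Proof. by rewrite /=; congr (_ %% _)%N; apply: prednK. Qed.

Lemma Zmod_gen (x : Zmod m) : x = ((Zp1 : Zmod m) ^+ nat_of_ord x)%g.
Proof.
apply: val_inj; rewrite [RHS]ZmodX Zp1_val modnMml mul1n modn_small //.
exact: Zmod_lt.
Qed.

Lemma Zmod_expP (x : Zmod m) k l : k = l %[mod m] -> (x ^+ k)%g = (x ^+ l)%g.
Proof. by move=> kl; apply: val_inj; rewrite /= !ZmodX -modnMmr kl modnMmr. Qed.

Lemma Zmod_expn (x : Zmod m) : (x ^+ m)%g = 1%g.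
Proof. by apply: val_inj; rewrite [LHS]ZmodX modnMl. Qed.

Lemma Zmod_order1 : #[Zp1 : Zmod m]%g = m.
Proof.
apply/eqP; rewrite eqn_dvd order_dvdn; apply/andP; split.
  by rewrite Zmod_expn.
have /eqP := expg_order (Zp1 : Zmod m); rewrite -val_eqE [X in X == _]ZmodX Zp1_val.
by rewrite modnMml mul1n.
Qed.

Lemma Zmod_orderP (x : Zmod m) : (#[x]%g == m) = coprime x m.
Proof.
rewrite [X in #[X]%g]Zmod_gen orderXgcd Zmod_order1 /coprime gcdnC.
apply/eqP/eqP => [e|->]; last by rewrite divn1.
have := divnK (dvdn_gcdr x m); rewrite e => /eqP.
by rewrite -[X in _ == X]muln1 eqn_pmul2l // => /eqP.
Qed.

Lemma card_Zmod : #|{: Zmod m}| = m.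
Proof. by rewrite card_ord prednK. Qed.

Definition zexp (G : finGroupType) (g : G) (x : Zmod m) : G := (g ^+ nat_of_ord x)%g.

Lemma zexpM (G : finGroupType) (g : G) : (g ^+ m)%g = 1%g ->
  {morph zexp g : x y / (x * y)%g}.
Proof.
move=> gm x y; rewrite /zexp -expgD -[in RHS](expg_mod _ gm); congr (_ ^+ _)%g.
exact: ZmodM.
Qed.

Lemma zexp1 (G : finGroupType) (g : G) : (g ^+ m)%g = 1%g -> zexp g Zp1 = g.
Proof. by move=> gm; rewrite /zexp Zp1_val expg_mod // expg1. Qed.

Lemma AutZE (s : AutZ m) x : sgval s x = (x ^+ AutZ_unit s)%g.
Proof.
have sX k : sgval s (Zp1 ^+ k)%g = (sgval s (Zp1 : Zmod m) ^+ k)%g.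
  elim: k => [|k IH]; last by rewrite !expgS AutZ_morph IH.
  exact: (morph1 (@AutZ_morph m s)).
rewrite [in LHS](Zmod_gen x) sX /AutZ_unit [in LHS](Zmod_gen (sgval s _)).
by rewrite -expgM mulnC expgM -Zmod_gen.
Qed.

Lemma AutZ_eq (s t : AutZ m) : AutZ_unit s = AutZ_unit t %[mod m] -> s = t.
Proof.
move=> st; apply: val_inj; apply/permP => x.
by rewrite -!/(sgval _) !AutZE; apply: Zmod_expP.
Qed.

Lemma AutZ_unitM (s t : AutZ m) : AutZ_unit (s * t)%g = (AutZ_unit s * AutZ_unit t)%N %[mod m].
Proof.
have -> : AutZ_unit (s * t)%g = sgval t (sgval s (Zp1 : Zmod m)).
  by rewrite /AutZ_unit /= permM.
by rewrite AutZE ZmodX modn_mod.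
Qed.

Lemma AutZ_unit1 : AutZ_unit (1%g : AutZ m) = 1%N %[mod m].
Proof. by rewrite /AutZ_unit /= perm1 Zp1_val modn_mod. Qed.

Lemma AutZ_unit_coprime (s : AutZ m) : coprime (AutZ_unit s) m.
Proof.
have /coprime_mod : (AutZ_unit s * AutZ_unit s^-1%g = 1 %[mod m])%N.
  by rewrite -AutZ_unitM mulgV AutZ_unit1.
by rewrite coprime1n coprimeMl => /andP [].
Qed.

Lemma AutZ_lift k : coprime k m -> exists s : AutZ m, AutZ_unit s = k %[mod m].
Proof.
move=> km; pose f (x : Zmod m) := (x ^+ k)%g.
have f_inj : injective f.
  move=> x y xy; have ck : coprime #|[set: Zmod m]| k.
    by rewrite cardsT card_Zmod coprime_sym.
  by rewrite -(expgK ck (in_setT x)) -(expgK ck (in_setT y)) -/(f x) xy.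
have fA : perm f_inj \in Aut [set: Zmod m].
  rewrite inE; apply/andP; split; first by apply/subsetP => x _; rewrite inE.
  apply/morphicP => x y _ _; rewrite !permE; apply: expgMn.
  exact: Zp_mulgC.
exists (Subg fA); rewrite /AutZ_unit /= permE /f ZmodX Zp1_val modn_mod.
by rewrite modnMml mul1n.
Qed.

Lemma AutZ_abelian : abelian [set: AutZ m].
Proof.
apply/centsP => s _ t _; apply: AutZ_eq.
by rewrite !AutZ_unitM mulnC.
Qed.
End CyclicGroup.

Section CyclicQuotient.
Variables (n d : nat).
Hypotheses (n_gt0 : (0 < n)%N) (d_gt0 : (0 < d)%N) (dn : (d %| n)%N).

Lemma Zp1_expn_dvd : ((Zp1 : Zmod d) ^+ n)%g = 1%g.
Proof. by case/dvdnP: dn => q ->; rewrite mulnC expgM Zmod_expn // expg1n. Qed.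

Lemma zexp_Zp1 (x : Zmod n) : nat_of_ord (zexp (Zp1 : Zmod d) x) = (x %% d)%N.
Proof. by rewrite /zexp ZmodX // Zp1_val // modnMml mul1n. Qed.
End CyclicQuotient.

(** * Conductors and primitive characters *)

Section DirichletCharacters.
Variable C : fieldType.

Lemma lin_char_eq m d (zeta : {ffun AutZ m -> C}) : (0 < m)%N -> (d %| m)%N ->
    lin_char zeta -> (forall s, AutZ_unit s = 1%N %[mod d] -> zeta s = 1) ->
  forall s t, AutZ_unit s = AutZ_unit t %[mod d] -> zeta s = zeta t.
Proof.
move=> m_gt0 dm [z1 zM] zker s t st.
rewrite -[s](mulgKV t) zM zker ?mul1r //.
rewrite (modn_weaken dm (AutZ_unitM m_gt0 _ _)) -modnMml st modnMml.
rewrite -(modn_weaken dm (AutZ_unitM m_gt0 _ _)) mulgV.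
exact: modn_weaken (AutZ_unit1 m_gt0).
Qed.

(** Every unit modulo d lifts to a unit modulo m, and the value of zeta does not depend on the lift,
    as zeta is trivial on the kernel of reduction; hence zeta descends. *)
Lemma induced_from_ker m d (zeta : {ffun AutZ m -> C}) : (0 < m)%N -> (d %| m)%N ->
    lin_char zeta -> (forall s, AutZ_unit s = 1%N %[mod d] -> zeta s = 1) ->
  induced_from d zeta.
Proof.
move=> m_gt0 dm zL zker; have zE := lin_char_eq m_gt0 dm zL zker.
have d_gt0 : (0 < d)%N := dvdn_gt0 m_gt0 dm.
have /choice [lift liftE] (t : AutZ d) : exists s : AutZ m, AutZ_unit s = AutZ_unit t %[mod d].
  have [k kt km] := coprime_lift d_gt0 m_gt0 (AutZ_unit_coprime d_gt0 t).
  have [s sk] := AutZ_lift m_gt0 km; exists s.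
  by rewrite (modn_weaken dm sk).
have [z1 zM] := zL.
exists [ffun t => zeta (lift t)]; last by move=> s t st; rewrite ffunE; apply: zE; rewrite liftE.
split=> [|s t]; rewrite !ffunE.
  by apply: zker; rewrite liftE AutZ_unit1.
rewrite -zM; apply: zE.
rewrite (modn_weaken dm (AutZ_unitM m_gt0 _ _)) liftE AutZ_unitM //.
by rewrite -modnMm -!liftE modnMm.
Qed.

(** The smallest divisor d of n from which xi is induced works: if the character modulo d came from
    a proper divisor of d, so would xi. *)
Lemma conductor n (xi : {ffun AutZ n -> C}) : (0 < n)%N -> lin_char xi ->
  exists d (zeta : {ffun AutZ d -> C}), [/\ (d %| n)%N, primitive zeta &
    forall s t, AutZ_unit s = AutZ_unit t %[mod d] -> xi s = zeta t].
Proof.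
move=> n_gt0 xL.
pose P d := `[< (d %| n)%N /\ induced_from d xi >].
have exP : exists d, P d.
  exists n; apply/asboolP; split=> //; exists xi => // s t /(AutZ_eq n_gt0) -> //.
case: (ex_minnP exP) => d /asboolP [dn [zeta zL xz]] d_min.
have d_gt0 : (0 < d)%N := dvdn_gt0 n_gt0 dn.
exists d, zeta; split=> //; split=> // d' d'd d'_neq [zeta' z'L zz'].
have /d_min : P d'.
  apply/asboolP; split; first exact: dvdn_trans dn.
  exists zeta' => // s t st.
  have [u us] : exists u : AutZ d, AutZ_unit u = AutZ_unit s %[mod d].
    by apply: (AutZ_lift d_gt0); apply: coprime_dvdr dn (AutZ_unit_coprime n_gt0 s).
  by rewrite (xz s u) // (zz' u t) // (modn_weaken d'd us).
by move/(leq_trans _)=> h; apply: d'_neq; apply/eqP; rewrite eqn_leq dvdn_leq //= h.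
Qed.

(** By [unit_residue], any s congruent to 1 modulo gcd(m, n) is represented by an admissible k, so
    zeta is trivial on it and is induced from the gcd; primitivity forces the gcd to be m. *)
Lemma primitive_residue (pi : nat_pred) m n L (zeta : {ffun AutZ m -> C}) :
    (0 < m)%N -> (0 < n)%N -> (0 < L)%N -> pi^'.-nat m -> primitive zeta ->
    (forall s k, k = AutZ_unit s %[mod m] -> k = 1%N %[mod n] -> coprime k L ->
      k = 1%N %[mod L`_pi] -> zeta s = 1) ->
  (m %| n)%N.
Proof.
move=> m_gt0 n_gt0 L_gt0 pi_m [zL zP] H.
have dm := dvdn_gcdl m n.
case: (eqVneq (gcdn m n) m) => [<-|/eqP ne]; first exact: dvdn_gcdr.
case: (zP _ dm ne); apply: induced_from_ker => // s s1.
have [k [ks k1 kL kpi]] :=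
  unit_residue m_gt0 n_gt0 L_gt0 pi_m (AutZ_unit_coprime m_gt0 s) s1.
exact: H kL kpi.
Qed.

Lemma Upsilon_gt0 pi (i : Upsilon C pi) : (0 < ups_m i)%N.
Proof. by case/andP: (ups_nat i). Qed.

(** The Galois action separates the pairs (m, zeta). Setting one of the two automorphisms to 1 gives
    each divisibility between the moduli by [primitive_residue]; the characters are compared
    afterwards. *)
Lemma Upsilon_eq (pi : nat_pred) (i j : Upsilon C pi) L : (0 < L)%N ->
    (forall s t k, k = AutZ_unit s %[mod ups_m i] -> k = AutZ_unit t %[mod ups_m j] ->
      coprime k L -> k = 1%N %[mod L`_pi] -> ups_zeta i s = ups_zeta j t) ->
  i = j.
Proof.
move=> L_gt0 H; have mi := Upsilon_gt0 i; have mj := Upsilon_gt0 j.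
have [[_ _] _] := (ups_primitive i, ups_primitive j).
have dij : (ups_m i %| ups_m j)%N.
  apply: (primitive_residue mi mj L_gt0 (ups_nat i) (ups_primitive i)) => s k ks k1 kL kpi.
  rewrite (H s 1%g k) ?(AutZ_unit1 mj) //.
  by have [[]] := ups_primitive j.
have dji : (ups_m j %| ups_m i)%N.
  apply: (primitive_residue mj mi L_gt0 (ups_nat j) (ups_primitive j)) => s k ks k1 kL kpi.
  rewrite -(H 1%g s k) ?(AutZ_unit1 mi) //.
  by have [[]] := ups_primitive i.
have /eqP mE : ups_m i == ups_m j by rewrite eqn_dvd dij.
case: i j mE mi mj H {dij dji} => [m zeta nm pm] [m' zeta' nm' pm'] /= mE.
case: m' / mE zeta' nm' pm' => zeta' nm' pm' m_gt0 _ H.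
have zz' : zeta = zeta'.
  apply/ffunP => s.
  (* With n = 1 the condition modulo the gcd is empty, so every s is represented by an admissible
     k. *)
  have s1 : AutZ_unit s = 1%N %[mod gcdn m 1] by rewrite gcdn1 !modn1.
  have [k [ks _ kL kpi]] :=
    unit_residue m_gt0 (ltn0Sn 0) L_gt0 nm (AutZ_unit_coprime m_gt0 s) s1.
  exact: H kL kpi.
case: zeta' / zz' pm' H => pm' _.
by congr Build_Upsilon; [apply: bool_irrelevance | apply: Prop_irrelevance].
Qed.
End DirichletCharacters.

(** * The action of the Galois group *)

Section FibreGroupTorsion.
Variables (C : fieldType) (pi : nat_pred).

Lemma coprime_expr_eq1 (z : C) a b : coprime a b -> z ^+ a = 1 -> z ^+ b = 1 -> z = 1.
Proof.
have [->|a_gt0] := posnP a.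
  by rewrite /coprime gcd0n => /eqP -> _; rewrite expr1.
case: (egcdnP b a_gt0) => u v e _ /eqP ab za zb; move: e; rewrite ab => e.
have := congr1 (fun k => z ^+ k) e.
by rewrite mulnC exprM za expr1n exprD mulnC exprM zb expr1n mul1r.
Qed.

(** The elements of pi-order form a subgroup containing the generators. *)
Lemma mu_pi_torsion (z : C) : in_mu_pi pi z -> exists2 n, pi.-nat n & z ^+ n = 1.
Proof.
move=> zpi; apply: (zpi (fun z => exists2 n, pi.-nat n & z ^+ n = 1)); first split.
- by exists 1%N.
- case=> n /andP [n_gt0 _]; rewrite expr0n -leqn0 leqNgt n_gt0 => /esym/eqP.
  by rewrite oner_eq0.
- move=> x y [n n_pi xn] [k k_pi yk]; exists (n * k)%N; first by rewrite pnatM n_pi.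
  by rewrite exprMn exprM xn expr1n mulnC exprM yk expr1n mulr1.
- by move=> x [n n_pi xn]; exists n => //; rewrite exprVn xn invr1.
move=> x [p [n [p_pi p_pr n_gt0 xn]]]; exists (p ^ n)%N => //.
by rewrite pnatX pnatE // p_pi.
Qed.

(** Induction on n: for a prime p dividing n, z is a product of powers of its p-part, which is a
    generator, and of its p'-part, whose order divides a smaller pi-number. *)
Lemma mu_pi_root (z : C) n : pi.-nat n -> z ^+ n = 1 -> in_mu_pi pi z.
Proof.
move=> n_pi zn B BG Br; have [B1 _ BM BV] := BG.
have BX x k : B x -> B (x ^+ k) by move=> Bx; elim: k => // k IH; rewrite exprS; apply: BM.
have [k le_nk] := ubnP n; elim: k => // k IH in n z n_pi zn le_nk *.
have /andP [n_gt0 /allP n_pi'] := n_pi.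
have [n1|n_neq1] := eqVneq n 1%N; first by move: zn; rewrite n1 expr1 => ->.
have n_gt1 : (1 < n)%N by case: (n) n_gt0 n_neq1 => [|[]].
have p_pr := pdiv_prime n_gt1; set p := pdiv n in p_pr.
have p_dvd : (p %| n)%N := pdiv_dvd n.
have p_pi : p \in pi by apply: n_pi'; rewrite mem_primes p_pr n_gt0.
have npp := partnC p n_gt0.
have np'_lt : (n`_p^' < n)%N.
  rewrite -[X in (_ < X)%N]npp ltn_Pmull ?part_gt0 // p_part -(expn0 p) ltn_exp2l ?prime_gt1 //.
  by rewrite logn_gt0 mem_primes p_pr n_gt0.
have Bp : B (z ^+ n`_p^').
  apply: Br; exists p, (logn p n); split=> //; first by rewrite logn_gt0 mem_primes p_pr n_gt0.
  by rewrite -p_part -exprM mulnC npp.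
have Bp' : B (z ^+ n`_p).
  apply: (IH (n`_p^')%N); last exact: leq_trans np'_lt _.
    exact: pnat_dvd (dvdn_part _ _) n_pi.
  by rewrite -exprM npp.
case: (egcdnP n`_p^' (part_gt0 p n)) => u v e _.
have g1 : gcdn n`_p n`_p^' = 1%N by apply/eqP; apply: coprime_partC.
have zE : z = (z ^+ n`_p) ^+ u * ((z ^+ n`_p^') ^+ v)^-1.
  have z_neq0 : z ^+ n`_p^' != 0.
    apply/eqP => e0; have /eqP : z ^+ n = 0 by rewrite -npp mulnC exprM e0 expr0n eqn0Ngt part_gt0.
    by rewrite zn oner_eq0.
  rewrite -exprM mulnC e g1 exprD expr1 mulnC exprM mulrC mulKf //.
  by rewrite expf_neq0.
by rewrite zE; apply: BM; [apply: BX | apply/BV/BX].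
Qed.
End FibreGroupTorsion.

Lemma linear_0 (C : fieldType) (U V : lmodType C) (f : U -> V) : linear f -> f 0 = 0.
Proof.
by move=> fL; have := fL (-1) 0 0; rewrite scaler0 addr0 scaleN1r addNr.
Qed.

(** * Power maps on class functions commute with fibered bisets *)

Section Eigenfunctions.
Variables (C : fieldType) (pi : nat_pred).
Hypothesis C_prim : forall n, (0 < n)%N -> exists z : C, n.-primitive_root z.
Notation A := (mu_pi C pi).
Notation iota := (mu_embedding C pi).

Lemma cardT_gt0 (G : finGroupType) : (0 < #|G|)%N.
Proof. by rewrite -cardsT cardG_gt0. Qed.

Lemma expg_cardT (G : finGroupType) (g : G) : (g ^+ #|G|)%g = 1%g.
Proof. by rewrite -cardsT expg_cardG ?inE. Qed.

Section BisetPowers.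
Variables (G H : finGroupType) (X : fbiset A H G) (x : X).
Let N := (#|G| * #|H|)%N.

Lemma fb_pow h g a k : (h \l x) \r g^-1%g = a \f x ->
  exists2 b : A, ((h ^+ k)%g \l x) \r (g ^+ k)^-1%g = b \f x & val b = val a ^+ k.
Proof.
move=> e; elim: k => [|k [b eb vb]].
  by exists 1%g; rewrite // !expg0 invg1 lact1 ract1 fact1.
exists (a * b)%g; last by rewrite exprS -vb.
rewrite expgS lactM expgS invMg ractM -lract eb.
by rewrite lfact rfact e -factM abmulgC.
Qed.

(** The N-th powers of h and g are trivial, so a ^ N = 1; as a also has pi-order, the pi-part of N
    suffices. *)
Lemma fb_eigen_torsion h g (a : A) : (h \l x) \r g^-1%g = a \f x -> val a ^+ N`_pi = 1.
Proof.
move=> e; have [b eb vb] := fb_pow N e.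
have N_gt0 : (0 < N)%N by rewrite muln_gt0 !cardT_gt0.
have hN : (h ^+ N)%g = 1%g by rewrite /N mulnC expgM expg_cardT expg1n.
have gN : (g ^+ N)%g = 1%g by rewrite /N expgM expg_cardT expg1n.
have aN : val a ^+ N = 1.
  rewrite -vb; suff -> : b = 1%g by [].
  by apply: (fact_free (f := fb_on X) (x := x)); rewrite -eb hN gN invg1 lact1 ract1.
have [n n_pi an] := mu_pi_torsion (asboolW (valP a)).
apply: (@coprime_expr_eq1 _ _ n N`_pi^').
- exact: pnat_coprime n_pi (part_pnat _ _).
- by rewrite -exprM mulnC exprM an expr1n.
- by rewrite -exprM partnC.
Qed.

Lemma fb_coef_pow h g k : coprime k N -> k = 1%N %[mod N`_pi] ->
  fb_coef iota (((h ^+ k)%g \l x) \r (g ^+ k)^-1%g) x = fb_coef iota ((h \l x) \r g^-1%g) x.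
Proof.
move=> kN k1; have N_gt0 : (0 < N)%N by rewrite muln_gt0 !cardT_gt0.
have [[a e]|ne] := pselect (exists a, (h \l x) \r g^-1%g = a \f x).
  have [b eb vb] := fb_pow k e; rewrite (fb_coefE _ e) (fb_coefE _ eb) /= vb.
  by rewrite -(expr_mod k (fb_eigen_torsion e)) k1 expr_mod ?expr1 // (fb_eigen_torsion e).
(* [l] inverts k modulo N, so an l-th power carries a relation between the k-th powers back to h and
   g. *)
rewrite !fb_coef0 // => -[b e]; apply: ne; pose l := (k ^ (totient N).-1)%N.
have kl : (k * l = 1 %[mod N])%N.
  by rewrite /l -expnS prednK ?totient_gt0 // Euler_exp_totient.
have powK (K : finGroupType) (y : K) : (#|K| %| N)%N -> ((y ^+ k) ^+ l)%g = y.
  move=> KN; rewrite -expgM -(expg_mod _ (expg_cardT y)) (modn_weaken KN kl).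
  by rewrite expg_mod ?expg1 // expg_cardT.
have [c ec _] := fb_pow l e; exists c.
by rewrite -ec (powK H h (dvdn_mull _ (dvdnn _))) (powK G g (dvdn_mulr _ (dvdnn _))).
Qed.
End BisetPowers.

Section EigenDef.
Variables (m : nat) (zeta : {ffun AutZ m -> C}).

(* The eigenvalue of f |-> (x |-> f(x ^ k)) is the inverse of zeta: Iso^s acts on
   the class functions on Z/m by f |-> f o s^-1. *)
Definition eigen (G : finGroupType) (u : CR C G) : Prop :=
  forall s k x, k = AutZ_unit s %[mod m] -> coprime k #|G| -> k = 1%N %[mod (#|G|)`_pi] ->
    zeta s * ch u (x ^+ k)%g = ch u x.

Lemma eigen0 (G : finGroupType) : eigen (0 : CR C G).
Proof. by move=> s k x _ _ _; rewrite !ch0 mulr0. Qed.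

Lemma eigen_lin (G : finGroupType) c (u v : CR C G) :
  eigen u -> eigen v -> eigen (c *: u + v).
Proof.
move=> uE vE s k x ks kG k1; rewrite !ch_lin mulrDr mulrCA.
by rewrite (uE s k x) // (vE s k x).
Qed.

Hypotheses (m_gt0 : (0 < m)%N) (m_pi : pi^'.-nat m).

(** In the trace formula, substitute a power of g for g: the coefficients are unchanged by
    [fb_coef_pow], and the values of u are multiplied by the inverse of [zeta s]. *)
Lemma eigen_CR_map (G H : finGroupType) (phi : Chom A C G H) (u : CR C G) :
  eigen u -> eigen (CR_map iota phi u).
Proof.
move=> uE; move: phi; apply: (@CK0_ind _ _ _ _ (fun phi => eigen (CR_map iota phi u))).
- move=> t; rewrite -bcls_sk; move: (fb_of_sk t) => X s k h ks kH k1.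
  have [I [r [rS rI]]] := fb_transversal X.
  rewrite !(ch_CR_map iota C_prim _ _ rS rI) mulrCA; congr (_ * _).
  set L := (#|G| * #|H|)%N.
  (* The exponent k is controlled only modulo m and |H|. It is replaced by some k' congruent to it
     modulo both, prime to |G| |H| and congruent to 1 modulo the pi-part of that product; the
     pi'-part of |H| is put into the modulus to keep h ^ k unchanged. *)
  have m'_gt0 : (0 < m * (#|H|)`_pi^')%N by rewrite muln_gt0 m_gt0 part_gt0.
  have m'_pi : (pi^'.-nat (m * (#|H|)`_pi^'))%N by rewrite pnatM m_pi part_pnat.
  have km' : coprime k (m * (#|H|)`_pi^').
    rewrite coprimeMr (coprime_mod ks) AutZ_unit_coprime //.
    exact: coprime_dvdr (dvdn_part _ _) kH.
  have L_gt0 : (0 < L)%N by rewrite muln_gt0 !cardT_gt0.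
  have k1' : k = 1%N %[mod gcdn (m * (#|H|)`_pi^') 1] by rewrite gcdn1 !modn1.
  have [k' [kk' _ k'L k'1]] := unit_residue m'_gt0 (ltn0Sn 0) L_gt0 m'_pi km' k1'.
  have k'H : k' = k %[mod #|H|].
    apply/eqP; rewrite -(partnC pi (cardT_gt0 H)) chinese_remainder ?coprime_partC //.
    rewrite (modn_weaken (dvdn_mull _ (dvdnn _)) kk') eqxx andbT k1.
    by rewrite (modn_weaken (partn_dvd _ L_gt0 (dvdn_mull _ (dvdnn _))) k'1).
  have -> : (h ^+ k = h ^+ k')%g.
    by rewrite -(expg_mod _ (expg_cardT h)) -k'H expg_mod // expg_cardT.
  have powI : injective (fun g : G => g ^+ k')%g.
    move=> g g' gg'; have cG : coprime #|[set: G]| k'.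
      by rewrite cardsT coprime_sym (coprime_dvdr _ k'L) // dvdn_mulr.
    by rewrite -(expgK cG (in_setT g)) -(expgK cG (in_setT g')) gg'.
  rewrite mulr_sumr (reindex_inj powI); apply: eq_bigr => g _ /=.
  rewrite mulrCA; congr (_ * _); last first.
    apply: uE; first by rewrite (modn_weaken (dvdn_mulr _ (dvdnn _)) kk').
      by rewrite (coprime_dvdr _ k'L) // dvdn_mulr.
    by rewrite (modn_weaken (partn_dvd _ L_gt0 (dvdn_mulr _ (dvdnn _))) k'1).
  by apply: eq_bigr => i _; apply: fb_coef_pow.
- rewrite (linear_0 (fun c phi psi => CR_map_linearl iota u c phi psi)).
  exact: eigen0.
by move=> c v w Ev Ew; rewrite CR_map_linearl; apply: eigen_lin.
Qed.

End EigenDef.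
End Eigenfunctions.

(** * Generation *)

Lemma coprime_primes x n : (0 < n)%N -> coprime x n = all (fun p => ~~ (p %| x)%N) (primes n).
Proof.
move=> n_gt0; apply/idP/allP => [xn p|H].
  rewrite mem_primes => /and3P [p_pr _ pn]; apply/negP => px.
  have := dvdn_gcd p x n; rewrite px pn (eqP xn) dvdn1 => /eqP p1.
  by rewrite p1 in p_pr.
have g_gt0 : (0 < gcdn x n)%N by rewrite gcdn_gt0 n_gt0 orbT.
rewrite /coprime; case: (ltngtP (gcdn x n) 1) => // [|g_gt1]; first by rewrite ltnS leqNgt g_gt0.
have /H/negP[] : pdiv (gcdn x n) \in primes n.
  by rewrite mem_primes pdiv_prime // n_gt0 (dvdn_trans (pdiv_dvd _) (dvdn_gcdr _ _)).
exact: dvdn_trans (pdiv_dvd _) (dvdn_gcdl _ _).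
Qed.

Lemma sum_prim_root (F : fieldType) a (w : F) t : a.-primitive_root w ->
  \sum_(j < a) (w ^+ t) ^+ j = (a %| t)%N%:R * a%:R.
Proof.
move=> w_pr; have [at_|nat_] := boolP (a %| t)%N.
  rewrite mul1r (eq_bigr (fun=> 1)) ?sumr_const ?card_ord // => j _.
  by move: at_; rewrite (prim_order_dvd w_pr) => /eqP ->; rewrite expr1n.
have ne : w ^+ t - 1 != 0 by rewrite subr_eq0 -(prim_order_dvd w_pr).
apply: (mulfI ne); rewrite mul0r mulr0 -subrX1 -exprM mulnC exprM.
by rewrite (prim_expr_order w_pr) expr1n subrr.
Qed.

Section Realizable.
Variables (C : fieldType) (pi : nat_pred).
Hypothesis C_prim : forall n, (0 < n)%N -> exists z : C, n.-primitive_root z.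
Notation A := (mu_pi C pi).
Notation iota := (mu_embedding C pi).
Notation F := (functor_CR iota).

Section Operations.
Variable P : forall G : finGroupType, CR C G -> Prop.
Hypothesis Psub : @subfunctor A C F P.

(** The class functions belonging to the subfunctor P; by [ch_inj] they determine it. *)
Definition realized (G : finGroupType) (f : G -> C) : Prop :=
  exists2 u : CR C G, P u & ch u =1 f.

Lemma realized_ext (G : finGroupType) (f g : G -> C) :
  f =1 g -> realized f -> realized g.
Proof. by move=> fg [u Pu uf]; exists u => // x; rewrite uf. Qed.

Lemma realized_lin (G : finGroupType) c (f g : G -> C) :
  realized f -> realized g -> realized (fun x => c * f x + g x).
Proof.
have [_ PL _] := Psub; move=> [u Pu uf] [v Pv vg]; exists (c *: u + v); first exact: PL.
by move=> x; rewrite ch_lin uf vg.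
Qed.

Lemma realized0 (G : finGroupType) : realized (fun _ : G => 0).
Proof. by have [P0 _ _] := Psub; exists 0; [exact: P0 | move=> x; rewrite ch0]. Qed.

Lemma realized_scale (G : finGroupType) c (f : G -> C) :
  realized f -> realized (fun x => c * f x).
Proof.
move=> Qf; apply: realized_ext (realized_lin c Qf (realized0 G)) => x.
by rewrite addr0.
Qed.

Lemma realized_sum (G : finGroupType) (I : finType) (c : I -> C) (f : I -> G -> C) :
  (forall i, realized (f i)) -> realized (fun x => \sum_i c i * f i x).
Proof.
move=> Qf; elim: (index_enum I) => [|i s IH].
  by apply: realized_ext (realized0 G) => x; rewrite big_nil.
by apply: realized_ext (realized_lin (c i) (Qf i) IH) => x; rewrite big_cons.
Qed.

Lemma realized_res (G H : finGroupType) (h : H -> G) (l : H -> A) (f : G -> C) :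
    {morph h : x y / (x * y)%g} -> {morph l : x y / (x * y)%g} ->
  realized f -> realized (fun x => iota (l x) * f (h x)).
Proof.
have [_ _ PF] := Psub; move=> hM lM [u Pu uf].
exists (CR_map iota (bcls C (fb_res hM lM)) u); first exact: PF.
by move=> x; rewrite ch_res ?uf.
Qed.

Lemma realized_pullback (G H : finGroupType) (h : H -> G) (f : G -> C) :
  {morph h : x y / (x * y)%g} -> realized f -> realized (fun x => f (h x)).
Proof.
move=> hM; have lM : {morph (fun _ : H => 1%g : A) : x y / (x * y)%g} by move=> x y; rewrite mulg1.
by move/(realized_res hM lM); apply: realized_ext => x; rewrite mul1r.
Qed.

Lemma realized_ind (G H : finGroupType) (h : H -> G) (f : H -> C) :
    {morph h : x y / (x * y)%g} ->
  realized f -> realized (fun y => \sum_x \sum_z (y * z == z * h x)%g%:R * f x).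
Proof.
have [_ _ PF] := Psub; move=> hM [u Pu uf].
have Q : realized (fun y => #|H|%:R^-1 * \sum_x \sum_z (y * z == z * h x)%g%:R * f x).
  exists (CR_map iota (bcls C (fb_ind A hM)) u); first exact: PF.
  move=> y; rewrite ch_ind //; congr (_ * _); apply: eq_bigr => x _.
  by apply: eq_bigr => z _; rewrite uf.
apply: realized_ext (realized_scale #|H|%:R Q) => y.
by rewrite mulVKf // prim_natr_eq0 // -lt0n cardT_gt0.
Qed.

(** In a commutative target all conjugating elements contribute alike, and induction becomes
    summation over the fibres of h. *)
Lemma realized_ind_Zmod n (n_gt0 : (0 < n)%N) (H : finGroupType) (h : H -> Zmod n) (f : H -> C) :
    {morph h : x y / (x * y)%g} ->
  realized f -> realized (fun y => \sum_(x | h x == y) f x).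
Proof.
move=> hM /(realized_ind hM)/(realized_scale (n%:R^-1)); apply: realized_ext => y.
have n_neq0 : n%:R != 0 :> C by rewrite prim_natr_eq0 // -lt0n.
rewrite [RHS]big_mkcond mulr_sumr; apply: eq_bigr => x _.
under eq_bigr => z _ do rewrite (Zp_mulgC y z) (inj_eq (mulgI z)) eq_sym.
rewrite sumr_const (_ : #|_| = n); last exact: card_Zmod.
case: eqP => _; last by rewrite mul0r mul0rn mulr0.
by rewrite mul1r -[X in _ * X]mulr_natl mulKf.
Qed.

(** Restriction to the subgroup of multiples of p followed by induction multiplies by its indicator
    function, up to a scalar. *)
Lemma realized_dvd n p (f : Zmod n -> C) : (0 < n)%N -> (p %| n)%N ->
  realized f -> realized (fun x : Zmod n => (p %| x)%N%:R * f x).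
Proof.
move=> n_gt0 pn Qf; have p_gt0 : (0 < p)%N := dvdn_gt0 n_gt0 pn.
set n' := (n %/ p)%N; have n'_gt0 : (0 < n')%N by rewrite divn_gt0 // dvdn_leq.
have e : (p * n' = n)%N by rewrite mulnC divnK.
have gn' : (((Zp1 : Zmod n) ^+ p) ^+ n')%g = 1%g.
  by rewrite -expgM e Zmod_expn.
have hM := zexpM n'_gt0 gn'; set h := zexp _ in hM.
have hE (j : Zmod n') : (h j : Zmod n) = (p * j)%N :> nat.
  rewrite /h /zexp -expgM ZmodX // Zp1_val // modnMml mul1n modn_small //.
  by rewrite -[X in (_ < X)%N]e ltn_pmul2l // Zmod_lt.
have := realized_ind_Zmod n_gt0 hM (realized_pullback hM Qf).
apply: realized_ext => y; rewrite (eq_bigr (fun=> f y)) => [|x /eqP -> //].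
rewrite sumr_const mulr_natl; congr (_ *+ _).
have [/dvdnP [j yj]|npy] := boolP (p %| y)%N; last first.
  apply: eq_card0 => x; apply/negP => /eqP hxy; case/negP: npy.
  by have := hE x; rewrite hxy => ->; rewrite dvdn_mulr.
have j_lt : (j < n'.-1.+1)%N.
  by rewrite prednK // -(ltn_pmul2l p_gt0) e mulnC -yj Zmod_lt.
apply: (@eq_card1 _ (Ordinal j_lt)) => x.
rewrite -[LHS]/(h x == y) -!val_eqE /= [X in X == _]hE yj mulnC eqn_pmul2r //.
Qed.

(** The indicator of the generators is the product, over the primes p dividing n, of 1 minus the
    indicator of the multiples of p. *)
Lemma realized_coprime n (f : Zmod n -> C) : (0 < n)%N ->
  realized f -> realized (fun x : Zmod n => (coprime x n)%:R * f x).
Proof.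
move=> n_gt0 Qf.
suff Qs s : all (fun p => p %| n)%N s ->
    realized (fun x : Zmod n => (all (fun p => ~~ (p %| x))%N s)%:R * f x).
  have /Qs : all (fun p => p %| n)%N (primes n).
    by apply/allP => p; rewrite mem_primes => /and3P [].
  by apply: realized_ext => x; rewrite coprime_primes.
elim: s => [_|p s IH /= /andP [pn sn]].
  by apply: realized_ext Qf => x; rewrite mul1r.
have Qs := IH sn; have := realized_lin (-1) (realized_dvd n_gt0 pn Qs) Qs.
apply: realized_ext => x; case: (p %| x)%N => /=; first by rewrite mul1r mulN1r addNr mul0r.
by rewrite mul0r mulr0 add0r.
Qed.

(** As a is a pi-number, the linear characters of Z/a have values in A, so twisting by them is
    available and Fourier inversion yields the indicator of the class of 1. *)
Lemma realized_residue n a (f : Zmod n -> C) : (0 < n)%N -> (a %| n)%N -> pi.-nat a ->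
  realized f -> realized (fun x : Zmod n => (x == 1%N %[mod a])%:R * f x).
Proof.
move=> n_gt0 an a_pi Qf; have a_gt0 : (0 < a)%N := dvdn_gt0 n_gt0 an.
have [w w_pr] := C_prim a_gt0; have wa := prim_expr_order w_pr.
have wX k : `[< in_mu_pi pi (w ^+ k) >].
  by apply/asboolP; apply: (mu_pi_root a_pi); rewrite -exprM mulnC exprM wa expr1n.
pose l (j : nat) (x : Zmod n) : A := 
  exist (fun z => is_true `[< in_mu_pi pi z >]) _ (wX (j * x)%N).
have lM j : {morph l j : x y / (x * y)%g}.
  move=> x y; apply: val_inj.
  transitivity (w ^+ (j * nat_of_ord (x * y)%g)) => //.
  transitivity (w ^+ (j * x) * w ^+ (j * y)) => //.
  rewrite -exprD -mulnDr -(expr_mod _ wa) -[RHS](expr_mod _ wa); congr (w ^+ _).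
  by rewrite -modnMmr -[in RHS]modnMmr ZmodM // modn_dvdm.
have Ql (j : 'I_a) := realized_res (h := id) (fun _ _ => erefl) (lM j) Qf.
(* The exponent [a.-1] stands for -1: these are the Fourier coefficients of the indicator of 1. *)
have := realized_scale a%:R^-1 (realized_sum (fun j : 'I_a => w ^+ (j * a.-1)) Ql).
apply: realized_ext => x; have a_neq0 : a%:R != 0 :> C by rewrite prim_natr_eq0 // -lt0n.
transitivity (a%:R^-1 * ((\sum_(j < a) (w ^+ (x + a.-1)) ^+ j) * f x)).
  congr (_ * _); rewrite mulr_suml; apply: eq_bigr => j _; rewrite /= mulrA -exprD -exprM.
  by rewrite -mulnDr addnC mulnC.
rewrite (sum_prim_root _ w_pr).
have -> : (a %| x + a.-1)%N = (x == 1%N %[mod a]).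
  by rewrite -[RHS](eqn_modDr a.-1) add1n (prednK a_gt0) modnn.
by rewrite mulrAC mulrC mulfK.
Qed.

Lemma realized_deflation n d (f : Zmod n -> C) : (0 < n)%N -> (0 < d)%N -> (d %| n)%N ->
  realized f -> realized (fun y : Zmod d => \sum_(x : Zmod n | x == y %[mod d]) f x).
Proof.
move=> n_gt0 d_gt0 dn Qf.
have hM := zexpM n_gt0 (Zp1_expn_dvd d_gt0 dn).
have := realized_ind_Zmod d_gt0 hM Qf; apply: realized_ext => y; apply: eq_bigl => x.
by rewrite -val_eqE [X in X == _]zexp_Zp1 // [in RHS](modn_small (Zmod_lt d_gt0 y)).
Qed.

(** A class function f is the average over G of the functions obtained by inducing, for each x, f(x)
    times the indicator of the generator along Z/#[x] -> G, since y has exactly one preimage x under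
    conjugation by a given z. *)
Lemma realized_delta (G : finGroupType) (f : G -> C) :
    (forall n, (0 < n)%N -> realized (fun x : Zmod n => (x == Zp1)%:R)) ->
    (forall x y, f (x ^ y)%g = f x) ->
  realized f.
Proof.
move=> Qd fJ.
have hM (x : G) : {morph @zexp #[x]%g G x : y z / (y * z)%g}.
  by apply: zexpM; [exact: order_gt0 | exact: expg_order].
have := realized_scale #|G|%:R^-1
  (realized_sum f (fun x : G => realized_ind (hM x) (Qd _ (order_gt0 x)))).
apply: realized_ext => y.
transitivity (#|G|%:R^-1 * \sum_(z : G) f y).
  congr (_ * _); under eq_bigr => x _.
    rewrite (bigD1 Zp1) //= [X in _ + X]big1 => [|j /negPf ne]; last first.
      by rewrite big1 // => z _; rewrite ne mulr0.
    rewrite eqxx addr0 mulr_sumr; over.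
  rewrite exchange_big; apply: eq_bigr => z _ /=.
  rewrite (bigD1 (y ^ z)%g) //= big1 => [|x ne]; rewrite zexp1 ?order_gt0 ?expg_order // mulr1.
    by rewrite conjgE mulKVg eqxx mulr1 addr0 -conjgE fJ.
  case: eqP => [e|]; last by rewrite mulr0.
  by case/eqP: ne; rewrite conjgE e mulKg.
rewrite sumr_const -[X in _ * X]mulr_natl [LHS]mulrA mulVf ?mul1r // prim_natr_eq0 //.
by rewrite -lt0n cardT_gt0.
Qed.

End Operations.
End Realizable.

(** * The eigenfunctions on Z/m *)

Section Eigenvectors.
Variables (C : fieldType) (pi : nat_pred).
Hypothesis C_prim : forall n, (0 < n)%N -> exists z : C, n.-primitive_root z.
Notation A := (mu_pi C pi).
Notation iota := (mu_embedding C pi).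
Notation F := (functor_CR iota).

Lemma all_subfunctor : @subfunctor A C F (fun _ _ => True).
Proof. by []. Qed.

(** [realized_delta] is applied to the whole functor; on Z/n the indicator of the generator is a
    Fourier sum of linear characters. *)
Lemma ch_surj (G : finGroupType) (f : G -> C) :
  (forall x y, f (x ^ y)%g = f x) -> exists u : CR C G, ch u =1 f.
Proof.
move=> fJ; suff [u _ uf] : realized (fun _ _ => True) f by exists u.
apply: (realized_delta C_prim all_subfunctor) fJ => n n_gt0.
have [w w_pr] := C_prim n_gt0; have wn := prim_expr_order w_pr.
have Q (j : 'I_n) : realized (fun _ _ => True) (fun x : Zmod n => w ^+ (j * x)).
  have Mr : mx_repr [set: Zmod n]%G (fun x : Zmod n => (w ^+ (j * x))%:M : 'M[C]_1).
    split=> [|x y _ _]; first by rewrite muln0 expr0.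
    rewrite -scalar_mxM -exprD -mulnDr ZmodM // -(expr_mod _ wn) modnMmr expr_mod //.
  exists (rcls (Representation (MxRepresentation Mr))) => // x.
  by rewrite chE /= mxtrace_scalar.
have := realized_scale all_subfunctor n%:R^-1
  (realized_sum all_subfunctor (fun j : 'I_n => w ^+ (j * n.-1)) Q).
apply: realized_ext => x.
have n_neq0 : n%:R != 0 :> C by rewrite prim_natr_eq0 // -lt0n.
rewrite (eq_bigr (fun j : 'I_n => (w ^+ (x + n.-1)) ^+ j)) => [|j _]; last first.
  by rewrite -exprD -exprM -mulnDr addnC mulnC.
rewrite (sum_prim_root _ w_pr) mulrC mulfK //; congr (_%:R).
have -> : (n %| x + n.-1)%N = (x == 1%N %[mod n]).
  by rewrite -[RHS](eqn_modDr n.-1) (_ : (1 + n.-1 = n)%N) ?modnn // add1n prednK.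
by rewrite (modn_small (Zmod_lt n_gt0 x)) -Zp1_val.
Qed.

Section Vector.
Variables (m : nat) (zeta : {ffun AutZ m -> C}).

(** The values are inverses of those of zeta so that Iso^s multiplies the function by [zeta s]. *)
Definition evec_fun (x : Zmod m) : C :=
  if [pick s : AutZ m | AutZ_unit s == x %[mod m]] is Some s then (zeta s)^-1 else 0.

Lemma evec_funJ x y : evec_fun (x ^ y)%g = evec_fun x.
Proof. by rewrite conjgE (Zp_mulgC x y) mulKg. Qed.

Definition evec : CR C (Zmod m) := sval (cid (ch_surj evec_funJ)).

Lemma ch_evec x : ch evec x = evec_fun x.
Proof. by rewrite /evec; case: cid. Qed.

Hypothesis m_gt0 : (0 < m)%N.

Lemma ch_evec_unit (x : Zmod m) (s : AutZ m) : AutZ_unit s = x %[mod m] -> ch evec x = (zeta s)^-1.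
Proof.
rewrite ch_evec /evec_fun => sx; case: pickP => [t /eqP tx|/(_ s)]; last by rewrite sx eqxx.
by rewrite (AutZ_eq m_gt0 (etrans tx (esym sx))).
Qed.

Lemma ch_evec0 (x : Zmod m) : ~~ coprime x m -> ch evec x = 0.
Proof.
move=> xm; rewrite ch_evec /evec_fun; case: pickP => // s /eqP sx.
by rewrite -(coprime_mod sx) AutZ_unit_coprime in xm.
Qed.

Hypothesis zetaL : lin_char zeta.

Lemma lin_char_neq0 s : zeta s != 0.
Proof.
have [z1 zM] := zetaL; apply/eqP => zs; have /eqP := zM s s^-1%g.
by rewrite mulgV z1 zs mul0r oner_eq0.
Qed.

Hypothesis m_pi : pi^'.-nat m.

Lemma part_pi'_nat n : pi^'.-nat n -> (n`_pi)%N = 1%N.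
Proof. by move=> n_pi; apply: part_p'nat. Qed.

Lemma evec_eigen : eigen pi zeta evec.
Proof.
move=> s k x ks; rewrite card_Zmod // => km _.
have [xm|nxm] := boolP (coprime x m); last first.
  rewrite !ch_evec0 ?mulr0 //; apply: contra nxm.
  by rewrite ZmodX // (coprime_modl _ m) coprimeMl => /andP [].
have [t tx] := AutZ_lift m_gt0 xm.
have ts : AutZ_unit (t * s)%g = nat_of_ord (x ^+ k)%g %[mod m].
  by rewrite AutZ_unitM // ZmodX // modn_mod -modnMm tx -ks modnMm.
have [_ zM] := zetaL.
rewrite (ch_evec_unit tx) (ch_evec_unit ts) zM invfM mulrCA mulfV ?mulr1 //.
exact: lin_char_neq0.
Qed.

Hypothesis zetaP : primitive zeta.

(** An exponent congruent to 1 modulo the order of x fixes the nonzero value at x, so zeta is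
    trivial on the corresponding s, and primitivity applies. *)
Lemma eigen_order (G : finGroupType) (u : CR C G) x :
  eigen pi zeta u -> ch u x <> 0 -> (m %| #[x]%g)%N.
Proof.
move=> uE ux; apply: (primitive_residue m_gt0 (order_gt0 x) (cardT_gt0 G) m_pi zetaP).
move=> s k ks k1 kG kpi; have := uE s k x ks kG kpi.
rewrite -(expg_mod _ (expg_order x)) k1 expg_mod ?expg_order // expg1.
by move/eqP; rewrite -subr_eq0 -[X in _ - X]mul1r -mulrBl mulf_eq0 subr_eq0 => /orP [/eqP|/eqP].
Qed.

Lemma eigen_small (G : finGroupType) (u : CR C G) :
  eigen pi zeta u -> (#|G| < m)%N -> u = 0.
Proof.
move=> uE Gm; apply: (ch_inj C_prim) => x; rewrite ch0; apply: contrapT => ux.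
have mx := dvdn_leq (order_gt0 x) (eigen_order uE ux).
have xG : (#[x]%g <= #|G|)%N.
  by rewrite dvdn_leq ?cardT_gt0 // order_dvdn expg_cardT.
by have := leq_trans Gm (leq_trans mx xG); rewrite ltnn.
Qed.

(** Multiplicity one at Z/m: by [eigen_order] u vanishes off the generators, and these are permuted
    transitively by the power maps. *)
Lemma eigen_evec (u : CR C (Zmod m)) : eigen pi zeta u -> u = ch u Zp1 *: evec.
Proof.
move=> uE; apply: (ch_inj C_prim) => x; rewrite chZ.
have [xm|nxm] := boolP (coprime x m); last first.
  rewrite ch_evec0 // mulr0; apply: contrapT => ux; case/negP: nxm.
  rewrite -Zmod_orderP // eqn_dvd (eigen_order uE ux) andbT.
  by rewrite order_dvdn Zmod_expn.
have [s sx] := AutZ_lift m_gt0 xm; rewrite (ch_evec_unit sx).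
have {1}-> : x = ((Zp1 : Zmod m) ^+ AutZ_unit s)%g.
  by rewrite (Zmod_expP m_gt0 Zp1 sx) -Zmod_gen.
have /(_ s (AutZ_unit s) Zp1 erefl) := uE.
rewrite card_Zmod // AutZ_unit_coprime // part_pi'_nat // !modn1 => /(_ isT erefl) <-.
by rewrite mulrAC mulfV ?lin_char_neq0 // mul1r.
Qed.
End Vector.
End Eigenvectors.

(** * Nonzero subfunctors of an eigenspace, and generation of the whole functor *)

Section Generation.
Variables (C : fieldType) (pi : nat_pred).
Hypothesis C_prim : forall n, (0 < n)%N -> exists z : C, n.-primitive_root z.
Notation A := (mu_pi C pi).
Notation iota := (mu_embedding C pi).
Notation F := (functor_CR iota).

Lemma eqn_mod_partn n x y : (0 < n)%N ->
  (x == y %[mod n]) = (x == y %[mod n`_pi]) && (x == y %[mod n`_pi^']).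
Proof.
by move=> n_gt0; rewrite -[in LHS](partnC pi n_gt0) chinese_remainder ?coprime_partC.
Qed.

Lemma Zp1_eqE n (n_gt0 : (0 < n)%N) (x : Zmod n) : (x == Zp1) = (x == 1%N %[mod n]).
Proof. by rewrite (modn_small (Zmod_lt n_gt0 x)) -Zp1_val. Qed.

Lemma Zmod1_mod n d (n_gt0 : (0 < n)%N) : (d %| n)%N -> (Zp1 : Zmod n) = 1%N %[mod d].
Proof. by move=> dn; rewrite Zp1_val // modn_dvdm. Qed.

Section Core.
Variables (m : nat) (zeta : {ffun AutZ m -> C}).
Hypotheses (m_gt0 : (0 < m)%N) (m_pi : pi^'.-nat m) (zetaP : primitive zeta).
Variable P : forall G : finGroupType, CR C G -> Prop.
Hypotheses (Psub : @subfunctor A C F P)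
  (P_eigen : forall (G : finGroupType) (u : CR C G), P u -> eigen pi zeta u).

(* Restricting to a cyclic group generated by a point where u does not vanish,
   cutting down to the generators with a fixed pi-part, and deflating, leads to a
   function f4 on Z/b, b a pi'-number, supported on the generators; the eigenvalue
   condition makes it constant on its support in the fibre of 1 over Z/m, so that
   its deflation f5 to Z/m does not vanish at 1. *)
Lemma eigen_core (G : finGroupType) (u : CR C G) : P u -> u <> 0 -> P (evec pi C_prim zeta).
Proof.
move=> Pu u_neq0; have zetaL := zetaP.1.
have [x ux] : exists x, ch u x <> 0.
  apply: contrapT => h; apply: u_neq0; apply: (ch_inj C_prim) => x; rewrite ch0.
  by apply: contrapT => ux; apply: h; exists x.
set n := #[x]%g; have n_gt0 : (0 < n)%N := order_gt0 x.
set b := (n`_pi^')%N; have b_gt0 : (0 < b)%N := part_gt0 _ _.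
have bn : (b %| n)%N := dvdn_part _ _.
have b_pi : pi^'.-nat b := part_pnat _ _.
have hM := zexpM n_gt0 (expg_order x).
have Q1 : realized P (ch u) by exists u.
pose f2 (j : Zmod n) := (coprime j n)%:R * ch u (zexp x j).
have Q2 : realized P f2 := realized_coprime C_prim Psub n_gt0 (realized_pullback C_prim Psub hM Q1).
pose f3 (j : Zmod n) := (j == 1%N %[mod n`_pi])%:R * f2 j.
have Q3 : realized P f3 :=
  realized_residue C_prim Psub n_gt0 (dvdn_part pi n) (part_pnat pi n) Q2.
pose f4 (y : Zmod b) := \sum_(j : Zmod n | j == y %[mod b]) f3 j.
have Q4 : realized P f4 := realized_deflation C_prim Psub n_gt0 b_gt0 bn Q3.
have f41 : f4 Zp1 = ch u x.
  have Z11 : (Zp1 : Zmod b) = (Zp1 : Zmod n) %[mod b] by rewrite !Zmod1_mod.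
  rewrite /f4 (bigD1 (Zp1 : Zmod n)) /= ?Z11 ?eqxx // big1 => [|j /andP [/eqP jb j1]].
    rewrite addr0 /f3 Zmod1_mod ?dvdn_part // eqxx mul1r /f2 zexp1 ?expg_order //.
    by rewrite (coprime_mod (Zmod1_mod n_gt0 (dvdnn n))) coprime1n mul1r.
  rewrite /f3; case: eqP => [j1'|]; last by rewrite mul0r.
  case/eqP: j1; apply: val_inj.
  have : j = 1%N %[mod n].
    by apply/eqP; rewrite eqn_mod_partn // j1' jb Zmod1_mod // !eqxx.
  by rewrite (modn_small (Zmod_lt n_gt0 j)) => h; rewrite [LHS]h [RHS]Zp1_val.
have f40 (y : Zmod b) : ~~ coprime y b -> f4 y = 0.
  move=> yb; rewrite /f4 big1 // => j /eqP jy; rewrite /f3 /f2.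
  suff /negPf -> : ~~ coprime j n by rewrite mul0r mulr0.
  apply: contra yb => jn; rewrite -(coprime_mod jy).
  exact: coprime_dvdr bn jn.
case: Q4 => u4 Pu4 u4f; have u4E := P_eigen Pu4.
have mb : (m %| b)%N.
  have u41 : ch u4 Zp1 <> 0 by rewrite u4f f41.
  by have := eigen_order m_gt0 m_pi zetaP u4E u41; rewrite (Zmod_order1 b_gt0).
pose f5 (y : Zmod m) := \sum_(j : Zmod b | j == y %[mod m]) f4 j.
have Q5 : realized P f5.
  by apply: (realized_deflation C_prim Psub b_gt0 m_gt0 mb); exists u4.
have f51 : f5 Zp1 <> 0.
  have f4E (j : Zmod b) : j = 1%N %[mod m] -> coprime j b -> f4 j = ch u x.
    move=> j1 jb; rewrite -f41 -!u4f.
    have /(_ 1%g j Zp1) := u4E; rewrite j1 (AutZ_unit1 m_gt0) card_Zmod //.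
    rewrite part_pi'_nat // !modn1 => /(_ erefl jb erefl).
    by rewrite -Zmod_gen // zetaL.1 mul1r.
  have -> : f5 Zp1 = ch u x *+ #|[pred j : Zmod b | (j == 1%N %[mod m]) && coprime j b]|.
    rewrite -sumr_const /f5 big_mkcond [RHS]big_mkcond /=; apply: eq_bigr => j _.
    rewrite Zmod1_mod // inE /=; case: eqP => //= j1.
    by case: ifP => [jb|/negbT jb]; [rewrite f4E | rewrite f40].
  rewrite -mulr_natl; apply/eqP; rewrite mulf_neq0 //; last exact/eqP.
  rewrite prim_natr_eq0 // -lt0n; apply/card_gt0P; exists Zp1.
  rewrite inE /= Zmod1_mod // eqxx /=.
  by rewrite (coprime_mod (Zmod1_mod b_gt0 (dvdnn b))) coprime1n.
case: Q5 => u5 Pu5 u5f; have [P0 PL _] := Psub.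
have u5E := eigen_evec C_prim m_gt0 zetaL m_pi zetaP (P_eigen Pu5).
have -> : evec pi C_prim zeta = (f5 Zp1)^-1 *: u5 + 0.
  rewrite addr0 {1}u5E u5f scalerA mulVf ?scale1r //; exact/eqP.
exact: PL.
Qed.
End Core.

(** It suffices to realize the indicator of the generator on every cyclic group, which is done by
    Fourier analysis on the units modulo b; each Dirichlet character modulo b is inflated from the
    primitive one at its conductor. *)
Lemma evec_generate (P : forall G : finGroupType, CR C G -> Prop) :
    @subfunctor A C F P ->
    (forall i : Upsilon C pi, P (Zmod (ups_m i)) (evec pi C_prim (ups_zeta i))) ->
  forall (G : finGroupType) (u : CR C G), P G u.
Proof.
move=> Psub Pe G u; suff [v Pv vu] : realized P (ch u).
  by rewrite -(ch_inj C_prim vu).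
apply: (realized_delta C_prim Psub); last by move=> x y; rewrite chJ.
move=> n n_gt0 {G u}.
set b := (n`_pi^')%N; have b_gt0 : (0 < b)%N := part_gt0 _ _.
have bn : (b %| n)%N := dvdn_part _ _.
have b_pi : pi^'.-nat b := part_pnat _ _.
(* Reduction to the pi'-part b of n: inflate, then cut out the class of 1 modulo the pi-part. *)
suff Qb : realized P (fun x : Zmod b => (x == Zp1)%:R).
  have hM := zexpM n_gt0 (Zp1_expn_dvd b_gt0 bn).
  have := realized_residue C_prim Psub n_gt0 (dvdn_part pi n) (part_pnat pi n)
    (realized_pullback C_prim Psub hM Qb).
  apply: realized_ext => x; rewrite -natrM mulnb; congr ((nat_of_bool _)%:R).
  rewrite !Zp1_eqE // zexp_Zp1 // modn_mod.
  by rewrite [RHS]eqn_mod_partn.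
have dJ (s t : AutZ b) : ((s ^ t)%g == 1%g)%:R = (s == 1%g)%:R :> C by rewrite conjg_eq1.
have [v vd] := ch_surj pi C_prim dJ.
have [I [c [l [lL vl]]]] := ch_span_linear C_prim v (AutZ_abelian b_gt0).
(* The inverse of s matches the inverse values of [evec]; the indicator of 1 is invariant under
   inversion. *)
pose g i (x : Zmod b) :=
  if [pick s : AutZ b | AutZ_unit s == x %[mod b]] is Some s then l i s^-1%g else 0.
have Qg i : realized P (g i).
  have [l1 lM] := lL i; pose xi := [ffun s => l i s].
  have xiL : lin_char xi by split=> [|s t]; rewrite !ffunE.
  have [d [zeta [db zP xz]]] := conductor b_gt0 xiL.
  have d_gt0 : (0 < d)%N := dvdn_gt0 b_gt0 db.
  have Qe : realized P (ch (evec pi C_prim zeta)).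
    by exists (evec pi C_prim zeta) => //; apply: (Pe (Build_Upsilon (pnat_dvd db b_pi) zP)).
  have hM := zexpM b_gt0 (Zp1_expn_dvd d_gt0 db).
  have := realized_coprime C_prim Psub b_gt0 (realized_pullback C_prim Psub hM Qe).
  apply: realized_ext => x; rewrite /g; case: pickP => [s /eqP sx|nos].
    have [t tx] := AutZ_lift d_gt0 (coprime_dvdr db (AutZ_unit_coprime b_gt0 s)).
    rewrite -(coprime_mod sx) AutZ_unit_coprime // mul1r.
    rewrite (@ch_evec_unit _ _ _ _ _ d_gt0 _ t); last first.
      by rewrite tx zexp_Zp1 // modn_mod (modn_weaken db sx).
    have ls : l i s * l i s^-1%g = 1 by rewrite -lM mulgV.
    have ls0 : l i s != 0.
      by apply/eqP => e; move: ls; rewrite e mul0r => /eqP; rewrite eq_sym oner_eq0.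
    by apply: (mulfI ls0); rewrite ls -(xz s t) // ffunE mulfV.
  case: (boolP (coprime x b)) => [xb|]; last by rewrite mul0r.
  by have [s sx] := AutZ_lift b_gt0 xb; have := nos s; rewrite sx eqxx.
apply: realized_ext (realized_sum Psub c Qg) => x; rewrite /g.
case: pickP => [s /eqP sx|nos].
  rewrite -vl vd invg_eq1; congr ((nat_of_bool _)%:R); rewrite Zp1_eqE // -sx.
  apply/eqP/eqP => [->|s1]; first exact: AutZ_unit1.
  by apply: (AutZ_eq b_gt0); rewrite s1 AutZ_unit1.
rewrite big1 => [|i _]; last by rewrite mulr0.
rewrite Zp1_eqE //; have := nos 1%g; rewrite (AutZ_unit1 b_gt0) eq_sym => -> //.
Qed.
End Generation.

(** * Endomorphisms of a cyclic group *)

Lemma sig_eq (T : Type) (D : T -> Prop) (x y : {x : T | D x}) : sval x = sval y -> x = y.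
Proof.
case: x y => [x hx] [y hy] /= xy; case: y / xy hy => hy.
by congr exist; apply: Prop_irrelevance.
Qed.

Section Subbiset.
Variables (A : abelianGroupType) (G H : finGroupType) (X : fbiset A G H) (D : X -> Prop).
Hypotheses (Dl : forall g x, D x -> D (g \l x)) (Dr : forall x h, D x -> D (x \r h))
  (Da : forall a x, D x -> D (a \f x)).

Lemma fb_sub_subproof : exists (I : finType) (r : I -> {x : X | D x}),
  forall x, exists a i, x = exist _ (a \f sval (r i)) (Da a (svalP (r i))).
Proof.
have [I [r hr]] := fact_fin (fb_on X).
pose J := {i : I | `[< D (r i) >]}.
exists J, (fun j : J => exist _ (r (val j)) (asboolW (valP j))) => -[x Dx].
have [a [i e]] := hr x.
have Di : `[< D (r i) >].
  by apply/asboolP; rewrite -[r i](fact1 (fb_on X)) -(mulVg a) factM -e; apply: Da.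
by exists a, (exist _ i Di); apply: sig_eq.
Qed.

Definition fb_sub : fbiset A G H.
Proof.
refine (@FBiset A G H {x : X | D x} (@FBisetOn A G H _
  (fun g x => exist _ (g \l sval x) (Dl g (svalP x)))
  (fun x h => exist _ (sval x \r h) (Dr h (svalP x)))
  (fun a x => exist _ (a \f sval x) (Da a (svalP x)))
  _ _ _ _ _ _ _ _ _ _ fb_sub_subproof)).
- by move=> x; apply: sig_eq; rewrite /= lact1.
- by move=> g g' x; apply: sig_eq; rewrite /= lactM.
- by move=> x; apply: sig_eq; rewrite /= ract1.
- by move=> x h h'; apply: sig_eq; rewrite /= ractM.
- by move=> x; apply: sig_eq; rewrite /= fact1.
- by move=> a b x; apply: sig_eq; rewrite /= factM.
- by move=> g x h; apply: sig_eq; rewrite /= lract.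
- by move=> g a x; apply: sig_eq; rewrite /= lfact.
- by move=> a x h; apply: sig_eq; rewrite /= rfact.
- by move=> a x /(congr1 sval); apply: fact_free.
Defined.
End Subbiset.

(** * Factoring bisets through quotients and subgroups *)

Section Factorizations.
Variable A : abelianGroupType.

Definition trivM (G : finGroupType) :
  {morph (fun _ : G => 1%g : A) : x y / (x * y)%g} := fun _ _ => esym (mulg1 _).

Lemma fb_sub_split (G H : finGroupType) (X : fbiset A G H) (D : X -> Prop)
    (Dl : forall g x, D x -> D (g \l x)) (Dr : forall x h, D x -> D (x \r h))
    (Da : forall a x, D x -> D (a \f x))
    (Dl' : forall g x, ~ D x -> ~ D (g \l x)) (Dr' : forall x h, ~ D x -> ~ D (x \r h))
    (Da' : forall a x, ~ D x -> ~ D (a \f x)) :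
  fb_iso (fb_sum (fb_sub Dl Dr Da) (fb_sub Dl' Dr' Da')) X.
Proof.
exists (fun z => match z with inl x => sval x | inr x => sval x end).
split; [|by move=> g []|by move=> [] |by move=> a []].
apply: bij_of => [[[x hx]|[x hx]] [[y hy]|[y hy]] //= xy|x].
- by congr inl; apply: sig_eq.
- by case: hy; rewrite -xy.
- by case: hx; rewrite xy.
- by congr inr; apply: sig_eq.
by have [Dx|nDx] := pselect (D x); [exists (inl (exist _ x Dx)) | exists (inr (exist _ x nDx))].
Qed.

Section RightKernel.
Variables (G H : finGroupType) (X : fbiset A G H) (N : {group H}).
Hypotheses (nN : ([set: H] \subset 'N(N))%g) (triv : forall (x : X) h, h \in N -> x \r h = x).

Lemma mem_normT h : (h \in 'N(N))%g.
Proof. by apply: (subsetP nN); rewrite inE. Qed.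

Lemma coset_setM : {morph coset N : x y / (x * y)%g}.
Proof. by move=> x y; rewrite morphM ?mem_normT. Qed.

Lemma ract_coset (x : X) h k : coset N h = coset N k -> x \r h = x \r k.
Proof.
move=> hk; have /rcosetP [n Nn ->] : h \in (N :* k)%g.
  by rewrite -(val_coset (mem_normT k)) -hk (val_coset (mem_normT h)) rcoset_refl.
by rewrite ractM (triv x Nn).
Qed.

Definition fb_coset : fbiset A G (coset_of N).
Proof.
refine (@FBiset A G (coset_of N) X (@FBisetOn A G (coset_of N) X
  (fun g x => g \l x) (fun x c => x \r fingroup.repr c) (fun a x => a \f x)
  _ _ _ _ _ _ _ _ _ _ (fact_fin (fb_on X)))).
- by move=> x; rewrite lact1.
- by move=> g g' x; rewrite lactM.
- by move=> x; rewrite repr_coset1 ract1.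
- move=> x c c'; rewrite -ractM; apply: ract_coset.
  by rewrite coset_setM !coset_reprK.
- by move=> x; rewrite fact1.
- by move=> a b x; rewrite factM.
- by move=> g x h; rewrite lract.
- by move=> g a x; rewrite lfact.
- by move=> a x h; rewrite rfact.
- by move=> a x; apply: fact_free.
Defined.

(** A nontrivial normal subgroup acting trivially on the right thus makes X factor through a smaller
    group. *)
Lemma fb_coset_tens : fb_iso (fb_tens fb_coset (fb_ind A coset_setM)) X.
Proof.
apply: fb_iso_trans (fb_tens_ind coset_setM fb_coset) _; exists id; split=> //.
  by exists id.
by move=> x h; apply: ract_coset; rewrite coset_reprK.
Qed.
End RightKernel.

Section LeftInduction.
Variables (G K : finGroupType) (X : fbiset A G K) (x0 : X).
Hypothesis gen : forall x : X, exists a g k, x = a \f ((g \l x0) \r k).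

Let S : {set G} := [set g | `[< exists a k, g \l x0 = a \f (x0 \r k) >]].

Let SP g : reflect (exists a k, g \l x0 = a \f (x0 \r k)) (g \in S).
Proof. by rewrite inE; apply: asboolP. Qed.

(** This is the projection to G of the stabilizer of [x0] under the three actions. *)
Lemma right_orbit_group_set : group_set S.
Proof.
apply/group_setP; split=> [|g g' /SP [a [k e]] /SP [b [l e']]].
  by apply/SP; exists 1%g, 1%g; rewrite lact1 ract1 fact1.
apply/SP; exists (b * a)%g, (k * l)%g.
by rewrite lactM e' lfact lract e rfact ractM -factM.
Qed.

Let D : {group G} := Group right_orbit_group_set.

Lemma sgval_morph : {morph (sgval : subg_of D -> G) : x y / (x * y)%g}.
Proof. by []. Qed.

Let XD := fb_lpull sgval_morph (@trivM _) X.
Let O (x : XD) := exists a k, x = a \f (x0 \r k).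

Let Ol g (x : XD) : O x -> O (g \l x).
Proof.
case=> a [k ->]; have /SP [b [l e]] := subgP g; exists (a * b)%g, (l * k)%g.
rewrite -[LHS]/(1%g \f (sgval g \l (a \f (x0 \r k)))) fact1.
by rewrite lfact lract e rfact -ractM -factM.
Qed.

Let Or (x : XD) h : O x -> O (x \r h).
Proof.
case=> a [k ->]; exists a, (k * h)%g.
by rewrite -[LHS]/((a \f (x0 \r k)) \r h) rfact ractM.
Qed.

Let Oa b (x : XD) : O x -> O (b \f x).
Proof. by case=> a [k ->]; exists (b * a)%g, k; rewrite factM. Qed.

Let X0 : fbiset A (subg_of D) K := fb_sub Ol Or Oa.

(** A transitive biset is induced from the orbit of [x0] under A and K, on which only the subgroup
    [D] acts from the left. *)
Lemma fb_ind_tens : fb_iso (fb_tens (fb_ind A sgval_morph) X0) X.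
Proof.
pose F := @tq_lift A G _ K (fb_ind A sgval_morph) X0 _
  (fun p => p.1.1 \f (p.1.2 \l (sval p.2 : X)) : X).
have FE (x : A * G) (y : X0) :
    F (@tq _ _ _ _ (fb_ind A sgval_morph) X0 x y) = x.1 \f (x.2 \l (sval y : X)).
  apply: tq_liftE => -[a g] b h z /=.
  by rewrite lactM fact1 lfact -factM abmulgC.
apply: (@fb_tens_isoF _ _ _ _ _ _ _ F).
- apply: bij_of => [|x].
    elim/tq_ind=> -[a g] y; elim/tq_ind=> -[a' g'] y'; rewrite !FE /= => e.
    have e1 : (g^-1 * g')%g \l (sval y' : X) = (a'^-1 * a)%g \f (sval y : X).
      have e2 : g' \l (sval y' : X) = (a'^-1 * a)%g \f (g \l (sval y : X)).
        by rewrite factM e -factM mulVg fact1.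
      by rewrite lactM e2 lfact -lactM mulVg lact1.
    have dS : (g^-1 * g')%g \in D.
      apply/SP; case: (svalP y) => b [k ey]; case: (svalP y') => b' [k' ey'].
      exists (b'^-1 * (a'^-1 * a * b))%g, (k * k'^-1)%g.
      move: e1; rewrite ey ey' lfact lract => e1.
      rewrite factM ractM -2!rfact (factM _ _ b) -e1 -!rfact -factM mulVg fact1.
      by rewrite -ractM mulgV ract1.
    have -> : @tq _ _ _ _ (fb_ind A sgval_morph) X0 (a', g') y' =
        @tq _ _ _ _ (fb_ind A sgval_morph) X0 (a', g) (Subg dS \l y').
      by rewrite -tqH /= mulKVg.
    have -> : Subg dS \l y' = (a'^-1 * a)%g \f y.
      apply: sig_eq; rewrite -[LHS]/(1%g \f ((g^-1 * g')%g \l (sval y' : X))) fact1.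
      exact: e1.
    by rewrite -tqA /= abmulgC mulgA mulgV mul1g.
  have [a [g [k ->]]] := gen x.
  have Oy : O (x0 \r k) by exists 1%g, k; rewrite fact1.
  exists (@tq _ _ _ _ (fb_ind A sgval_morph) X0 (a, g) (exist _ _ Oy)).
  by rewrite FE /= lract.
- by move=> h [a g] y; rewrite !FE /= lactM lfact.
- by move=> [a g] y k; rewrite !FE /= rfact lract.
- by move=> b [a g] y; rewrite !FE /= factM.
Qed.
End LeftInduction.
End Factorizations.

Lemma fmap0r (A : abelianGroupType) (C : fieldType) (T : fbfunctor A C)
  (H K : finGroupType) (phi : Chom A C H K) : fmap phi (0 : T H) = 0.
Proof. exact: (linear_0 (@fmap_linearr _ _ T H K phi)). Qed.

Lemma fmap0l (A : abelianGroupType) (C : fieldType) (T : fbfunctor A C)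
  (H K : finGroupType) (t : T H) : fmap (0 : Chom A C H K) t = 0.
Proof. exact: (linear_0 (@fmap_linearl _ _ T H K t)). Qed.

(** * Endomorphisms of Z/m act on minimal vectors by scalars *)

Section Endomorphisms.
Variables (C : fieldType) (pi : nat_pred) (m : nat) (zeta : {ffun AutZ m -> C}).
Hypotheses (m_gt0 : (0 < m)%N) (m_pi : pi^'.-nat m).
Notation A := (mu_pi C pi).
Notation G := (Zmod m).

Definition essential_vector (T : fbfunctor A C) (t : T G) : Prop :=
  (forall (H : finGroupType) (phi : Chom A C G H), (#|H| < m)%N -> fmap phi t = 0) /\
  (forall s : AutZ m, fmap (bcls C (fb_aut A s)) t = zeta s *: t).

(** The scalar is chosen before the functor and the vector, which permits comparing two different
    functors. *)
Definition scalar_on_essential (phi : Chom A C G G) : Prop :=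
  exists c : C, forall (T : fbfunctor A C) (t : T G),
    essential_vector t -> fmap phi t = c *: t.

Lemma scalar_lin c phi psi :
  scalar_on_essential phi -> scalar_on_essential psi -> scalar_on_essential (c *: phi + psi).
Proof.
move=> [a ha] [b hb]; exists (c * a + b) => T t te.
by rewrite fmap_linearl (ha T t te) (hb T t te) scalerDl scalerA.
Qed.

Lemma scalar0 : scalar_on_essential 0.
Proof. by exists 0 => T t _; rewrite fmap0l scale0r. Qed.

Lemma scalar_factor (H : finGroupType) (X : fbiset A G G) (Y : fbiset A G H)
    (Z : fbiset A H G) : (#|H| < m)%N -> fb_iso (fb_tens Y Z) X ->
  scalar_on_essential (bcls C X).
Proof.
move=> Hm YZ; exists 0 => T t [t_small _].
by rewrite -(bcls_iso C YZ) -CcompE fmap_comp t_small // fmap0r scale0r.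
Qed.

Section Transitive.
Variables (X : fbiset A G G) (x0 : X).
Hypothesis gen : forall x : X, exists a g k, x = a \f ((g \l x0) \r k).

(** The order of a divides the pi-part of m ^ 2, which is 1. *)
Lemma stabilizer_fibre (x : X) g h (a : A) : (g \l x) \r h^-1%g = a \f x -> a = 1%g.
Proof.
move=> /fb_eigen_torsion; rewrite part_pi'_nat ?expr1 => [e|].
  exact: val_inj.
by rewrite !card_Zmod // pnatM m_pi.
Qed.

(** A Goursat-type case analysis: X factors through a proper subgroup or a proper quotient, and the
    scalar is 0, unless it is the biset of an automorphism. *)
Lemma scalar_transitive : scalar_on_essential (bcls C X).
Proof.
pose D := Group (right_orbit_group_set x0).
have [DT|nDT] := eqVneq (D : {set G}) [set: G]; last first.
  apply: (scalar_factor _ (fb_ind_tens gen)).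
  rewrite card_sub -[X in (_ < X)%N](card_Zmod m_gt0) -cardsT.
  by apply: proper_card; rewrite properT.
have left_right g : exists k, g \l x0 = x0 \r k.
  have : g \in (D : {set G}) by rewrite DT inE.
  rewrite inE => /asboolP [a [k e]]; exists k; rewrite e (_ : a = 1%g) ?fact1 //.
  by apply: (@stabilizer_fibre x0 g k); rewrite e rfact -ractM mulgV ract1.
have genr (x : X) : exists a k, x = a \f (x0 \r k).
  have [a [g [k ->]]] := gen x; have [l ->] := left_right g.
  by exists a, (l * k)%g; rewrite ractM.
have [[h [h1 [a ha]]]|rfree] := pselect (exists h : G, h <> 1%g /\ exists a, x0 \r h = a \f x0).
  have a1 : a = 1%g.
    by apply: (@stabilizer_fibre x0 1%g h^-1%g); rewrite invgK lact1.
  have nN : ([set: G] \subset 'N(<[h]>))%g.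
    by apply: sub_abelian_norm; rewrite ?subsetT //; apply/centsP => y _ z _; apply: Zp_mulgC.
  have triv (x : X) k : (k \in <[h]>)%g -> x \r k = x.
    case/cycleP => j ->; elim: j => [|j IH]; first by rewrite expg0 ract1.
    rewrite expgSr ractM IH; have [b [l ->]] := genr x.
    by rewrite rfact -ractM (Zp_mulgC l h) ractM ha a1 fact1.
  apply: (scalar_factor _ (fb_coset_tens nN triv)).
  rewrite -[#|_|]cardsT -quotientT -[X in (_ < X)%N](card_Zmod m_gt0) -cardsT.
  rewrite ltn_quotient ?subsetT //.
  by rewrite cycle_eq1; apply/eqP.
have rinj k l (a : A) : x0 \r k = a \f (x0 \r l) -> k = l.
  move=> e; apply: (mulIg l^-1%g); rewrite mulgV; apply: contrapT => ne; apply: rfree.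
  by exists (k * l^-1)%g; split=> //; exists a; rewrite ractM e rfact -ractM mulgV ract1.
(* With the right action free on A-orbits, moving the left action across [x0] defines a
   homomorphism, and X is restriction along it. *)
have /choice [tau tauE] := left_right.
have tauM : {morph tau : x y / (x * y)%g}.
  move=> g h; apply: (rinj _ _ 1%g); rewrite fact1 -tauE lactM tauE lract tauE.
  by rewrite ractM.
have X_res : fb_iso (fb_res tauM (@trivM A _)) X.
  exists (fun x : A * G => x.1 \f (x0 \r x.2)); split.
  - apply: bij_of => [[a k] [b l] /= e|x]; last first.
      by have [a [k ->]] := genr x; exists (a, k).
    have kl : k = l.
      by apply: (rinj _ _ (a^-1 * b)%g); rewrite factM -e -factM mulVg fact1.
    by case: l / kl e => /fact_inj ->.
  - by move=> g [a k]; rewrite /= mul1g lfact lract tauE ractM.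
  - by move=> [a k] l; rewrite /= rfact ractM.
  - by move=> b [a k]; rewrite /= factM.
have [tauI|ntauI] := pselect (injective tau); last first.
  have S_group : group_set [set tau g | g : G].
    apply/group_setP; split=> [|_ _ /imsetP [g _ ->] /imsetP [h _ ->]].
      by apply/imsetP; exists 1%g; rewrite ?inE // (morph1 tauM).
    by rewrite -tauM imset_f ?inE.
  pose S := Group S_group.
  have tauS g : tau g \in S by rewrite imset_f ?inE.
  pose tau1 g : subg_of S := Subg (tauS g).
  have tau1M : {morph tau1 : x y / (x * y)%g} by move=> g h; apply: val_inj; apply: tauM.
  have sM : {morph (sgval : subg_of S -> G) : x y / (x * y)%g} by [].
  apply: (@scalar_factor _ X (fb_res tau1M (@trivM A _)) (fb_res sM (@trivM A _))).
    rewrite card_sub -[X in (_ < X)%N](card_Zmod m_gt0).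
    have -> : #|[pred x | x \in S]| = #|[set tau g | g : G]| by apply: eq_card.
    rewrite ltn_neqAle leq_imset_card andbT; apply: contra_notN ntauI => /imset_injP h g g' e.
    by apply: h; rewrite ?inE.
  apply: fb_iso_trans (fb_tens_res _ _ _) _; apply: fb_iso_trans _ X_res.
  by exists id; split=> //; [exists id | move=> g [a k]; rewrite /= !mul1g].
have tauX (x : G) k : tau (x ^+ k)%g = (tau x ^+ k)%g.
  by elim: k => [|k IH]; rewrite ?expg0 ?(morph1 tauM) // !expgS tauM IH.
have t1 : coprime (tau Zp1) m.
  rewrite -Zmod_orderP // eqn_dvd order_dvdn Zmod_expn // eqxx -{1}(Zmod_order1 m_gt0).
  rewrite order_dvdn; apply/eqP; apply: tauI.
  by rewrite tauX expg_order (morph1 tauM).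
have [s sE] := AutZ_lift m_gt0 t1.
have stau x : sgval s x = tau x.
  rewrite AutZE // (Zmod_expP m_gt0 x sE) [in RHS](Zmod_gen m_gt0 x) tauX.
  by rewrite [in LHS](Zmod_gen m_gt0 x) [X in _ = (X ^+ _)%g](Zmod_gen m_gt0) -!expgM mulnC.
(* A left action through tau amounts to a right action through its inverse, hence the inverse of
   s. *)
exists (zeta s^-1%g) => T t [_ t_aut]; rewrite -t_aut; congr (fmap _ t); apply: bcls_iso.
apply: fb_iso_sym; apply: fb_iso_trans _ X_res.
exists (fun x : A * G => (x.1, tau x.2)); split.
- exists (fun x : A * G => (x.1, sgval s^-1%g x.2)) => -[a g] /=; congr pair.
    by rewrite -stau /= permK.
  by rewrite -stau /= permKV.
- by move=> g [a h]; rewrite /= mul1g tauM.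
- by move=> [a g] h; rewrite /= tauM -[X in (_ * X)%g]stau /= permKV.
- by move=> b [a g].
Qed.
End Transitive.

(** Induction on the number of representatives, splitting off one transitive component at a time. *)
Lemma scalar_bcls (X : fbiset A G G) : scalar_on_essential (bcls C X).
Proof.
have [I [r rS]] := fact_fin (fb_on X).
have [n le_n] := ubnP #|I|; elim: n => // n IH in I X r rS le_n *.
have [i0 _|noI] := pickP I; last first.
  have noX (x : X) : False by have [_ [i _]] := rS x; have := noI i.
  (* The empty biset is isomorphic to its sum with itself, so its class is 0. *)
  suff -> : bcls C X = 0 by exact: scalar0.
  apply: (addrI (bcls C X)); rewrite addr0 -bcls_sum; apply: bcls_iso.
  exists (fun z : X + X => match z with inl x => x | inr x => x end); split.
  - by exists inl => [[x|x]|x]; case: (noX x).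
  - by move=> g [] x.
  - by move=> [] x.
  - by move=> a [] x.
pose D (x : X) := exists a g k, x = a \f ((g \l r i0) \r k).
have Dl g x : D x -> D (g \l x).
  case=> a [h [k ->]]; exists a, (g * h)%g, k.
  by rewrite lfact lract lactM.
have Dr x l : D x -> D (x \r l).
  by case=> a [h [k ->]]; exists a, h, (k * l)%g; rewrite rfact ractM.
have Da b x : D x -> D (b \f x).
  by case=> a [h [k ->]]; exists (b * a)%g, h, k; rewrite factM.
have Dl' g x : ~ D x -> ~ D (g \l x).
  by move=> nD /(Dl g^-1%g); rewrite -lactM mulVg lact1.
have Dr' x l : ~ D x -> ~ D (x \r l).
  by move=> nD /(Dr _ l^-1%g); rewrite -ractM mulgV ract1.
have Da' b x : ~ D x -> ~ D (b \f x).
  by move=> nD /(Da b^-1%g); rewrite -factM mulVg fact1.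
have D0 : D (r i0) by exists 1%g, 1%g, 1%g; rewrite lact1 ract1 fact1.
rewrite -(bcls_iso C (fb_sub_split Dl Dr Da Dl' Dr' Da')) bcls_sum -[X in X + _]scale1r.
apply: scalar_lin.
  apply: (@scalar_transitive (fb_sub Dl Dr Da) (exist _ _ D0)) => -[x [a [g [k e]]]].
  by exists a, g, k; apply: sig_eq.
pose J := {i : I | `[< ~ D (r i) >]}.
apply: (IH J (fb_sub Dl' Dr' Da') (fun j => exist _ (r (val j)) (asboolW (valP j)))).
  move=> [x nDx]; have [a [i e]] := rS x.
  have Di : `[< ~ D (r i) >] by apply/asboolP => /(Da a); rewrite -e.
  by exists a, (exist _ i Di); apply: sig_eq.
apply: (@leq_trans #|I|); last exact: le_n.
rewrite card_sig -[X in (_ < X)%N]cardsT.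
rewrite -[X in (X < _)%N]cardsE; apply: proper_card; rewrite properT.
by apply/eqP => /setP /(_ i0); rewrite !inE => /asboolP.
Qed.

Lemma endomorphism_scalar (phi : Chom A C G G) : scalar_on_essential phi.
Proof.
move: phi; apply: (@CK0_ind _ _ _ _ scalar_on_essential).
- by move=> X; rewrite -bcls_sk; apply: scalar_bcls.
- exact: scalar0.
- exact: scalar_lin.
Qed.
End Endomorphisms.

(** * Simple functors *)

Section SubfunctorObject.
Variables (A : abelianGroupType) (C : fieldType) (F : fbfunctor A C).
Variable P : forall G : finGroupType, F G -> Prop.
Hypothesis Psub : subfunctor P.

Section Module.
Variable G : finGroupType.

(** The proof that P is a subfunctor is an argument of the type, so that the module structure can be
    attached to it. *)
Definition sub_ob (_ : subfunctor P) : Type := {x : F G | P x}.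
Local Notation V := (sub_ob Psub).

HB.instance Definition _ := gen_eqMixin V.
HB.instance Definition _ := gen_choiceMixin V.

Lemma sub_ob_eq (x y : V) : sval x = sval y -> x = y.
Proof. exact: sig_eq. Qed.

Let PL c (x y : F G) : P x -> P y -> P (c *: x + y).
Proof. by case: Psub => _ h _; apply: h. Qed.

Definition sub0 : V := exist _ 0 (let: And3 h _ _ := Psub in h G).
Definition sub_lin c (x y : V) : V :=
  exist _ (c *: sval x + sval y) (PL c (svalP x) (svalP y)).
Definition sub_add := sub_lin 1.
Definition sub_opp x := sub_lin (-1) x sub0.
Definition sub_scale c x := sub_lin c x sub0.

Lemma sub_addA : associative sub_add.
Proof. by move=> x y z; apply: sub_ob_eq; rewrite /= !scale1r addrA. Qed.
Lemma sub_addC : commutative sub_add.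
Proof. by move=> x y; apply: sub_ob_eq; rewrite /= !scale1r addrC. Qed.
Lemma sub_add0 : left_id sub0 sub_add.
Proof. by move=> x; apply: sub_ob_eq; rewrite /= scaler0 add0r. Qed.
Lemma sub_addN : left_inverse sub0 sub_opp sub_add.
Proof. by move=> x; apply: sub_ob_eq; rewrite /= scale1r addr0 scaleN1r addNr. Qed.

HB.instance Definition _ :=
  GRing.isZmodule.Build V sub_addA sub_addC sub_add0 sub_addN.

Lemma sub_addE (x y : V) : sval (x + y) = sval x + sval y.
Proof. by rewrite /= scale1r. Qed.

Lemma sub_scaleE c (x : V) : sval (sub_scale c x) = c *: sval x.
Proof. by rewrite /= addr0. Qed.

Lemma sub_scaleA a b x : sub_scale a (sub_scale b x) = sub_scale (a * b) x.
Proof. by apply: sub_ob_eq; rewrite !sub_scaleE scalerA. Qed.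
Lemma sub_scale1 : left_id 1 sub_scale.
Proof. by move=> x; apply: sub_ob_eq; rewrite sub_scaleE scale1r. Qed.
Lemma sub_scaleDr : right_distributive sub_scale +%R.
Proof.
by move=> a x y; apply: sub_ob_eq; rewrite sub_addE !sub_scaleE sub_addE scalerDr.
Qed.
Lemma sub_scaleDl x : {morph sub_scale^~ x : a b / a + b}.
Proof. by move=> a b; apply: sub_ob_eq; rewrite sub_addE !sub_scaleE scalerDl. Qed.

HB.instance Definition _ := GRing.Zmodule_isLmodule.Build C V
  sub_scaleA sub_scale1 sub_scaleDr sub_scaleDl.

Lemma sub_linE c (x y : V) : sval (c *: x + y) = c *: sval x + sval y.
Proof. by rewrite sub_addE -sub_scaleE. Qed.
End Module.

Definition sub_fob (G : finGroupType) : lmodType C := sub_ob G Psub.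

Definition sub_fmap (G H : finGroupType) (phi : Chom A C G H) (x : sub_fob G) : sub_fob H :=
  exist _ (fmap phi (sval x)) (let: And3 _ _ h := Psub in h G H phi _ (svalP x)).

Definition sub_functor : fbfunctor A C.
Proof.
refine (@FBFunctor A C sub_fob sub_fmap _ _ _ _).
- move=> G H u c phi psi; apply: sub_ob_eq.
  by rewrite sub_linE; apply: (@fmap_linearl _ _ F).
- move=> G H phi c u v; apply: sub_ob_eq.
  by rewrite sub_linE -[RHS]fmap_linearr -sub_linE.
- by move=> G u; apply: sub_ob_eq; apply: fmap_id.
- by move=> G H K phi psi u; apply: sub_ob_eq; apply: fmap_comp.
Defined.
End SubfunctorObject.

(** * The simple functor generated by an eigenvector *)

Section SimpleConstituents.
Variables (C : fieldType) (pi : nat_pred).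
Hypothesis C_prim : forall n, (0 < n)%N -> exists z : C, n.-primitive_root z.
Notation A := (mu_pi C pi).
Notation iota := (mu_embedding C pi).
Notation F := (functor_CR iota).

Section OneConstituent.
Variables (m : nat) (zeta : {ffun AutZ m -> C}).
Hypotheses (m_gt0 : (0 < m)%N) (m_pi : pi^'.-nat m) (zetaP : primitive zeta).
Local Notation e := (evec pi C_prim zeta).
Let zetaL : lin_char zeta := zetaP.1.

Lemma ch_evec1 : ch e Zp1 = 1.
Proof.
rewrite (@ch_evec_unit _ _ _ _ _ m_gt0 _ 1%g) ?zetaL.1 ?invr1 //.
by rewrite AutZ_unit1 // Zmod1_mod.
Qed.

Lemma evec_neq0 : e <> 0.
Proof. by move=> e0; have /eqP := ch_evec1; rewrite e0 ch0 eq_sym oner_eq0. Qed.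

Lemma evec_essential : @essential_vector C pi m zeta F e.
Proof.
split=> [H phi Hm|s].
  apply: (eigen_small C_prim m_gt0 m_pi zetaP _ Hm).
  by apply: eigen_CR_map => //; apply: evec_eigen.
apply: (ch_inj C_prim) => y; rewrite chZ.
(* Iso^s is induction along the automorphism s, so it sends e to y |-> e(s^-1 y). *)
have -> : bcls C (fb_aut A s) = bcls C (fb_ind A (AutZ_morph s)).
  by apply: bcls_iso; exists id; split=> //; exists id.
rewrite [LHS](ch_ind iota C_prim).
have m_neq0 : #|Zmod m|%:R != 0 :> C by rewrite card_Zmod // prim_natr_eq0 // -lt0n.
pose x := sgval s^-1%g y.
have sx : sgval s x = y by rewrite /x /= permKV.
rewrite (bigD1 x) //= [X in _ + X]big1 => [|h hx]; last first.
  rewrite big1 // => z _; rewrite (Zp_mulgC y z) (inj_eq (mulgI z)).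
  case: eqP => [yh|]; last by rewrite mul0r.
  by case/eqP: hx; rewrite /x yh /= permK.
rewrite addr0 (eq_bigr (fun=> ch e x)) => [|z _]; last first.
  by rewrite sx (Zp_mulgC y z) eqxx mul1r.
rewrite sumr_const -[X in _ * X]mulr_natl mulKf //.
have eE : eigen pi zeta e := evec_eigen C_prim m_gt0 zetaL.
have /(_ s (AutZ_unit s) x erefl) := eE.
rewrite card_Zmod // AutZ_unit_coprime // part_pi'_nat // !modn1 => /(_ isT erefl) <-.
by rewrite -AutZE // sx.
Qed.

Definition constituent (G : finGroupType) (u : F G) : Prop :=
  exists phi : Chom A C (Zmod m) G, u = CR_map iota phi e.

Lemma constituent_subfunctor : subfunctor constituent.
Proof.
split=> [G|G c _ _ [phi ->] [psi ->]|G H phi _ [psi ->]].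
- by exists 0; rewrite [RHS](@fmap0l _ _ F).
- by exists (c *: phi + psi); rewrite CR_map_linearl.
- by exists (Ccomp phi psi); rewrite CR_map_comp.
Qed.

Lemma constituent_eigen (G : finGroupType) (u : F G) :
  constituent u -> eigen pi zeta u.
Proof. by case=> phi ->; apply: eigen_CR_map => //; apply: evec_eigen. Qed.

Lemma constituent_evec : constituent e.
Proof. by exists (Cid A C _); rewrite CR_map_id. Qed.

Local Notation S := (sub_functor constituent_subfunctor).

(** A nonzero subfunctor is a subfunctor of C R_C inside the eigenspace of zeta, so it contains the
    generator e by [eigen_core]. The value at [Zp1] identifies the evaluation at Z/m with C. *)
Lemma constituent_simple : is_simple_functor_at zeta S.
Proof.
pose eS : S (Zmod m) := exist _ _ constituent_evec.
split; first split.
- by exists (Zmod m), eS => /(congr1 sval); apply: evec_neq0.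
- move=> Q [Q0 QL QF].
  pose P (G : finGroupType) (u : F G) := exists h : constituent u, Q G (exist _ u h).
  have Qext (G : finGroupType) (x y : S G) : sval x = sval y -> Q G x -> Q G y.
    by move/sig_eq ->.
  have Psub : subfunctor P.
    split=> [G|G c u v [hu Qu] [hv Qv]|G H phi u [hu Qu]].
    + by exists (svalP (0 : S G)); apply: Qext (Q0 G).
    + have h : constituent (c *: u + v) by case: constituent_subfunctor => _ L _; apply: L.
      by exists h; apply: Qext (QL _ c _ _ Qu Qv); rewrite sub_linE.
    + by exists (svalP (fmap phi (exist _ u hu : S G))); apply: Qext (QF _ _ phi _ Qu).
  have PE (G : finGroupType) (u : F G) : P G u -> eigen pi zeta u.
    by case=> hu _; apply: constituent_eigen.
  have [nz|z] := pselect (exists G (x : S G), Q G x /\ x <> 0); last first.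
    left=> G x Qx; apply: contrapT => x0; apply: z.
    by exists G, x.
  case: nz => G0 [x0 [Qx0 x0_neq0]].
  have Px0 : P G0 (sval x0) by exists (svalP x0); apply: Qext Qx0.
  have x0_neq0' : sval x0 <> 0 by move=> h; apply: x0_neq0; apply: sig_eq.
  have [he Qe] := eigen_core C_prim m_gt0 m_pi zetaP Psub PE Px0 x0_neq0'.
  right=> G [u [phi uphi]]; apply: Qext (QF _ _ phi _ Qe).
  by rewrite /= uphi.
- move=> H; rewrite card_Zmod // => Hm x; apply: sig_eq.
  exact: (eigen_small C_prim m_gt0 m_pi zetaP (constituent_eigen (svalP x)) Hm).
exists (fun c : C^o => c *: eS); split.
- by move=> a c d; rewrite scalerDl scalerA.
- have sE c : sval (c *: eS) = c *: e by rewrite -[c *: eS]addr0 sub_linE addr0.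
  exists (fun x : S (Zmod m) => @ch C _ (sval x) Zp1) => [c|x].
    by rewrite sE chZ ch_evec1 mulr1.
  apply: sig_eq; rewrite sE -(eigen_evec C_prim m_gt0 zetaL m_pi zetaP) //.
  exact: constituent_eigen (svalP x).
move=> s c; apply: sig_eq.
have sE d : sval (d *: eS) = d *: e by rewrite -[d *: eS]addr0 sub_linE addr0.
rewrite sE; transitivity (CR_map iota (bcls C (fb_aut A s)) (c *: e)); first by rewrite -sE.
have [_ /(_ s) se] := evec_essential.
rewrite -[c *: e]addr0 CR_map_linearr -/(fmap _ _) [X in c *: X]se.
by rewrite (linear_0 (CR_map_linearr _ _)) addr0 scalerA mulrC.
Qed.

End OneConstituent.
End SimpleConstituents.

HB.instance Definition _ (C : fieldType) (pi : nat_pred) := gen_eqMixin (Upsilon C pi).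
HB.instance Definition _ (C : fieldType) (pi : nat_pred) := gen_choiceMixin (Upsilon C pi).

(** * The decomposition into simple functors *)

Section Decomposition.
Variables (C : fieldType) (pi : nat_pred).
Hypothesis C_prim : forall n, (0 < n)%N -> exists z : C, n.-primitive_root z.
Notation A := (mu_pi C pi).
Notation iota := (mu_embedding C pi).
Notation F := (functor_CR iota).
Notation I := (Upsilon C pi).
Local Notation Z i := (Zmod (ups_m i)).
Local Notation e i := (evec pi C_prim (ups_zeta i)).

(** The usual independence of eigenvectors: composing the relation with a power map and subtracting
    a multiple of it eliminates [w j]. If [w i] were nonzero, the eigenvalues of i and j would agree
    for all admissible exponents, against [Upsilon_eq]. *)
Lemma eigen_independent (G : finGroupType) (s : seq I) (w : I -> CR C G) : uniq s ->
    (forall i, i \in s -> eigen pi (ups_zeta i) (w i)) -> \sum_(i <- s) w i = 0 ->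
  forall i, i \in s -> w i = 0.
Proof.
elim: s w => [//|j s IH] w /= /andP [js us] wE w0.
have ws i : i \in s -> w i = 0.
  move=> si; have ij : i <> j by move=> ij; rewrite -ij si in js.
  (* All the moduli enter L, so that an exponent prime to L is a unit modulo each of them at
     once. *)
  pose L := (#|G| * \prod_(k <- j :: s) ups_m k)%N.
  have L_gt0 : (0 < L)%N.
    rewrite muln_gt0 cardT_gt0 prodn_cond_gt0 // => k _; exact: Upsilon_gt0.
  apply: contrapT => wi; apply: ij; apply: (Upsilon_eq L_gt0) => t t0 k kt kt0 kL k1.
  have kG : coprime k #|G| by rewrite (coprime_dvdr _ kL) // dvdn_mulr.
  have k1G : k = 1%N %[mod (#|G|)`_pi].
    by apply: modn_weaken k1; apply: partn_dvd; rewrite // dvdn_mulr.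
  have skP l : exists u : AutZ (ups_m l), l \in j :: s -> k = AutZ_unit u %[mod ups_m l].
    have [lj|lj] := boolP (l \in j :: s); last by exists 1%g.
    have kl : coprime k (ups_m l).
      apply: coprime_dvdr kL; apply: dvdn_mull.
      by rewrite (big_rem l lj) dvdn_mulr.
    by have [u uk] := AutZ_lift (Upsilon_gt0 l) kl; exists u.
  pose sk l := sval (cid (skP l)).
  have skE l : l \in j :: s -> k = AutZ_unit (sk l) %[mod ups_m l] := svalP (cid (skP l)).
  have skj : sk j = t0.
    by apply: (AutZ_eq (Upsilon_gt0 j)); rewrite -skE ?inE ?eqxx.
  have ski : sk i = t.
    by apply: (AutZ_eq (Upsilon_gt0 i)); rewrite -skE // inE si orbT.
  pose z l := ups_zeta l (sk l).
  have z_neq0 l : z l != 0 by apply: lin_char_neq0; have [] := ups_primitive l.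
  have wk l x : l \in j :: s -> ch (w l) (x ^+ k)%g = (z l)^-1 * ch (w l) x.
    by move=> ls; rewrite -(wE l ls (sk l) k x (skE l ls) kG k1G) mulKf.
  have w'0 : \sum_(l <- s) ((z l)^-1 - (z j)^-1) *: w l = 0.
    apply: (ch_inj C_prim) => x; rewrite ch0 ch_sum.
    have sum0 y : \sum_(l <- j :: s) ch (w l) y = 0 by rewrite -ch_sum w0 ch0.
    transitivity (\sum_(l <- j :: s) (ch (w l) (x ^+ k)%g - (z j)^-1 * ch (w l) x)).
      rewrite big_cons wk ?inE ?eqxx // subrr add0r !big_seq; apply: eq_bigr => l ls.
      by rewrite chZ wk ?inE ?ls ?orbT // mulrBl.
    by rewrite sumrB -mulr_sumr !sum0 mulr0 subrr.
  have w'E l : l \in s -> eigen pi (ups_zeta l) (((z l)^-1 - (z j)^-1) *: w l).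
    move=> ls; rewrite -[_ *: _]addr0; apply: eigen_lin; last exact: eigen0.
    by apply: wE; rewrite inE ls orbT.
  have /eqP := IH _ us w'E w'0 i si; rewrite scaler_eq0 subr_eq0 => /orP [/eqP|/eqP //].
  by move/invr_inj; rewrite /z ski skj.
move=> i; rewrite inE => /orP [/eqP ->|]; last exact: ws.
by move: w0; rewrite big_cons big_seq big1 ?addr0.
Qed.

Section Embedding.
Variables (m : nat) (zeta : {ffun AutZ m -> C}).
Hypotheses (m_gt0 : (0 < m)%N) (m_pi : pi^'.-nat m) (zetaP : primitive zeta).
Local Notation ez := (evec pi C_prim zeta).
Variable S : fbfunctor A C.
Hypothesis S_simple : is_simple_functor_at zeta S.

Lemma essential_vector_exists :
  exists2 t : S (Zmod m), @essential_vector C pi m zeta S t & t <> 0.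
Proof.
have [_ S_small [f [fL [f' fK f'K] f_aut]]] := S_simple.
exists (f 1); last first.
  rewrite -(linear_0 fL) => /(can_inj fK)/eqP; apply/negP; exact: oner_neq0.
split=> [H phi Hm|s]; first by apply: S_small; rewrite card_Zmod.
by rewrite f_aut -[RHS]addr0 -(linear_0 fL) -fL addr0.
Qed.

Lemma simple_embedding : exists theta : forall G : finGroupType, S G -> CR C G,
  [/\ forall G, linear (theta G),
      forall G H (phi : Chom A C G H) x, theta H (fmap phi x) = CR_map iota phi (theta G x),
      forall G x, theta G x = 0 -> x = 0,
      forall G x, eigen pi zeta (theta G x) &
      exists t, theta (Zmod m) t = ez].
Proof.
have [[_ S_sub] _ _] := S_simple.
have [t t_ess t_neq0] := essential_vector_exists.
have e_ess := evec_essential C_prim m_gt0 m_pi zetaP.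
have eE : eigen pi zeta ez := evec_eigen C_prim m_gt0 zetaP.1.
have e_neq0 : ez <> 0 := evec_neq0 m_gt0 zetaP.
have S_gen (G : finGroupType) (x : S G) : exists phi : Chom A C (Zmod m) G, x = fmap phi t.
  case: (S_sub (fun G x => exists phi : Chom A C (Zmod m) G, x = fmap phi t)) => [|S0|//].
    split=> [H|H c _ _ [phi ->] [psi ->]|H K phi _ [psi ->]].
    - by exists 0; rewrite fmap0l.
    - by exists (c *: phi + psi); rewrite fmap_linearl.
    - by exists (Ccomp phi psi); rewrite fmap_comp.
  by case: t_neq0; apply: S0; exists (Cid A C _); rewrite fmap_id.
(* For endomorphisms of Z/m the equivalence holds because t and e are multiplied by the same
   scalar. *)
have scal_ker (phi : Chom A C (Zmod m) (Zmod m)) :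
    (fmap phi t = 0 -> CR_map iota phi ez = 0) /\ (CR_map iota phi ez = 0 -> fmap phi t = 0).
  have [c phi_c] := endomorphism_scalar zeta m_gt0 m_pi phi.
  rewrite (phi_c _ _ t_ess) -[CR_map _ _ _]/(fmap (f := F) phi ez) (phi_c F _ e_ess).
  by split=> /eqP; rewrite scaler_eq0 => /orP [/eqP -> |/eqP //]; rewrite scale0r.
have t_e (G : finGroupType) (phi : Chom A C (Zmod m) G) : fmap phi t = 0 -> CR_map iota phi ez = 0.
  move=> phit; apply: contrapT => phie.
  (* If nonzero, this subfunctor contains e, giving an endomorphism f of Z/m with f t = 0 and f e =
     e, against the equal scalars. *)
  pose P (G : finGroupType) (u : CR C G) :=
    exists2 phi : Chom A C (Zmod m) G, fmap phi t = 0 & u = CR_map iota phi ez.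
  have Psub : @subfunctor A C F P.
    split=> [H|H c _ _ [f f0 ->] [g g0 ->]|H K f _ [g g0 ->]].
    - by exists 0; rewrite ?fmap0l // [RHS](@fmap0l _ _ F).
    - by exists (c *: f + g); rewrite ?fmap_linearl ?f0 ?g0 ?scaler0 ?addr0 // CR_map_linearl.
    - by exists (Ccomp f g); rewrite ?fmap_comp ?g0 ?fmap0r // CR_map_comp.
  have PE (H : finGroupType) (u : CR C H) : P H u -> eigen pi zeta u.
    by case=> f _ ->; apply: eigen_CR_map.
  have [f f0 ef] : P (Zmod m) ez.
    by apply: (eigen_core C_prim m_gt0 m_pi zetaP Psub PE _ phie); exists phi.
  by apply: e_neq0; rewrite ef; apply: (scal_ker f).1.
have e_t (G : finGroupType) (phi : Chom A C (Zmod m) G) : CR_map iota phi ez = 0 -> fmap phi t = 0.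
  (* By simplicity this subfunctor of S is zero or contains t; the latter gives f e = 0 and f t = t,
     again impossible. *)
  move=> phie; pose Q (G : finGroupType) (x : S G) :=
    exists2 phi : Chom A C (Zmod m) G, CR_map iota phi ez = 0 & x = fmap phi t.
  have Qsub : subfunctor Q.
    split=> [H|H c _ _ [f f0 ->] [g g0 ->]|H K f _ [g g0 ->]].
    - by exists 0; rewrite ?fmap0l // [LHS](@fmap0l _ _ F).
    - exists (c *: f + g); rewrite ?fmap_linearl // CR_map_linearl f0 g0.
      by rewrite scaler0 addr0.
    - exists (Ccomp f g); rewrite ?fmap_comp // CR_map_comp g0.
      exact: (@fmap0r _ _ F).
  have [Q0|QT] := S_sub Q Qsub; first by apply: Q0; exists phi.
  have [f f0 tf] := QT _ t.
  by case: t_neq0; rewrite tf; apply: (scal_ker f).2.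
pose theta G (x : S G) := CR_map iota (sval (cid (S_gen G x))) ez.
have thetaE (G : finGroupType) (phi : Chom A C (Zmod m) G) :
    theta G (fmap phi t) = CR_map iota phi ez.
  rewrite /theta; case: cid => psi /= e_psi; apply/eqP; rewrite eq_sym -subr_eq0; apply/eqP.
  rewrite addrC -scaleN1r -CR_map_linearl; apply: t_e.
  by rewrite fmap_linearl -e_psi scaleN1r addNr.
exists theta; split.
- move=> G c x y; have [phi ->] := S_gen G x; have [psi ->] := S_gen G y.
  by rewrite -fmap_linearl !thetaE CR_map_linearl.
- by move=> G H phi x; have [psi ->] := S_gen G x; rewrite -fmap_comp !thetaE CR_map_comp.
- by move=> G x; have [phi ->] := S_gen G x; rewrite thetaE; apply: e_t.
- by move=> G x; have [phi ->] := S_gen G x; rewrite thetaE; apply: eigen_CR_map.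
by exists t; rewrite -[t in LHS](fmap_id (f := S)) thetaE CR_map_id.
Qed.
End Embedding.

Section SumMap.
Variable S : I -> fbfunctor A C.
Hypothesis S_simple : forall i, is_simple_functor_at (ups_zeta i) (S i).

Let theta_ex i := simple_embedding (Upsilon_gt0 i) (ups_nat i) (ups_primitive i) (S_simple i).
Let theta i (G : finGroupType) : S i G -> CR C G := sval (cid (theta_ex i)) G.

Let theta_lin i G : linear (@theta i G).
Proof. by rewrite /theta; case: cid => f [/= fL]. Qed.

Let theta_nat i G H (phi : Chom A C G H) x :
  theta (fmap phi x) = CR_map iota phi (@theta i G x).
Proof. by rewrite /theta; case: cid => f [/= _ fN]. Qed.

Let theta_inj i G x : @theta i G x = 0 -> x = 0.
Proof. by rewrite /theta; case: cid => f [/= _ _ fI _ _]; apply: fI. Qed.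

Let theta_eigen i G x : eigen pi (ups_zeta i) (@theta i G x).
Proof. by rewrite /theta; case: cid => f [/= _ _ _ fE _]; apply: fE. Qed.

Let theta_evec i : exists t, @theta i (Z i) t = e i.
Proof. by rewrite /theta; case: cid => f [/= _ _ _ _]. Qed.

Lemma dsum_support (G : finGroupType) (v : functor_dsum S G) :
  exists s : seq I, uniq s /\ forall i, i \notin s -> sval v i = 0.
Proof.
have /finite_seqP [s sE] := svalP v; exists (undup s); split=> [|i]; first exact: undup_uniq.
rewrite mem_undup => /negP si; apply: contrapT => vi; apply: si.
have : [set` s]%classic i by rewrite -sE.
by [].
Qed.

Definition dsum_sum (G : finGroupType) (v : functor_dsum S G) : CR C G :=
  \sum_(i <- sval (cid (dsum_support v))) theta (sval v i).

(** Any finite list containing the support gives the same sum, so that two vectors can be summed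
    over a common list. *)
Lemma dsum_sumE (G : finGroupType) (v : functor_dsum S G) (s : seq I) :
  uniq s -> (forall i, i \notin s -> sval v i = 0) -> dsum_sum v = \sum_(i <- s) theta (sval v i).
Proof.
rewrite /dsum_sum; case: cid => r [/= ru rv] su sv.
have th0 i : sval v i = 0 -> theta (sval v i) = 0.
  by move=> ->; apply: (linear_0 (@theta_lin i G)).
have restrict (p q : seq I) : (forall i, i \notin q -> sval v i = 0) ->
    \sum_(i <- p) theta (sval v i) = \sum_(i <- [seq i <- p | i \in q]) theta (sval v i).
  move=> qv; rewrite big_filter [RHS]big_mkcond; apply: eq_bigr => i _.
  by case: ifP => // /negbT/qv/th0.
rewrite (restrict r s sv) (restrict s r rv); apply: perm_big; apply: uniq_perm.
- exact: filter_uniq.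
- exact: filter_uniq.
by move=> i; rewrite !mem_filter andbC.
Qed.

Lemma dsum_sum_linear (G : finGroupType) : linear (@dsum_sum G).
Proof.
move=> c u v; have [r [ru rv]] := dsum_support u; have [s [su sv]] := dsum_support v.
pose q := undup (r ++ s).
have uq i : i \notin q -> sval u i = 0.
  by rewrite mem_undup mem_cat negb_or => /andP [/rv].
have vq i : i \notin q -> sval v i = 0.
  by rewrite mem_undup mem_cat negb_or => /andP [_ /sv].
have wE i : sval (c *: u + v) i = c *: sval u i + sval v i by rewrite dsumD dsumZ.
rewrite (@dsum_sumE _ u q) ?undup_uniq // (@dsum_sumE _ v q) ?undup_uniq //.
rewrite (@dsum_sumE _ (c *: u + v) q) ?undup_uniq // => [|i iq]; last first.
  by rewrite [LHS]wE uq // vq // scaler0 addr0.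
rewrite scaler_sumr -big_split; apply: eq_bigr => i _ /=.
by rewrite -theta_lin; congr theta; apply: wE.
Qed.

Lemma dsum_sum_natural (G H : finGroupType) (phi : Chom A C G H) v :
  dsum_sum (fmap phi v) = CR_map iota phi (dsum_sum v).
Proof.
have [s [su sv]] := dsum_support v; rewrite (dsum_sumE su sv).
rewrite (dsum_sumE su) => [|i /sv iv]; last by rewrite /= iv fmap0r.
rewrite (big_morph (CR_map iota phi) (id1 := 0) (op1 := +%R)) => [|x y|].
- by apply: eq_bigr => i _; rewrite /= theta_nat.
- by rewrite -[x]scale1r CR_map_linearr !scale1r.
exact: (@fmap0r _ _ F).
Qed.

Lemma dsum_sum_inj (G : finGroupType) : injective (@dsum_sum G).
Proof.
suff ker0 v : @dsum_sum G v = 0 -> v = 0.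
  move=> u v uv; apply/eqP; rewrite -subr_eq0; apply/eqP/ker0.
  by rewrite addrC -scaleN1r dsum_sum_linear uv scaleN1r addNr.
have [s [su sv]] := dsum_support v; rewrite (dsum_sumE su sv) => v0.
apply: dsum_eq => i; have [si|/sv -> //] := boolP (i \in s).
apply: theta_inj.
exact: (@eigen_independent G s (fun i => theta (sval v i)) su (fun i _ => theta_eigen _) v0 i si).
Qed.

(** The image is a subfunctor containing every e, reached from a vector concentrated in one
    component; [evec_generate] concludes. *)
Lemma dsum_sum_surj (G : finGroupType) u : exists v, @dsum_sum G v = u.
Proof.
apply: (evec_generate (C_prim := C_prim) (P := fun G u => exists v, @dsum_sum G v = u)).
  split=> [H|H c _ _ [u1 <-] [u2 <-]|H K phi _ [v <-]].
  - by exists 0; apply: (linear_0 (@dsum_sum_linear H)).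
  - by exists (c *: u1 + u2); apply: dsum_sum_linear.
  - by exists (fmap phi v); apply: dsum_sum_natural.
move=> i; have [t te] := theta_evec i.
pose f : forall j, S j (Z i) := dfwith (fun j => 0 : S j (Z i)) t.
have f0 j : j \notin [:: i] -> f j = 0.
  by rewrite inE => ji; rewrite /f dfwith_out // eq_sym.
have f_fin : finite_set [set j | f j <> 0]%classic.
  apply: sub_finite_set (finite_set1 i) => j /= fj; apply: contrapT => ji; apply: fj.
  by apply: f0; rewrite inE; apply/eqP.
exists (exist _ f f_fin); rewrite (@dsum_sumE _ _ [:: i]) //.
by rewrite big_seq1 /= /f dfwith_in.
Qed.

Lemma CR_decomposition : functor_iso F (functor_dsum S).
Proof.
have bij G : bijective (@dsum_sum G) := bij_of (@dsum_sum_inj G) (@dsum_sum_surj G).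
have inv G : exists g, cancel (@dsum_sum G) g /\ cancel g (@dsum_sum G).
  by have [g gK Kg] := bij G; exists g.
exists (fun G => sval (cid (inv G))); split=> [G|G|G H phi x].
- by case: cid => g [/= gK Kg]; apply: (lin_inv (@dsum_sum_linear G)).
- by case: cid => g [/= gK Kg]; exists (@dsum_sum G).
case: (cid (inv G)) => g [/= gK Kg]; case: (cid (inv H)) => h [/= hK Kh].
by apply: (can_inj hK); rewrite Kh dsum_sum_natural Kg.
Qed.
End SumMap.
End Decomposition.

(** X^n - 1 splits and is separable, so it has n distinct roots, among which one is primitive. *)
Lemma closed_prim_root (F : closedFieldType) n : n%:R != 0 :> F ->
  exists z : F, n.-primitive_root z.
Proof.
move=> n_neq0; have n_gt0 : (0 < n)%N by case: n n_neq0 => //; rewrite eqxx.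
have [r rE] := closed_field_poly_normal ('X^n - 1 : {poly F}).
have p_monic : ('X^n - 1 : {poly F}) \is monic by apply: monicXnsubC.
rewrite (eqP p_monic) scale1r in rE.
have r_uniq : uniq r by rewrite -separable_prod_XsubC -rE separable_Xn_sub_1.
have r_size : size r = n.
  by have := size_XnsubC (1 : F) n_gt0; rewrite rE size_prod_XsubC => -[].
have : has n.-primitive_root r.
  apply: has_prim_root; rewrite ?r_size //.
  apply/allP => z zr; have : root ('X^n - 1) z by rewrite rE root_prod_XsubC.
  by [].
by case/hasP => z _ zP; exists z.
Qed.

(** The simple functors enter through their characterization, so the isomorphism is stated for any
    choice of them; the first half supplies such a choice. *)
Theorem theorem1 (R : realType) (pi : nat_pred)
    (pi_prime : forall p : nat, p \in pi -> prime p) :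
  (forall i : Upsilon R[i] pi, exists S : fbfunctor (mu_pi R[i] pi) R[i],
     is_simple_functor_at (ups_zeta i) S) /\
  (forall S : Upsilon R[i] pi -> fbfunctor (mu_pi R[i] pi) R[i],
     (forall i : Upsilon R[i] pi, is_simple_functor_at (ups_zeta i) (S i)) ->
     functor_iso (functor_CR (mu_embedding R[i] pi)) (functor_dsum S)).
Proof.
have C_prim n : (0 < n)%N -> exists z : R[i], n.-primitive_root z.
  by move=> n_gt0; apply: closed_prim_root; rewrite pnatr_eq0 -lt0n.
split=> [i|S S_simple]; last exact: (@CR_decomposition _ pi C_prim S S_simple).
exists (sub_functor (constituent_subfunctor pi C_prim (ups_zeta i))).
exact: (constituent_simple C_prim (Upsilon_gt0 i) (ups_nat i) (ups_primitive i)).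
Qed.
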